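(* Let $A\subset\mathbb{R}$ be a bounded $F_\sigma$-set which contains $0$, and define $$\varphi_A(x):=h(x)-\mathbb{P}_x[h(X_{T_A})],\qquad x\in\mathbb{R}.$$ Then for every $t\ge0$, every bounded $\mathcal{F}_t$-measurable functional $F_t$, and every $x\in\mathbb{R}$ with $\varphi_A(x)\ne0$, $$\lim_{q\to0+}\mathbb{P}_x[F_t\mid\boldsymbol{e}_q<T_A]=\mathbb{P}_x\left[F_t\cdot\frac{\varphi_A(X_t)}{\varphi_A(x)}1_{\{T_A>t\}}\right].$$
   Context: $((X_t)_{t\ge0},(\mathbb{P}_x)_{x\in\mathbb{R}})$ is the canonical representation of a one-dimensional Lévy process with $X_0=x$, $\mathbb{P}_x$-a.s.; $\mathbb{P}_x[\cdot]$ also denotes expectation and $\mathbb{P}_x[F\mid B]=\mathbb{P}_x[F;B]/\mathbb{P}_x(B)$. Put $\mathcal{F}^X_t=\sigma(X_s,0\le s\le t)$ and $\mathcal{F}_t=\bigcap_{s>t}\mathcal{F}^X_s$. The characteristic exponent $\Psi$ is given by $\mathbb{P}_0[e^{i\lambda X_t}]=e^{-t\Psi(\lambda)}$. Standing assumptions: $X$ is recurrent, every point is regular for itself, and (A) $\int_0^\infty\left|\frac{1}{q+\Psi(\lambda)}\right|d\lambda<\infty$ for all $q>0$. Then $X$ has a bounded continuous resolvent density $r_q$, i.e. $\int_{\mathbb{R}}f(x)r_q(x)dx=\mathbb{P}_0[\int_0^\infty e^{-qt}f(X_t)dt]$ for $q>0$, $f\ge0$. Put $h_q(x):=r_q(0)-r_q(-x)$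 and $h(x):=\lim_{q\to0+}h_q(x)$ (known to exist and be finite, and $h$ is continuous). $T_A:=\inf\{t\ge0: X_t\in A\}$, and $\boldsymbol{e}_q$ is an exponential random variable with parameter $q>0$ independent of $X$. *)

(* Defs.v *)
From HB Require Import structures.
From mathcomp Require Import all_boot all_order all_algebra.
From mathcomp Require Import all_classical all_reals all_analysis.
From mathcomp Require Import borel_hierarchy complex.

Set Implicit Arguments.
Unset Strict Implicit.
Unset Printing Implicit Defensive.

Import Order.TTheory GRing.Theory Num.Theory.
Import numFieldNormedType.Exports.

Local Open Scope classical_set_scope.
Local Open Scope ring_scope.
Local Open Scope complex_scope.

(* Paths are indexed by all of R because [0, +oo[ is not a type of its own;
   the last clause freezes the path on negative times, so that these functions
   are in bijection with the cadlag functions on [0, +oo[. *)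
Definition is_cadlag (R : realType) (w : R -> R) : Prop :=
  [/\ forall t, 0 <= t -> w s @[s --> t^'+] --> w t,
      forall t, 0 < t -> exists l : R, w s @[s --> t^'-] --> l
    & forall t, t < 0 -> w t = w 0].

Record cadlag (R : realType) := Cadlag {
  path_fun :> R -> R ;
  path_cadlag : is_cadlag path_fun }.

Lemma is_cadlag_cst (R : realType) (x : R) : is_cadlag (cst x).
Proof.
by split=> [t _|t _|//]; [exact: cvg_cst|exists x; exact: cvg_cst].
Qed.

Lemma is_cadlagD (R : realType) (x : R) (w : R -> R) :
  is_cadlag w -> is_cadlag (fun t => x + w t).
Proof.
case=> wr wl wn; split=> [t /wr wt|t /wl[l wt]|t /wn -> //].
- by apply: cvgD => //; exact: cvg_cst.
- by exists (x + l); apply: cvgD => //; exact: cvg_cst.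
Qed.

Definition translate (R : realType) (x : R) (w : cadlag R) : cadlag R :=
  Cadlag (is_cadlagD x (path_cadlag w)).

HB.instance Definition _ (R : realType) := gen_eqMixin (cadlag R).
HB.instance Definition _ (R : realType) := gen_choiceMixin (cadlag R).
HB.instance Definition _ (R : realType) :=
  isPointed.Build (cadlag R) (Cadlag (is_cadlag_cst 0)).

Definition cylinders (R : realType) (I : set R) : set (set (cadlag R)) :=
  [set C | exists s (B : set R),
    [/\ I s, measurable B & C = [set w : cadlag R | B (w s)]]].

HB.instance Definition _ (R : realType) :=
  @isMeasurable.Build (sigma_display (@cylinders R [set s | 0 <= s])) (cadlag R)
    <<s cylinders [set s | 0 <= s] >> (@sigma_algebra0 _ setT _)
    (@sigma_algebraC (cadlag R) _) (@sigma_algebra_bigcup _ setT _).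

Definition natural_filtration (R : realType) (t : R) : set (set (cadlag R)) :=
  <<s @cylinders R [set s | 0 <= s <= t] >>.

Definition right_filtration (R : realType) (t : R) : set (set (cadlag R)) :=
  \bigcap_(s in [set s | t < s]) natural_filtration s.

Record levy_family (R : realType) (P : R -> probability (cadlag R) R) : Prop := {
  levy_start : P 0 [set w : cadlag R | w 0 = 0] = 1%E ;
  levy_indep : forall (s t : R) (C : set (cadlag R)) (B : set R),
    0 <= s <= t -> natural_filtration s C -> measurable B ->
    P 0 (C `&` [set w : cadlag R | B (w t - w s)]) =
    (P 0%R C * P 0%R [set w : cadlag R | B (w t - w s)%R])%E ;
  levy_stationary : forall (s t : R) (B : set R),
    0 <= s <= t -> measurable B ->
    P 0 [set w : cadlag R | B (w t - w s)] =
    P 0 [set w : cadlag R | B (w (t - s))] ;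
  levy_translate : forall (x : R) (C : set (cadlag R)),
    measurable C -> P x C = P 0 (translate x @^-1` C) }.

Definition cexp (R : realType) (z : R[i]) : R[i] :=
  (expR (complex.Re z))%:C * (cos (complex.Im z) +i* sin (complex.Im z)).

Definition cexpect d (T : measurableType d) (R : realType)
    (P : probability T R) (Z : T -> R[i]) : R[i] :=
  (\int[P]_w complex.Re (Z w)) +i* (\int[P]_w complex.Im (Z w)).

(* This determines Psi: it is minus the derivative at t = 0 of the right-hand
   side. *)
Definition characteristic_exponent (R : realType)
    (P : R -> probability (cadlag R) R) (Psi : R -> R[i]) : Prop :=
  forall t l : R, 0 <= t ->
    cexpect (P 0) (fun w => cexp (0 +i* (l * w t))) = cexp (- (t%:C * Psi l)).

Definition recurrent (R : realType) (P : R -> probability (cadlag R) R) : Prop :=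
  {ae P 0, forall w : cadlag R,
    limf_einf (fun t : R => `|w t|%:E) (pinfty_nbhs R) = 0%E}.

Definition regular_for_itself (R : realType)
    (P : R -> probability (cadlag R) R) (x : R) : Prop :=
  {ae P x, forall w : cadlag R,
    ereal_inf [set s%:E | s in [set s : R | 0 < s /\ w s = x]] = 0%E}.

Definition resolvent_density (R : realType)
    (P : R -> probability (cadlag R) R) (q : R) (r : R -> R) : Prop :=
  forall f : R -> R, measurable_fun [set: R] f -> (forall x, 0 <= f x) ->
    (\int[lebesgue_measure]_x (f x * r x)%:E =
     \int[P 0%R]_w \int[lebesgue_measure]_(t in `[0%R, +oo[)
       (expR (- (q * t)) * f (w t))%:E)%E.

Definition hitting_time (R : realType) (A : set R) (w : cadlag R) : \bar R :=
  ereal_inf [set t%:E | t in [set t : R | 0 <= t /\ A (w t)]].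

(* Hitting times of F_sigma sets are measurable only for the completion of the
   path sigma-algebra. The library integral is a difference of suprema over
   measurable simple functions, defined for arbitrary integrands; on integrands
   measurable for the completed measure it equals the completed integral. For
   that reason probabilities of events involving a hitting time are written
   below as integrals, never as values of the measure. *)

Definition phi (R : realType) (P : R -> probability (cadlag R) R) (h : R -> R)
    (A : set R) (x : R) : R :=
  h x - \int[P x]_(w in [set w | (hitting_time A w < +oo)%E])
    h (w (fine (hitting_time A w))).

Definition elementary_cond_exp d (T : measurableType d) (R : realType)
    (P : probability T R) (F : T -> R) (B : set T) : R :=
  (\int[P]_(w in B) F w) / (\int[P]_(w in B) 1).

(* (T, Q x) is an extension of (cadlag R, P x), with projection Y, on which
   the clocks e q live. *)
Record exponential_clocks (R : realType) (P : R -> probability (cadlag R) R)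
    d (T : measurableType d) (Q : R -> probability T R) (Y : T -> cadlag R)
    (e : R -> T -> R) : Prop := {
  clock_path_measurable : measurable_fun [set: T] Y ;
  clock_path_law : forall (x : R) (C : set (cadlag R)),
    measurable C -> Q x (Y @^-1` C) = P x C ;
  clock_measurable : forall q : R, 0 < q -> measurable_fun [set: T] (e q) ;
  clock_law : forall (x q : R) (B : set R), 0 < q ->
    measurable B -> Q x (e q @^-1` B) = exponential_prob q B ;
  clock_indep : forall (x q : R) (C : set (cadlag R)) (B : set R), 0 < q ->
    measurable C -> measurable B ->
    Q x (Y @^-1` C `&` e q @^-1` B) = (Q x (Y @^-1` C) * Q x (e q @^-1` B))%E }.

(* Main.v *)
(* Write [rho_q x = r q (- x)] for the q-resolvent density at the origin seen from x,
   so that [h_q = rho_q 0 - rho_q], and let T be the hitting time of A. Since A contains 0,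
   the strong Markov property gives [rho_q x = P_x[exp(-qT) rho_q(X_T)]], hence
     phi_q x := rho_q 0 * P_x(e_q < T) = h_q x - P_x[exp(-qT) h_q(X_T)],
   and [phi_q --> phi_A] pointwise because [h_q] is bounded on a neighbourhood of A,
   uniformly in q <= 1. By the Markov property at time t, up to an error O(q * rho_q 0),
     rho_q 0 * P_x[F_t; e_q < T] = exp(-qt) P_x[F_t phi_q(X_t); t < T],
   so the theorem is the ratio of the limits, provided that [q * rho_q 0 --> 0] and that the
   limit can be taken under the last expectation. As [0 <= phi_q <= h_q], the latter follows
   from [P_x[h_q(X_t)] --> P_x[h(X_t)]]. Everything rests on two potential theoretic facts:
   [h_q] is nonnegative and subadditive, by hitting a point, and
   [exp(pt) rho_p - P_t rho_p] increases with p, P_t being the semigroup of X. *)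

(* The limit under the last expectation has no evident dominating function: [h_q] is bounded by
   [rho_q 0], for which no bound uniform in q is at hand. A Scheffe argument replaces domination:
   min(h_q, h) is dominated by h, so only an upper estimate of P_x[h_q(X_t)] is missing. By
   subadditivity its defect is asymptotically the same at all x, so one well-chosen x suffices;
   monotonicity in the rate then compares all small q with a fixed one. Two further obstacles shape
   the proof. Resolvent identities determine densities only almost everywhere, while hitting a point
   needs values at points: densities are therefore smoothed by tent functions and recovered by
   continuity. And the hitting time of an F_sigma set need not be measurable for the path
   sigma-algebra; quasi-left-continuity makes it an optional time outside a set that is null for all
   starting points, and the same continuity along increasing times carries the hitting identities
   from open sets to closed ones. *)
Require Import Defs.
From HB Require Import structures.
From mathcomp Require Import all_boot all_order all_algebra.
From mathcomp Require Import all_classical all_reals all_analysis.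
From mathcomp Require Import borel_hierarchy complex measurable_realfun.
From mathcomp Require Import ring lra.

Set Implicit Arguments.
Unset Strict Implicit.
Unset Printing Implicit Defensive.

Import Order.TTheory GRing.Theory Num.Theory.
Import numFieldNormedType.Exports.

Local Open Scope classical_set_scope.
Local Open Scope ring_scope.

(** * Integration *)

Section integration.
Local Open Scope ereal_scope.
Context d (T : measurableType d) (R : realType).

Import HBNNSimple.

Let le_integral_off_null (mu : {measure set T -> \bar R}) (N : set T)
    (f g : T -> \bar R) :
  measurable N -> mu N = 0 -> (forall x, 0 <= f x) -> (forall x, 0 <= g x) ->
  (forall x, ~ N x -> f x = g x) -> \int[mu]_x f x <= \int[mu]_x g x.
Proof.
move=> mN N0 f0 g0 fg; rewrite (ge0_integralTE _ f0); apply/ge_ereal_sup.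
move=> _ /= [u uf <-].
have mNC : measurable (~` N) by exact: measurableC.
pose v := proj_nnsfun u mNC.
have vE x : v x = (u \_ (~` N)) x by rewrite mrestrict.
have uE (w : {nnsfun T >-> R}) : sintegral mu w = \int[mu]_x (w x)%:E.
  by rewrite integral_nnsfun// patch_setT.
rewrite uE; have -> : \int[mu]_x (u x)%:E = \int[mu]_x (v x)%:E.
  apply: ge0_ae_eq_integral => //.
  - exact/measurable_EFinP/measurable_funP.
  - exact/measurable_EFinP/measurable_funP.
  - by move=> x _; rewrite lee_fin.
  - by move=> x _; rewrite lee_fin.
  exists N; split => // x /=; apply: contra_notP => Nx _.
  by have := vE x; rewrite patchE mem_set //= => ->.
rewrite -uE (ge0_integralTE _ g0).
apply: ereal_sup_ubound; exists v => // x; rewrite vE patchE.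
by case: ifPn => [/set_mem Nx|_]; [rewrite -fg|exact: g0].
Qed.

(* The integrands need not be measurable: the simple functions below f can be cut off on N. *)
Lemma integral_off_null (mu : {measure set T -> \bar R}) (N : set T)
    (f g : T -> \bar R) :
  measurable N -> mu N = 0 -> (forall x, ~ N x -> f x = g x) ->
  \int[mu]_x f x = \int[mu]_x g x.
Proof.
move=> mN N0 fg; rewrite integralE [RHS]integralE; congr (_ - _);
  apply/eqP; rewrite eq_le; apply/andP; split;
  apply: (le_integral_off_null mN N0) => // x Nx;
  by rewrite ?funeposE ?funenegE fg.
Qed.

End integration.

Section bounded_convergence.
Local Open Scope ereal_scope.
Context d (T : measurableType d) (R : realType) (P : probability T R).

Lemma integrable_bounded (f : T -> R) (M : R) :
  measurable_fun setT f -> (forall x, `|f x| <= M)%R ->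
  P.-integrable setT (EFin \o f).
Proof.
move=> mf fM; apply: (@le_integrable _ _ _ _ _ measurableT _ (cst M%:E)).
- exact/measurable_EFinP.
- by move=> x _ /=; rewrite lee_fin (le_trans (fM x))// ler_norm.
- exact: finite_measure_integrable_cst.
Qed.

Lemma cvg_integral_bounded (f_ : nat -> T -> R) (f : T -> R) (M : R) :
  (forall n, measurable_fun setT (f_ n)) -> (forall n x, `|f_ n x| <= M)%R ->
  (forall x, f_ n x @[n --> \oo] --> f x) ->
  \int[P]_x (f_ n x)%:E @[n --> \oo] --> \int[P]_x (f x)%:E.
Proof.
move=> mf fM ff; have mf' : measurable_fun setT f.
  by apply: (measurable_fun_cvg mf) => x _; exact: ff.
have [] // := @dominated_convergence _ _ _ P setT measurableT
  (fun n => EFin \o f_ n) (EFin \o f) (cst M%:E).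
- by move=> n; exact/measurable_EFinP.
- exact/measurable_EFinP.
- by apply/aeW => x _; apply: cvg_EFin; [exact: nearW|exact: ff].
- exact: finite_measure_integrable_cst.
- by apply/aeW => x n _ /=; rewrite lee_fin.
Qed.

End bounded_convergence.

Section independence.
Local Open Scope ereal_scope.
Context d (T : measurableType d) (R : realType) (P : probability T R).
Context d1 (T1 : measurableType d1) d2 (T2 : measurableType d2).
Variables (U : T -> T1) (V : T -> T2) (Q : probability T2 R).
Hypotheses (mU : measurable_fun setT U) (mV : measurable_fun setT V).
Hypothesis indep : forall A B, measurable A -> measurable B ->
  P (U @^-1` A `&` V @^-1` B) = P (U @^-1` A) * Q B.

Let mUmixin := isMeasurableFun.Build _ _ _ _ _ mU.
Let Upack : {mfun _ >-> _} := HB.pack U mUmixin.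

(** The pair has a product law, so this is Tonelli. [T1] may carry a coarser sigma-algebra than [T]:
    with [U] the identity into a type of past events, conditioning on the past becomes an integral
    with [U] frozen. *)
Lemma integral_indep (g : T1 * T2 -> \bar R) :
  measurable_fun setT g -> (forall x, 0 <= g x) ->
  \int[P]_x g (U x, V x) = \int[P]_x \int[Q]_y g (U x, y).
Proof.
move=> mg g0; have mUV : measurable_fun setT (fun x => (U x, V x)).
  exact: measurable_fun_pair.
rewrite -(@ge0_integral_pushforward _ _ _ _ _ _ mUV P setT)//.
transitivity (\int[(distribution P Upack \x Q)%E]_z g z).
  apply: eq_measure_integral => /= A mA _; apply/esym.
  apply: (@product_measure_unique _ _ _ _ _ _ _
    (pushforward P (fun x => (U x, V x)))) => //= B C mB mC; exact: indep.
rewrite fubini_tonelli1// ge0_integral_pushforward//.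
  exact: measurable_fun_fubini_tonelli_F.
by move=> x _; apply: integral_ge0.
Qed.

End independence.

Section lebesgue_translation.
Local Open Scope ereal_scope.
Context {R : realType}.
Local Notation mu := lebesgue_measure.

Let maddr (a : R) : measurable_fun setT (fun x : measurableTypeR R => (x + a)%R : measurableTypeR R).
Proof. exact: measurable_funD. Qed.

Lemma lebesgue_measureD (a : R) (A : set R) : measurable A ->
  mu ((fun x => x + a)%R @^-1` A) = mu A.
Proof.
move=> mA; apply/esym.
apply: (@lebesgue_measure_unique _ (pushforward mu (fun x : measurableTypeR R => (x + a)%R : measurableTypeR R))) => //= _ [[b c]] _ <-.
rewrite /pushforward.
rewrite (_ : _ @^-1` _ = `](b - a)%R, (c - a)%R]%classic); last first.
  by apply/seteqP; split => x /=; rewrite !in_itv/= ltrBlDr lerBrDr.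
rewrite !lebesgue_measure_itv/= !lte_fin ltrD2r.
by case: ifP => // _; rewrite -!EFinB; congr EFin; ring.
Qed.

Lemma ge0_integral_translation (a : R) (f : R -> \bar R) :
  measurable_fun setT f -> (forall x, 0 <= f x) ->
  \int[mu]_x f (x + a)%R = \int[mu]_x f x.
Proof.
move=> mf f0; rewrite -(@ge0_integral_pushforward _ _ _ _ _ _ (maddr a) mu setT)//.
by apply: eq_measure_integral => /= A mA _; exact: lebesgue_measureD.
Qed.

Lemma ge0_integral_reflection (a : R) (f : R -> \bar R) :
  measurable_fun setT f -> (forall x, 0 <= f x) ->
  \int[mu]_x f (a - x)%R = \int[mu]_x f x.
Proof.
move=> mf f0; rewrite -(ge0_integral_translation a mf f0).
pose g (x : measurableTypeR R) := f (x + a)%R.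
have mg : measurable_fun setT g by apply: measurableT_comp mf (maddr a).
pose N (x : measurableTypeR R) : measurableTypeR R := (- x)%R.
have mN : measurable_fun setT N by exact: measurable_funN.
transitivity (\int[pushforward mu N]_x g x).
  rewrite (@ge0_integral_pushforward _ _ _ _ _ _ mN mu)//.
  by apply: eq_integral => x _ /=; rewrite /g addrC.
  by move=> x _; exact: f0.
by apply: eq_measure_integral => /= A mA _; exact: lebesgue_measureN.
Qed.

End lebesgue_translation.

(** * Path space *)

Section path_space.
Context {R : realType}.
Implicit Types (w : cadlag R) (s t : R).

Lemma cadlag_right w t e : 0 <= t -> 0 < e ->
  exists2 delta, 0 < delta & forall s, t <= s < t + delta -> `|w s - w t| < e.
Proof.
move=> t0 e0; case: (path_cadlag w) => /(_ _ t0) /cvgrPdist_lt /(_ _ e0) wt _ _.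
case: wt => delta /= delta0 wt; exists delta => // s /andP[ts std].
have [->|nts] := eqVneq s t; first by rewrite subrr normr0.
rewrite distrC; apply: wt => /=; last by rewrite lt_neqAle eq_sym nts.
by rewrite ltr0_norm ?subr_lt0 ?lt_neqAle 1?eq_sym ?nts//; lra.
Qed.

Lemma cadlag_left w t : 0 < t -> exists l, forall e, 0 < e ->
  exists2 delta, 0 < delta & forall s, t - delta < s < t -> `|w s - l| < e.
Proof.
move=> t0; case: (path_cadlag w) => _ /(_ _ t0)[l wl] _; exists l => e e0.
move/cvgrPdist_lt : wl => /(_ _ e0)[delta /= delta0 wl].
exists delta => // s /andP[tds st]; rewrite distrC; apply: wl => //=.
by rewrite gtr0_norm ?subr_gt0 //; lra.
Qed.

Lemma cadlag_neg w t : t <= 0 -> w t = w 0.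
Proof.
by rewrite le_eqVlt => /predU1P[->//|t0]; case: (path_cadlag w) => _ _; exact.
Qed.

Lemma cadlag_cvg w t (u : R^nat) : 0 <= t -> (forall n, t <= u n) ->
  u n @[n --> \oo] --> t -> w (u n) @[n --> \oo] --> w t.
Proof.
move=> t0 tu /cvgrPdist_lt ut; apply/cvgrPdist_lt => e e0.
have [delta delta0 wt] := cadlag_right w t0 e0.
near=> n; rewrite distrC wt// tu/=.
have : `|t - u n| < delta by near: n; exact: ut.
by rewrite ltr_norml => /andP[+ _]; lra.
Unshelve. all: by end_near. Qed.

(** Clipping s at 0 freezes the path at negative times, as [is_cadlag] demands; clipping t keeps all
    evaluations at times where the path is right-continuous. *)
Let is_cadlag_increment t w :
  is_cadlag (fun s => w (Num.max t 0 + Num.max s 0) - w (Num.max t 0)).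
Proof.
set t' := Num.max t 0; have t0 : 0 <= t' by rewrite le_max lexx orbT.
split.
- move=> s s0; apply/cvg_at_rightP => u [su us].
  apply: cvgB; last exact: cvg_cst.
  rewrite (max_idPl s0).
  apply: cadlag_cvg; first by rewrite addr_ge0.
  + by move=> n; rewrite lerD2l le_max ltW.
  + apply: cvgD; first exact: cvg_cst.
    rewrite [X in X @ _ --> _](_ : _ = u)//; apply/funext => n.
    by rewrite (max_idPl _)// (le_trans s0)// ltW.
- move=> s s0; have ts0 : 0 < t' + s by rewrite ltr_wpDl.
  have [l wl] := cadlag_left w ts0; exists (l - w t').
  apply/cvgrPdist_lt => e e0; have [delta delta0 wd] := wl _ e0.
  near=> u; rewrite opprB addrA subrK distrC.
  have u0 : 0 < u by near: u; exact: nbhs_left_gt.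
  rewrite (max_idPl (ltW u0)); apply: wd; apply/andP; split.
    rewrite -addrA ltrD2l; near: u; apply: nbhs_left_gt.
    by rewrite ltrBlDr ltrDl.
  by rewrite ltrD2l; near: u; exact: nbhs_left_lt.
- by move=> s s0; rewrite (max_idPr (ltW s0)) maxxx.
Unshelve. all: by end_near. Qed.

Definition increment t w : cadlag R := Cadlag (is_cadlag_increment t w).

Lemma incrementE t w s : 0 <= t -> 0 <= s -> increment t w s = w (t + s) - w t.
Proof. by move=> t0 s0; rewrite /= !(max_idPl _). Qed.

(** The usual shift of paths, built from the increment so that the Markov property reduces to the
    independence of the increments after t from the past. *)
Definition path_shift t w := translate (w t) (increment t w).

Lemma path_shiftE t w s : 0 <= t -> 0 <= s -> path_shift t w s = w (t + s).
Proof. by move=> t0 s0; rewrite [LHS]/= !(max_idPl _)// addrC subrK. Qed.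

Lemma measurable_cadlag d (T : measurableType d) (f : T -> cadlag R) :
  (forall s, 0 <= s -> measurable_fun setT (fun x => f x s)) ->
  measurable_fun setT f.
Proof.
move=> mf; apply: (@measurability _ _ _ _ _ _ (@cylinders R [set s | 0 <= s])) => //.
move=> _ [_ [s [B [s0 mB ->]]] <-].
by apply: mf.
Qed.

Lemma natural_filtration_measurable t (C : set (cadlag R)) :
  natural_filtration t C -> measurable C.
Proof.
apply: sub_sigma_algebra2 => _ [s [B [/= /andP[s0 _] mB ->]]].
by exists s, B.
Qed.

Lemma natural_filtration_mono s t (C : set (cadlag R)) : s <= t ->
  natural_filtration s C -> natural_filtration t C.
Proof.
move=> st; apply: sub_sigma_algebra2 => _ [u [B [/= /andP[u0 us] mB ->]]].
by exists u, B; split => //=; rewrite u0 (le_trans us).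
Qed.

(** Path space as a type whose measurable sets are the events of the past up to t, so that
    measurability with respect to that past is an ordinary [measurable_fun]. *)
Definition filtered t := g_sigma_algebraType (@cylinders R [set s | 0 <= s <= t]).

Lemma measurable_filtered_eval s t : 0 <= s <= t ->
  measurable_fun [set: filtered t] (fun w : filtered t => (w : cadlag R) s).
Proof.
move=> st _ B mB; rewrite setTI; apply: sub_sigma_algebra.
by exists s, B.
Qed.

Lemma measurable_filtered d (T : measurableType d) t (f : cadlag R -> T) :
  measurable_fun [set: filtered t] (f : filtered t -> T) -> measurable_fun setT f.
Proof.
by move=> mf _ B mB; apply: (@natural_filtration_measurable t); exact: mf.
Qed.

Lemma measurable_filteredS d (T : measurableType d) s t (f : cadlag R -> T) :
  s <= t -> measurable_fun [set: filtered s] (f : filtered s -> T) ->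
  measurable_fun [set: filtered t] (f : filtered t -> T).
Proof.
by move=> st mf _ B mB; apply: (natural_filtration_mono st); exact: mf.
Qed.

Lemma measurable_eval s : measurable_fun setT (fun w : cadlag R => w s).
Proof.
have [s0|/ltW s0] := leP 0 s.
  by apply: (@measurable_filtered _ _ s); apply: measurable_filtered_eval; rewrite s0 /=.
rewrite (_ : (fun w => _) = (fun w : cadlag R => w 0)).
  by apply: (@measurable_filtered _ _ 0); apply: measurable_filtered_eval; rewrite lexx.
by apply/funext => w; rewrite cadlag_neg.
Qed.

Lemma measurable_translate : measurable_fun setT
  (fun z : R * cadlag R => translate z.1 z.2).
Proof.
apply: measurable_cadlag => s s0 /=; apply: measurable_funD => //.
exact: measurableT_comp (measurable_eval s) _.
Qed.

Lemma measurable_increment t : measurable_fun setT (increment t).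
Proof.
by apply: measurable_cadlag => s s0 /=; apply: measurable_funB; exact: measurable_eval.
Qed.

Lemma measurable_path_shift t : measurable_fun setT (path_shift t).
Proof.
apply: measurable_cadlag => s s0 /=; apply: measurable_funD; first exact: measurable_eval.
by apply: measurable_funB; exact: measurable_eval.
Qed.

(* Strictly above [s], so that [grid_above n (T w) = k/(n+1)] only involves events [T w < u]
   with [u <= k/(n+1)]. *)
Definition grid_above n s : R := (Num.truncn (n.+1%:R * s)).+1%:R / n.+1%:R.

Lemma grid_above_gt n s : 0 <= s -> s < grid_above n s <= s + n.+1%:R^-1.
Proof.
move=> s0; have ns0 : 0 <= n.+1%:R * s by rewrite mulr_ge0.
have /andP[trl trg] := truncn_itv ns0.
apply/andP; split; first by rewrite ltr_pdivlMr// (mulrC s).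
by rewrite ler_pdivrMr// mulrDl mulVf ?pnatr_eq0// -natr1 lerD2r (mulrC s).
Qed.

Lemma grid_above_cvg s : 0 <= s -> grid_above n s @[n --> \oo] --> s.
Proof.
move=> s0; apply: (@squeeze_cvgr _ _ _ _ (fun=> s) (fun n => s + n.+1%:R^-1)).
- by apply: nearW => n; have /andP[/ltW -> ->] := grid_above_gt n s0.
- exact: cvg_cst.
- rewrite -[X in _ --> X]addr0; apply: cvgD; first exact: cvg_cst.
  exact: cvg_harmonic.
Qed.

Lemma grid_above_neg n s : s <= 0 -> grid_above n s = n.+1%:R^-1.
Proof.
move=> s0; rewrite /grid_above (_ : Num.truncn _ = 0%N) ?mul1r//.
apply/truncn0Pn; rewrite -ltNge (le_lt_trans _ ltr01)//.
by rewrite mulr_ge0_le0.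
Qed.

Lemma cvg_eval_grid w s : w (grid_above n s) @[n --> \oo] --> w s.
Proof.
have [s0|/ltW s0] := leP 0 s.
  apply: cadlag_cvg => //; last exact: grid_above_cvg.
  by move=> n; have /andP[/ltW] := grid_above_gt n s0.
rewrite (cadlag_neg _ s0).
under eq_cvg do rewrite grid_above_neg//.
by apply: cadlag_cvg => //; exact: cvg_harmonic.
Qed.

Lemma measurable_grid_index n (k : nat) :
  measurable [set s : R | Num.truncn (n.+1%:R * s) = k].
Proof.
have mN : measurable_fun setT (fun s : R => n.+1%:R * s) by exact: measurable_funM.
(* [Num.truncn] sends every negative real to 0, so the cell of index 0 is a half-line. *)
rewrite (_ : [set _ | _] = (fun s => n.+1%:R * s) @^-1`
    (`]-oo, k.+1%:R[ `&` (`[k%:R, +oo[ `|` [set s | k = 0%N]))).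
  rewrite -[X in measurable X]setTI; apply: mN => //.
  apply: measurableI => //; apply: measurableU => //.
  have [->|/eqP k0] := eqVneq k 0%N.
    by rewrite (_ : mkset _ = setT)//; apply/seteqP; split.
  by rewrite (_ : mkset _ = set0)//; apply/seteqP; split.
apply/seteqP; split => s /=.
  move=> <-; rewrite in_itv/= in_itv/= andbT; split; first exact: truncnS_gt.
  have [s0|s0] := leP 0 (n.+1%:R * s); first by left; rewrite truncn_le.
  by right; apply/truncn0Pn; rewrite -ltNge (lt_trans s0).
rewrite in_itv/= in_itv/= andbT => -[sk [ks|k0]].
  by apply: truncn_def; rewrite ks.
by rewrite k0 in sk *; apply/truncn0Pn; rewrite -ltNge.
Qed.

(** By right-continuity, the value at a time is the limit of the values at the grid times above it.
    These range over a countable set, so joint measurability reduces to one time at a time. *)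
Lemma measurable_eval2 : measurable_fun setT (fun z : R * cadlag R => z.2 z.1).
Proof.
apply: (@measurable_fun_cvg _ _ _ _
  (fun n (z : R * cadlag R) => z.2 (grid_above n z.1))); last first.
  by move=> z _; exact: cvg_eval_grid.
move=> n _ B mB; rewrite setTI.
rewrite (_ : _ @^-1` _ = \bigcup_k ([set s : R | Num.truncn (n.+1%:R * s) = k]
   `*` [set w : cadlag R | B (w (k.+1%:R / n.+1%:R))])).
  apply: bigcupT_measurable => k; apply: measurableX; first exact: measurable_grid_index.
  by rewrite -[X in measurable X]setTI; exact: measurable_eval.
apply/seteqP; split => [[s w] /= Bw|[s w] [k _ [/= <-]]//].
by exists (Num.truncn (n.+1%:R * s)).
Qed.

Lemma measurable_eval_comp d (T : measurableType d) (f : T -> R) (g : T -> cadlag R) :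
  measurable_fun setT f -> measurable_fun setT g ->
  measurable_fun setT (fun x => g x (f x)).
Proof.
move=> mf mg; exact: (measurableT_comp measurable_eval2 (measurable_fun_pair mf mg)).
Qed.

End path_space.

(** * Markov properties *)

Section increments.
Context {R : realType} {P : R -> probability (cadlag R) R}.
Hypothesis hlevy : levy_family P.
Local Open Scope ereal_scope.
Implicit Types (w v : cadlag R) (x : R).

Lemma measurable_translate1 x : measurable_fun setT (@translate R x).
Proof.
have /= := measurableT_comp (@measurable_translate R) (measurable_fun_pair
  (measurable_cst x) (@measurable_id _ (cadlag R) setT)).
exact.
Qed.

Lemma expect_translate x (H : cadlag R -> \bar R) :
  measurable_fun setT H -> (forall w, 0 <= H w) ->
  \int[P x]_w H w = \int[P 0%R]_w H (translate x w).
Proof.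
move=> mH H0; have mx := measurable_translate1 x.
rewrite -(@ge0_integral_pushforward _ _ _ _ _ _ mx (P 0%R) setT)//.
by apply: eq_measure_integral => //= A mA _; rewrite (levy_translate hlevy).
Qed.

Lemma natural_filtration_translate x t (C : set (cadlag R)) :
  natural_filtration t C -> natural_filtration t (translate x @^-1` C).
Proof.
have mx : @measurable_fun _ _ (filtered t) (filtered t) setT (translate x).
  refine (@measurability _ _ (filtered t) (filtered t) setT (translate x) (@cylinders R [set s | (0 <= s <= t)%R]) erefl _).
  move=> _ [_ [s [B [s0 mB ->]]] <-].
  have := @measurable_funD _ (filtered t) R setT (cst x) _ (measurable_cst _)
    (measurable_filtered_eval s0).
  exact.
by move=> tC; rewrite -[X in natural_filtration _ X]setTI; exact: mx.
Qed.

(** Translating a path does not change its increments, so the independence assumed under [P 0] holds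
    from every starting point. *)
Lemma increment_indep x (s t : R) (C : set (cadlag R)) (B : set R) :
  (0 <= s <= t)%R -> natural_filtration s C -> measurable B ->
  P x (C `&` [set w : cadlag R | B (w t - w s)%R]) =
  P x C * P 0%R [set w : cadlag R | B (w (t - s)%R)].
Proof.
move=> st sC mB.
have mC := natural_filtration_measurable sC.
have mts : measurable_fun setT (fun w : cadlag R => w t - w s)%R.
  by apply: measurable_funB; exact: measurable_eval.
have mD : measurable [set w : cadlag R | B (w t - w s)%R].
  by rewrite -[X in measurable X]setTI; exact: mts.
rewrite (levy_translate hlevy); last exact: measurableI.
rewrite (levy_translate hlevy x mC) -(levy_stationary hlevy st mB).
rewrite -(levy_indep hlevy st _ mB); last exact: natural_filtration_translate.
congr (P 0%R (_ `&` _)); apply/seteqP; split => w /=;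
  by rewrite opprD addrACA subrr add0r.
Qed.

Let eval (s : R) (w : cadlag R) := w s.
Let evalmix s := isMeasurableFun.Build _ _ _ _ (eval s) (measurable_eval s).
Let evalm s : {mfun _ >-> _} := HB.pack (eval s) (evalmix s).

Lemma expect_increment x (s t : R) (g : cadlag R * R -> \bar R) : (0 <= s <= t)%R ->
  measurable_fun [set: filtered s * R] (g : filtered s * R -> \bar R) ->
  (forall z, 0 <= g z) ->
  \int[P x]_w g (w, w t - w s)%R = \int[P x]_w \int[P 0%R]_v g (w, v (t - s)%R).
Proof.
move=> st mg g0.
rewrite (@integral_indep _ _ _ (P x) _ (filtered s) _ _ (fun w => w)
  (fun w => w t - w s)%R (distribution (P 0%R) (evalm (t - s)%R))) //.
- apply: eq_integral => w _.
  rewrite (@ge0_integral_distribution _ _ _ _ _ _ _ (fun y => g (w, y)))//.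
  exact: measurableT_comp mg _.
- by move=> _ B mB; rewrite setTI; exact: (natural_filtration_measurable mB).
- by apply: measurable_funB; exact: measurable_eval.
- by move=> A B mA mB; exact: increment_indep.
Qed.

Section finite_dimensional.
Variable f : R -> R -> R.
Hypothesis mf : forall a, measurable_fun setT (f a).
Hypothesis f0 : forall a y, (0 <= f a y)%R.

(** In a pair, the first component is a time and the second selects the test function; for the ramps
    used below it is a threshold. *)
Definition cylinder_prod (l : seq (R * R)) v : R := \prod_(p <- l) f p.2 (v p.1).

Lemma cylinder_prod_ge0 l v : (0 <= cylinder_prod l v)%R.
Proof. by apply: prodr_ge0. Qed.

Lemma measurable_cylinder_prod l : measurable_fun setT (cylinder_prod l).
Proof.
elim: l => [|p l IH].
  by rewrite (_ : cylinder_prod _ = cst 1%R)//; apply/funext => w; rewrite /cylinder_prod big_nil.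
rewrite (_ : cylinder_prod _ = fun w => f p.2 (w p.1) * cylinder_prod l w)%R.
  by apply: measurable_funM => //; exact: measurableT_comp (mf _) (measurable_eval _).
by apply/funext => w; rewrite /cylinder_prod big_cons.
Qed.

(** Iterated integral over successive independent increments: s is the last time already treated and
    z the displacement at s. *)
Fixpoint cylinder_expect (l : seq (R * R)) (s z : R) : \bar R :=
  if l is p :: l' then
    \int[P 0%R]_v ((f p.2 (z + v (p.1 - s))%R)%:E *
                   cylinder_expect l' p.1 (z + v (p.1 - s))%R)
  else 1.

Lemma cylinder_expect_ge0 l s z : 0 <= cylinder_expect l s z.
Proof.
elim: l s z => [|p l IH] s z //=.
by apply: integral_ge0 => v _; rewrite mule_ge0// lee_fin.
Qed.

Lemma measurable_cylinder_expect l s : measurable_fun setT (cylinder_expect l s).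
Proof.
elim: l s => [|p l IH] s /=; first exact: measurable_cst.
have mzv : measurable_fun setT (fun z : R * cadlag R => z.1 + z.2 (p.1 - s))%R.
  apply: measurable_funD => //.
  exact: measurableT_comp (measurable_eval _) measurable_snd.
apply: (@measurable_fun_fubini_tonelli_F _ _ _ _ _ (P 0%R) (fun z : R * cadlag R =>
  (f p.2 (z.1 + z.2 (p.1 - s))%R)%:E *
  cylinder_expect l p.1 (z.1 + z.2 (p.1 - s))%R)).
  apply: emeasurable_funM; last exact: measurableT_comp (IH _) mzv.
  by apply/measurable_EFinP; exact: measurableT_comp (mf _) mzv.
by move=> z; rewrite mule_ge0 ?lee_fin// cylinder_expect_ge0.
Qed.

(** The weight [W] absorbs the factors already treated. The factor at the next time u joins it, the
    induction hypothesis treats the later times, and the increment between t + s and t + u is then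
    replaced by an independent copy. *)
Lemma expect_cylinder_prod_weight x (t s : R) l (W : cadlag R -> \bar R) :
  (0 <= t)%R -> (0 <= s)%R -> path <=%R s (map fst l) ->
  measurable_fun [set: filtered (t + s)] (W : filtered (t + s) -> \bar R) ->
  (forall w, 0 <= W w) ->
  \int[P x]_w (W w * (cylinder_prod l (increment t w))%:E) =
  \int[P x]_w (W w * cylinder_expect l s (increment t w s)).
Proof.
move=> t0; elim: l s W => [|[u a] l IH] s W s0 /=.
  by move=> _ mW W0; apply: eq_integral => w _; rewrite /cylinder_prod big_nil.
move=> /andP[su pl] mW W0.
have u0 : (0 <= u)%R by exact: le_trans su.
have incr_meas (r q : R) : (0 <= r)%R -> (r <= q)%R ->
    measurable_fun [set: filtered (t + q)]
      (fun w : filtered (t + q) => increment t w r).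
  move=> r0 rq; apply: (@eq_measurable_fun _ _ _ _ _ (fun w : filtered (t + q) =>
    (w : cadlag R) (t + r) - (w : cadlag R) t)%R).
    by move=> w _; rewrite incrementE.
  by apply: measurable_funB; apply: measurable_filtered_eval;
    rewrite ?t0 ?addr_ge0 ?lerD2l//= lerDl (le_trans r0).
transitivity (\int[P x]_w (W w * (f a (increment t w u))%:E *
    (cylinder_prod l (increment t w))%:E)).
  apply: eq_integral => w _; rewrite -muleA; congr (_ * _).
  by rewrite /cylinder_prod big_cons EFinM.
rewrite (IH u (fun w => W w * (f a (increment t w u))%:E))//; last 2 first.
- apply: emeasurable_funM.
    by apply: measurable_filteredS mW; rewrite lerD2l.
  apply/measurable_EFinP.
  apply: (measurableT_comp (mf a)).
  exact: incr_meas.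
- by move=> w; rewrite mule_ge0// lee_fin.
pose g (z : cadlag R * R) := W z.1 * ((f a (increment t z.1 s + z.2)%R)%:E *
  cylinder_expect l u (increment t z.1 s + z.2)%R).
transitivity (\int[P x]_w g (w, w (t + u) - w (t + s))%R).
  apply: eq_integral => w _; rewrite -muleA /g/=.
  have -> // : (increment t w s + (w (t + u) - w (t + s)) = increment t w u)%R.
  by rewrite !incrementE//; ring.
have msum : measurable_fun [set: filtered (t + s) * R]
    (fun z : filtered (t + s) * R => increment t z.1 s + z.2)%R.
  apply: measurable_funD => //.
  exact: measurableT_comp (incr_meas s s s0 (lexx s)) measurable_fst.
have mfV : measurable_fun setT (fun y => (f a y)%:E * cylinder_expect l u y).
  apply: emeasurable_funM; last exact: measurable_cylinder_expect.
  exact/measurable_EFinP.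
rewrite expect_increment//; first last.
- by move=> z; rewrite /g !mule_ge0 ?lee_fin// cylinder_expect_ge0.
- apply: emeasurable_funM; first exact: measurableT_comp mW measurable_fst.
  exact: measurableT_comp mfV msum.
- by rewrite addr_ge0//= lerD2l.
apply: eq_integral => w _; rewrite /g /=.
rewrite (_ : t + u - (t + s) = u - s)%R; last by ring.
rewrite ge0_integralZl//.
- apply: (measurableT_comp mfV).
  by apply: measurable_funD => //; exact: measurable_eval.
- by move=> v _; rewrite mule_ge0 ?lee_fin ?cylinder_expect_ge0.
Qed.

Lemma expect_cylinder_prod_past x (t : R) l (C : set (cadlag R)) :
  (0 <= t)%R -> path <=%R 0%R (map fst l) -> natural_filtration t C ->
  \int[P x]_(w in C) (cylinder_prod l (increment t w))%:E =
  P x C * cylinder_expect l 0 0.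
Proof.
move=> t0 pl tC; have mC := natural_filtration_measurable tC.
have mWC : measurable_fun [set: filtered (t + 0)]
    (fun w : filtered (t + 0) => (\1_C (w : cadlag R))%:E : \bar R).
  apply: (@measurable_filteredS _ _ _ t (t + 0)%R); first by rewrite addr0.
  by apply/measurable_EFinP; exact: (@measurable_indic _ (filtered t) R setT C tC).
have := @expect_cylinder_prod_weight x t 0 l (fun w => (\1_C w)%:E) t0 (lexx _) pl mWC.
move=> /(_ (fun w => ltac:(by rewrite lee_fin))) E.
rewrite integral_mkcond.
transitivity (\int[P x]_w ((\1_C w)%:E * (cylinder_prod l (increment t w))%:E)).
  apply: eq_integral => w _; rewrite patchE indicE.
  by case: ifPn => _; rewrite ?mul1e ?mul0e.
rewrite E.
transitivity (\int[P x]_w ((\1_C w)%:E * cylinder_expect l 0 0)).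
  by apply: eq_integral => w _; rewrite incrementE// addr0 subrr.
rewrite ge0_integralZr//.
- by rewrite integral_indic// setIT.
- by apply/measurable_EFinP; exact: measurable_indic.
- exact: cylinder_expect_ge0.
Qed.

(** Take t = 0 and the sure event in [expect_cylinder_prod_past]: the path starts at 0 almost
    surely, hence agrees with its increment from time 0 at the times of [l]. *)
Lemma cylinder_expectE l : path <=%R 0%R (map fst l) ->
  cylinder_expect l 0 0 = \int[P 0%R]_w (cylinder_prod l w)%:E.
Proof.
move=> pl; have T0 : natural_filtration (0 : R) [set: cadlag R].
  exact: (@measurableT _ (filtered 0)).
have := @expect_cylinder_prod_past 0 0 l setT (lexx _) pl T0.
rewrite probability_setT mul1e => <-.
have m0 : measurable [set w : cadlag R | w 0%R = 0%R].
  rewrite -[X in measurable X]setTI.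
  exact: (measurable_eval 0 measurableT (measurable_set1 0%R)).
have P0 : P 0%R (~` [set w : cadlag R | w 0%R = 0%R]) = 0.
  by rewrite probability_setC// (levy_start hlevy) subee.
apply: (@integral_off_null _ _ _ _ (~` [set w : cadlag R | w 0%R = 0%R])) => //.
- exact: measurableC.
- move=> w /contrapT/= w0; congr EFin; apply: eq_big_seq => p pl'.
  rewrite incrementE//; last first.
    move: pl; rewrite (path_sortedE le_trans) => /andP[/allP + _]; apply.
    exact: map_f.
  by rewrite add0r w0 subr0.
Qed.

End finite_dimensional.

End increments.

(** * Strong Markov property by discretization *)

Section strong_markov.
Context {R : realType} {P : R -> probability (cadlag R) R}.
Local Open Scope ereal_scope.
Implicit Types (w v : cadlag R) (x t : R) (T : cadlag R -> \bar R).

(** The strict inequality is the one that hitting times of open sets satisfy; it characterises the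
    stopping times of the right-continuous filtration. *)
Definition optional_time T :=
  (forall w, 0 <= T w) /\
  forall s : R, natural_filtration s [set w | T w < s%:E].

Lemma measurable_optional_time T : optional_time T -> measurable_fun setT T.
Proof.
move=> [_ oT]; apply: (measurability _ (ErealGenInftyO.measurableE R)).
move=> _ [_ [s ->] <-]; rewrite setTI.
rewrite (_ : _ @^-1` _ = [set w | T w < s%:E]).
  exact: natural_filtration_measurable (oT s).
by apply/seteqP; split => w /=; rewrite in_itv.
Qed.

Section discretization.
Variables (x M : R) (T : cadlag R -> \bar R).
Hypothesis oT : optional_time T.

Let D := [set w | T w < +oo].

Let mD : measurable D.
Proof.
rewrite -[X in measurable X]setTI; apply: emeasurable_fun_infty_o => //.
exact: measurable_optional_time.
Qed.

Let F n k := [set w | T w < ((k.+1)%:R / n.+1%:R)%:E] `&`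
  ~` [set w | T w < (k%:R / n.+1%:R)%:E].

Let FE n k : F n k = D `&` [set w | Num.truncn (n.+1%:R * fine (T w)) = k].
Proof.
have T0 := oT.1.
apply/seteqP; split => w /=.
  move=> [/= Tk /negP]; rewrite -leNgt => kT.
  have Tfin : T w \is a fin_num by rewrite ge0_fin_numE// (lt_trans Tk)// ltry.
  split; first exact: lt_trans Tk (ltry _).
  move: Tk kT; rewrite -(fineK Tfin) /= lte_fin lee_fin => Tk kT.
  apply: truncn_def; rewrite [(_ * fine _)%R]mulrC.
  by rewrite -ler_pdivrMr//= kT/= -ltr_pdivlMr.
move=> [Toy Tk]; have Tfin : T w \is a fin_num by rewrite ge0_fin_numE.
have := truncn_itv (_ : 0 <= n.+1%:R * fine (T w))%R.
rewrite Tk => /(_ (mulr_ge0 (ler0n _ _) (fine_ge0 (T0 w)))).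
rewrite [(_ * fine _)%R]mulrC -ler_pdivrMr// -ltr_pdivlMr// => /andP[kT Tk1].
by split=> /=; [|apply/negP; rewrite -leNgt]; rewrite -(fineK Tfin) ?lte_fin ?lee_fin.
Qed.

Let pF n k : natural_filtration (k.+1%:R / n.+1%:R) (F n k).
Proof.
apply: (@measurableI _ (filtered (k.+1%:R / n.+1%:R)%R)); first exact: oT.2.
apply: (@measurableC _ (filtered (k.+1%:R / n.+1%:R)%R)).
apply: (natural_filtration_mono _ (oT.2 _)).
by rewrite ler_pM2r ?invr_gt0 ?ltr0n// ler_nat.
Qed.

Let mF n k : measurable (F n k).
Proof. exact: natural_filtration_measurable (@pF n k). Qed.

Let tF n : trivIset setT (F n).
Proof. by apply/trivIsetP => i j _ _ ij; apply/seteqP; split => // w /=;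
  rewrite !FE => -[[_ /= Ti] [_ /= Tj]]; move: ij; rewrite -Ti Tj eqxx.
Qed.

Let DF n : D = \bigcup_k F n k.
Proof.
apply/seteqP; split => w; last by move=> [k _]; rewrite FE => -[].
by move=> Dw; exists (Num.truncn (n.+1%:R * fine (T w))) => //; rewrite FE.
Qed.

Section process.
Variable A : R -> cadlag R -> R.
Hypothesis mA : forall t, (0 <= t)%R -> measurable_fun setT (A t).
Hypothesis A0 : forall t w, (0 <= t)%R -> (0 <= A t w <= M)%R.
Hypothesis rA : forall t w, (0 <= t)%R ->
  A (grid_above n t) w @[n --> \oo] --> A t w.

Let An n w := A (grid_above n (fine (T w))) w.

Let grid0 n w : (0 <= grid_above n (fine (T w)))%R.
Proof. by rewrite divr_ge0. Qed.

Let AnF n k w : F n k w -> An n w = A (k.+1%:R / n.+1%:R)%R w.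
Proof. by rewrite FE => -[_ /= Tk]; rewrite /An /grid_above Tk. Qed.

Let mAn n : measurable_fun D (An n).
Proof.
rewrite (DF n); apply/measurable_fun_bigcup; first exact: mF.
move=> k; apply: (@eq_measurable_fun _ _ _ _ _ (A (k.+1%:R / n.+1%:R)%R)).
  by move=> w /set_mem Fw; rewrite (AnF Fw).
by apply: measurable_funS (mA _) => //; rewrite divr_ge0.
Qed.

Lemma integral_grid n : \int[P x]_(w in D) (An n w)%:E =
  \sum_(k <oo) \int[P x]_(w in F n k) (A (k.+1%:R / n.+1%:R)%R w)%:E.
Proof.
rewrite (DF n) ge0_integral_bigcup//.
- apply: eq_eseriesr => k _; apply: eq_integral => w /set_mem Fw.
  by rewrite (AnF Fw).
- by apply/measurable_EFinP; rewrite -DF.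
- by move=> w _; rewrite lee_fin; case/andP : (A0 w (grid0 n w)).
Qed.

Lemma cvg_integral_grid :
  \int[P x]_(w in D) (An n w)%:E @[n --> \oo] -->
  \int[P x]_(w in D) (A (fine (T w)) w)%:E.
Proof.
have E (g : cadlag R -> R) :
    \int[P x]_(w in D) (g w)%:E = \int[P x]_w ((g \_ D) w)%:E.
  rewrite integral_mkcond; apply: eq_integral => w _.
  by rewrite !patchE; case: ifP.
rewrite E (_ : (fun n => _) = (fun n => \int[P x]_w ((An n \_ D) w)%:E)); last first.
  by apply/funext => n; exact: E.
apply: (@cvg_integral_bounded _ _ _ (P x) (fun n => An n \_ D) _ M).
- by move=> n; apply/(measurable_restrictT _ mD); exact: mAn.
- move=> n w; rewrite patchE; case: ifPn => _.
    by case/andP : (A0 w (grid0 n w)) => a0 aM; rewrite ger0_norm.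
  by case/andP : (A0 w (grid0 n w)) => a0 aM; rewrite normr0 (le_trans a0).
- move=> w; rewrite patchE; under eq_cvg do rewrite patchE.
  case: ifPn => _; last exact: cvg_cst.
  by apply: rA; rewrite fine_ge0// oT.1.
Qed.

End process.

(** [A] and [B] play the roles of a functional of the path after t and of its conditional
    expectation given the past. On the grid, T takes countably many values, each on an event of the
    past, where the hypothesis applies; right-continuity and bounded convergence remove the grid.
    This form avoids the sigma-algebra of events before T. *)
Lemma strong_markov_principle (A B : R -> cadlag R -> R) :
  (forall t, (0 <= t)%R -> measurable_fun setT (A t)) ->
  (forall t, (0 <= t)%R -> measurable_fun setT (B t)) ->
  (forall t w, (0 <= t)%R -> 0 <= A t w <= M)%R ->
  (forall t w, (0 <= t)%R -> 0 <= B t w <= M)%R ->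
  (forall t w, (0 <= t)%R -> A (grid_above n t) w @[n --> \oo] --> A t w) ->
  (forall t w, (0 <= t)%R -> B (grid_above n t) w @[n --> \oo] --> B t w) ->
  (forall t C, (0 <= t)%R -> natural_filtration t C ->
    \int[P x]_(w in C) (A t w)%:E = \int[P x]_(w in C) (B t w)%:E) ->
  \int[P x]_(w in [set w | T w < +oo]) (A (fine (T w)) w)%:E =
  \int[P x]_(w in [set w | T w < +oo]) (B (fine (T w)) w)%:E.
Proof.
move=> mA mB A0 B0 rA rB AB.
have cA := cvg_integral_grid mA A0 rA.
have cB := cvg_integral_grid mB B0 rB.
move/cvg_lim : cA => <- //; move/cvg_lim : cB => <- //.
apply/congr_lim/funext => n /=.
rewrite !integral_grid//; apply: eq_eseriesr => k _.
exact: (AB _ (F n k) (divr_ge0 (ler0n _ _) (ler0n _ _)) (@pF n k)).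
Qed.

End discretization.

End strong_markov.

(** * Markov property for the right-continuous filtration *)

Section markov.
Context {R : realType} {P : R -> probability (cadlag R) R}.
Hypothesis hlevy : levy_family P.
Local Open Scope ereal_scope.
Implicit Types (w v : cadlag R) (x t : R).

Lemma grid_above_ge n t : (0 <= t)%R -> (t <= grid_above n t)%R.
Proof. by move=> t0; have /andP[/ltW] := grid_above_gt n t0. Qed.

Lemma cvg_increment_grid t w (s : R) : (0 <= t)%R -> (0 <= s)%R ->
  increment (grid_above n t) w s @[n --> \oo] --> increment t w s.
Proof.
move=> t0 s0; rewrite incrementE//.
under eq_cvg do rewrite incrementE ?(le_trans t0 (grid_above_ge _ t0))//.
apply: cvgB; last exact: cvg_eval_grid.
apply: cadlag_cvg; first by rewrite addr_ge0.
- by move=> n; rewrite lerD2r grid_above_ge.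
- by apply: cvgD; [exact: grid_above_cvg|exact: cvg_cst].
Qed.

Lemma cylinder_prod_itv01 (f : R -> R -> R) l w :
  (forall a y, (0 <= f a y <= 1)%R) -> (0 <= cylinder_prod f l w <= 1)%R.
Proof.
move=> f01; have f0 a y : (0 <= f a y)%R by case/andP: (f01 a y).
rewrite cylinder_prod_ge0//= /cylinder_prod.
elim: l => [|p l IH]; first by rewrite big_nil.
rewrite big_cons mulr_ile1//; last by case/andP : (f01 p.2 (w p.1)).
exact: prodr_ge0.
Qed.

(* Right-continuity of paths upgrades independence from the natural filtration
   to its right limit: on a constant time cut off outside of [C], the strong
   Markov principle is the statement for [C] in [right_filtration t]. *)
Lemma expect_cylinder_prod_future (f : R -> R -> R) x t l (C : set (cadlag R)) :
  (forall a, continuous (f a)) -> (forall a y, (0 <= f a y <= 1)%R) ->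
  (0 <= t)%R -> path <=%R 0%R (map fst l) -> right_filtration t C ->
  \int[P x]_(w in C) (cylinder_prod f l (increment t w))%:E =
  P x C * \int[P 0%R]_w (cylinder_prod f l w)%:E.
Proof.
move=> cf f01 t0 pl tC.
have mf a : measurable_fun setT (f a) by exact: continuous_measurable_fun.
have f0 a y : (0 <= f a y)%R by case/andP: (f01 a y).
have prod01 w := cylinder_prod_itv01 l w f01.
have mprod : measurable_fun setT (cylinder_prod f l) by exact: measurable_cylinder_prod.
have l0 p : p \in l -> (0 <= p.1)%R.
  move=> pl'; move: pl; rewrite (path_sortedE le_trans) => /andP[/allP + _].
  by apply; exact: map_f.
pose c := fine (\int[P 0%R]_w (cylinder_prod f l w)%:E).
have c01 : (0 <= c <= 1)%R /\ c%:E = \int[P 0%R]_w (cylinder_prod f l w)%:E.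
  have i0 : 0 <= \int[P 0%R]_w (cylinder_prod f l w)%:E.
    by apply: integral_ge0 => w _; rewrite lee_fin; case/andP : (prod01 w).
  have i1 : \int[P 0%R]_w (cylinder_prod f l w)%:E <= 1.
    rewrite -(@probability_setT _ _ _ (P 0%R)) -[leRHS]mul1e -integral_cst//.
    apply: ge0_le_integral => //.
    + by move=> w _; rewrite lee_fin; case/andP : (prod01 w).
    + exact/measurable_EFinP.
    + by move=> w _; rewrite lee_fin; case/andP : (prod01 w).
  have ifin : \int[P 0%R]_w (cylinder_prod f l w)%:E \is a fin_num.
    by rewrite ge0_fin_numE// (le_lt_trans i1)// ltry.
  by rewrite fineK// -!lee_fin fineK// i0 i1.
have mC : measurable C.
  by apply: (@natural_filtration_measurable _ (t + 1)); apply: tC; rewrite /= ltrDl.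
pose T w := if w \in C then t%:E else +oo.
have Toy : [set w | T w < +oo] = C.
  apply/seteqP; split => w; rewrite /= /T; last by move=> wC; rewrite mem_set// ltry.
  by case: ifPn => [/set_mem//|_]; rewrite ltxx.
have oT : optional_time T.
  split=> [w|s]; first by rewrite /T; case: ifP => // _; rewrite lee_fin.
  have [ts|st] := ltP t s.
    rewrite (_ : [set _ | _] = C); first exact: tC.
    apply/seteqP; split => w; rewrite /= /T; last by move=> wC; rewrite mem_set// lte_fin.
    by case: ifPn => [/set_mem//|_]; rewrite ltNge leey.
  rewrite (_ : [set _ | _] = set0); first exact: (@measurable0 _ (filtered s)).
  apply/seteqP; split => w //=; rewrite /T.
  by case: ifPn => _; rewrite ltNge ?leey ?lee_fin ?st.
have := @strong_markov_principle R P x 1 T oT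
  (fun t w => cylinder_prod f l (increment t w)) (fun _ _ => c).
rewrite Toy.
transitivity (\int[P x]_(w in C) (cylinder_prod f l (increment (fine (T w)) w))%:E).
  by apply: eq_integral => w wC; rewrite /T wC.
rewrite H.
- by rewrite integral_cst// muleC c01.2.
- by move=> u u0; apply: measurableT_comp mprod (measurable_increment u).
- by move=> u u0; exact: measurable_cst.
- by move=> u w _; exact: prod01.
- by move=> u w _; exact: c01.1.
- move=> u w u0; rewrite /cylinder_prod.
  elim: (l) l0 => [|p l' IH] l'0.
    by rewrite big_nil; under eq_cvg do rewrite big_nil; exact: cvg_cst.
  rewrite big_cons; under eq_cvg do rewrite big_cons.
  apply: cvgM; last by apply: IH => q ql; apply: l'0; rewrite inE ql orbT.
  apply: continuous_cvg; first exact: cf.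
  by apply: cvg_increment_grid => //; apply: l'0; rewrite mem_head.
- by move=> u w _; exact: cvg_cst.
- move=> u D u0 uD; rewrite expect_cylinder_prod_past// (cylinder_expectE hlevy)//.
  by rewrite integral_cst ?c01.2 1?muleC//; exact: natural_filtration_measurable uD.
Qed.

(** Continuous approximations of the indicator of ]a, +oo[: continuity lets the right-continuity of
    the paths pass through the test functions. *)
Let ramp (n : nat) (a y : R) : R := Num.min 1%R (Num.max 0%R (n.+1%:R * (y - a))%R).

Let ramp_continuous n a : continuous (ramp n a).
Proof.
move=> y; pose g (z : R) : R := (n.+1%:R * (z - a))%R.
have cg : {for y, continuous g}.
  apply: (@continuousM _ _ (cst n.+1%:R) (fun z : R => z - a)%R); first exact: cvg_cst.
  by apply: (@continuousB _ _ _ id (cst a)); [exact: cvg_id|exact: cvg_cst].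
apply: (@continuous_min _ _ (cst 1%R) (cst 0%R \max g)); first exact: cvg_cst.
by apply: (@continuous_max _ _ (cst 0%R) g) => //; exact: cvg_cst.
Qed.

Let ramp01 n a y : (0 <= ramp n a y <= 1)%R.
Proof. by rewrite /ramp le_min ler01 ge_min lexx le_max lexx. Qed.

Let cvg_ramp a y : ramp n a y @[n --> \oo] --> ((a < y)%R%:R : R).
Proof.
have [ay|ya] := ltP a y; last first.
  apply: cvg_near_cst; apply: nearW => n; rewrite /ramp.
  rewrite (max_idPl _) ?(min_idPr _)//.
  by rewrite mulr_ge0_le0// subr_le0.
have ya0 : (0 < y - a)%R by rewrite subr_gt0.
apply: cvg_near_cst; near=> n; rewrite /ramp (max_idPr _); last first.
  by rewrite mulr_ge0// ltW.
rewrite (min_idPl _)// -ler_pdivrMr// div1r.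
near: n; exists (Num.truncn (y - a)^-1) => // n /= tn.
by rewrite ltW// (lt_le_trans (truncnS_gt _))// ler_nat ltnS.
Unshelve. all: by end_near. Qed.

Let orthant (l : seq (R * R)) : set (cadlag R) := [set w | all (fun p : R * R => p.2 < w p.1)%R l].

Let cvg_cylinder_ramp l w :
  cylinder_prod (ramp n) l w @[n --> \oo] --> (\1_(orthant l) w : R).
Proof.
rewrite indicE (_ : (w \in orthant l) = all (fun p => p.2 < w p.1)%R l); last first.
  by apply/idP/idP => [/set_mem//|wl]; rewrite inE.
elim: l => [|p l IH] /=.
  by rewrite /cylinder_prod; under eq_cvg do rewrite big_nil; exact: cvg_cst.
rewrite /cylinder_prod; under eq_cvg do rewrite big_cons.
by rewrite -mulnb natrM; apply: cvgM => //; exact: cvg_ramp.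
Qed.

Let orthants := [set orthant l | l in [set l | all (fun p : R * R => 0 <= p.1)%R l]].

Let orthants_setI : setI_closed orthants.
Proof.
move=> _ _ [l l0 <-] [k k0 <-]; exists (l ++ k); first by rewrite /= all_cat l0.
by apply/seteqP; split => w /=; rewrite /orthant /= all_cat => /andP.
Qed.

Let measurable_orthants : @measurable _ (cadlag R) = <<s orthants >>.
Proof.
apply/seteqP; split.
- apply: (@smallest_sub _ _ (@cylinders R [set s | (0 <= s)%R])).
    exact: smallest_sigma_algebra.
  move=> _ [s [B [s0 mB ->]]].
  have ms : @measurable_fun _ _ (g_sigma_algebraType orthants) R setT (fun w : cadlag R => w s).
    refine (@measurability _ _ (g_sigma_algebraType orthants) R setT _ _ (RGenOInfty.measurableE R) _).
    move=> _ [_ [a ->] <-]; apply: sub_sigma_algebra.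
    exists [:: (s, a)] => /=; first by rewrite s0.
    by rewrite setTI; apply/seteqP; split => w; rewrite /orthant /= in_itv /= !andbT.
  by have := ms measurableT _ mB; rewrite setTI.
- apply: smallest_sub; first exact: sigma_algebra_measurable.
  move=> _ [l l0 <-]; elim: l l0 => [|p l IH] /= => [_|/andP[p0 l0]].
    by rewrite (_ : orthant _ = setT)//; apply/seteqP; split.
  rewrite (_ : orthant _ = [set w : cadlag R | p.2 < w p.1]%R `&` orthant l); last first.
    by apply/seteqP; split => w; rewrite /orthant /= => /andP.
  apply: measurableI; last exact: IH.
  rewrite (_ : [set _ | _] = (fun w : cadlag R => w p.1) @^-1` `]p.2, +oo[%classic).
    rewrite -[X in measurable X]setTI.
    exact: (measurable_eval p.1 measurableT (measurable_itv _)).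
  by apply/seteqP; split => w /=; rewrite in_itv /= andbT.
Qed.

(** Both sides are finite measures in [B]. They agree on the orthants, a pi-system that generates
    the sigma-algebra, as limits of the identities for ramps. *)
Lemma increment_indep_future x t (C B : set (cadlag R)) : (0 <= t)%R ->
  right_filtration t C -> measurable B ->
  P x (C `&` increment t @^-1` B) = P x C * P 0%R B.
Proof.
move=> t0 tC mB.
have mC : measurable C.
  by apply: (@natural_filtration_measurable _ (t + 1)); apply: tC; rewrite /= ltrDl.
have mt := @measurable_increment R t.
have PC : (fine (P x C))%:E = P x C by rewrite fineK// fin_num_measure.
pose m1 := pushforward (mrestr (P x) mC) (increment t).
pose k : {nonneg R} := NngNum (fine_ge0 (measure_ge0 (P x) C)).
pose m2 := mscale k (P 0%R).
have m12 : forall A, orthants A -> m1 A = m2 A.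
  move=> _ [l l0 <-].
  (* The iterated integral visits times in increasing order, while those of an orthant come in any
     order. *)
  pose l' := sort (fun p q : R * R => (p.1 <= q.1)%R) l.
  have -> : orthant l = orthant l'.
    by apply/seteqP; split => w; rewrite /orthant /= all_sort.
  have pl : path <=%R 0%R (map fst l').
    rewrite (path_sortedE le_trans) all_map all_sort l0/= sorted_map.
    by apply: sort_sorted => p q; exact: le_total.
  have morth : measurable (orthant l').
    rewrite measurable_orthants; apply: sub_sigma_algebra; exists l' => //.
    by rewrite /= all_sort.
  have mr n a : measurable_fun setT (ramp n a).
    exact: continuous_measurable_fun.
  have mcyl n : measurable_fun setT (cylinder_prod (ramp n) l').
    exact: measurable_cylinder_prod.
  have cyl01 n w : (`|cylinder_prod (ramp n) l' w| <= 1)%R.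
    by have /andP[r0 r1] := cylinder_prod_itv01 l' w (ramp01 n); rewrite ger0_norm.
  have c1 : \int[P x]_(w in C) (cylinder_prod (ramp n) l' (increment t w))%:E
      @[n --> \oo] --> m1 (orthant l').
    have -> : m1 (orthant l') =
        \int[P x]_w (\1_(increment t @^-1` orthant l' `&` C) w)%:E.
      rewrite integral_indic ?setIT//; apply: measurableI => //.
      by rewrite -[X in measurable X]setTI; exact: mt.
    have E (g : cadlag R -> R) :
        \int[P x]_(w in C) (g w)%:E = \int[P x]_w ((g \_ C) w)%:E.
      rewrite integral_mkcond; apply: eq_integral => w _.
      by rewrite !patchE; case: ifP.
    rewrite (_ : (fun n => _) = (fun n => \int[P x]_w
      (((fun w => cylinder_prod (ramp n) l' (increment t w)) \_ C) w)%:E)); last first.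
      by apply/funext => n; exact: E.
    apply: (@cvg_integral_bounded _ _ _ (P x) _ _ 1%R).
    + move=> n; apply/(measurable_restrictT _ mC); apply: measurable_funTS.
      exact: measurableT_comp (mcyl n) mt.
    + by move=> n w; rewrite patchE; case: ifPn => _; rewrite ?normr0.
    + move=> w; rewrite indicE in_setI; have [wC|wC] := boolP (w \in C).
        under eq_cvg do rewrite patchE wC.
        by rewrite andbT; have := @cvg_cylinder_ramp l' (increment t w); rewrite indicE.
      under eq_cvg do rewrite patchE (negbTE wC).
      by rewrite andbF; exact: cvg_cst.
  have c2 : P x C * \int[P 0%R]_w (cylinder_prod (ramp n) l' w)%:E
      @[n --> \oo] --> m2 (orthant l').
    have -> : m2 (orthant l') = P x C * \int[P 0%R]_w (\1_(orthant l') w)%:E.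
      by rewrite integral_indic// setIT /m2 /mscale /= PC.
    apply: cvgeZl; first by rewrite -PC.
    by apply: (@cvg_integral_bounded _ _ _ (P 0%R) _ _ 1%R).
  rewrite (_ : (fun n => _) = (fun n => P x C *
      \int[P 0%R]_w (cylinder_prod (ramp n) l' w)%:E)) in c1; last first.
    by apply/funext => n; rewrite expect_cylinder_prod_future.
  exact: cvg_unique c1 c2.
have -> : P x (C `&` increment t @^-1` B) = m1 B.
  by rewrite /m1 /pushforward /mrestr setIC.
have -> : P x C * P 0%R B = m2 B by rewrite /m2 /mscale /= PC.
apply: (@measure_unique _ R (cadlag R) orthants (fun=> setT)) => //.
- by move=> _; exists [::] => //; apply/seteqP; split.
- by apply/seteqP; split => // w _; exists 0%N.
- move=> _; have m1T : m1 setT = P x C.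
    by congr (P x _); apply/seteqP; split => w // [].
  by change (m1 setT < +oo); rewrite m1T -PC ltry.
Qed.

(** [right_filtration t] is already a sigma-algebra; generating it again provides a type and, by
    [measurable_right_filtered], adds no event. *)
Definition right_filtered t := g_sigma_algebraType (@right_filtration R t).

Lemma measurable_right_filtered t (C : set (right_filtered t)) :
  measurable C -> right_filtration t C.
Proof.
move=> tC s ts.
have : (<<s right_filtration t>> `<=` natural_filtration s)%classic.
  apply: smallest_sub; first exact: smallest_sigma_algebra.
  by move=> A; apply.
exact.
Qed.

Lemma measurable_right_filteredE t (C : set (cadlag R)) : right_filtration t C ->
  @measurable _ (right_filtered t) C.
Proof. exact: sub_sigma_algebra. Qed.

Lemma right_filtered_measurable t (C : set (cadlag R)) :
  @measurable _ (right_filtered t) C -> measurable C.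
Proof.
move=> /measurable_right_filtered tC.
by apply: (@natural_filtration_measurable _ (t + 1)); apply: tC; rewrite /= ltrDl.
Qed.

Lemma measurable_fun_right_filtered d (S : measurableType d) t (f : cadlag R -> S) :
  @measurable_fun _ _ (right_filtered t) S setT f -> measurable_fun setT f.
Proof.
by move=> mf _ B mB; apply: (@right_filtered_measurable t); exact: mf.
Qed.

Lemma measurable_right_filtered_eval t : (0 <= t)%R ->
  @measurable_fun _ _ (right_filtered t) R setT (fun w : cadlag R => w t).
Proof.
move=> t0 _ B mB; rewrite setTI; apply: measurable_right_filteredE => s /= ts.
by apply: sub_sigma_algebra; exists t, B; rewrite /= t0 ltW.
Qed.

(** The path after t is the translate by [w t] of the increment, which is independent of
    [right_filtration t]: freeze the past by [integral_indep] and integrate over the increment under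
    [P 0]. *)
Lemma markov_property x t (F H : cadlag R -> \bar R) : (0 <= t)%R ->
  @measurable_fun _ _ (right_filtered t) _ setT F -> (forall w, 0 <= F w) ->
  measurable_fun setT H -> (forall w, 0 <= H w) ->
  \int[P x]_w (F w * H (path_shift t w)) = \int[P x]_w (F w * \int[P (w t)]_v H v).
Proof.
move=> t0 mF F0 mH H0.
pose g (z : right_filtered t * cadlag R) :=
  F z.1 * H (translate ((z.1 : cadlag R) t) z.2).
have mtr : measurable_fun setT (fun z : right_filtered t * cadlag R =>
    translate ((z.1 : cadlag R) t) z.2).
  apply: measurable_cadlag => s s0 /=; apply: measurable_funD.
    exact: measurableT_comp (measurable_right_filtered_eval t0) measurable_fst.
  exact: measurableT_comp (measurable_eval s) measurable_snd.
have mg : measurable_fun setT g.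
  apply: emeasurable_funM; first exact: measurableT_comp mF measurable_fst.
  exact: measurableT_comp mH mtr.
have := @integral_indep _ _ _ (P x) _ (right_filtered t) _ _ (fun w => w)
  (increment t) (P 0%R) _ (@measurable_increment R t) _ g mg.
rewrite /g /= => -> //.
- apply: eq_integral => w _; rewrite ge0_integralZl//.
  + by congr (_ * _); rewrite (expect_translate hlevy _ mH H0).
  + exact: measurableT_comp mH (measurable_translate1 _).
- by move=> _ B mB; rewrite setTI; exact: right_filtered_measurable mB.
- move=> A B mA mB; apply: increment_indep_future => //.
  exact: measurable_right_filtered.
- by move=> z; exact: mule_ge0.
Qed.

End markov.

(** * Hitting times *)

Section hitting_times.
Context {R : realType}.
Local Open Scope ereal_scope.
Implicit Types (w : cadlag R) (A B G : set R) (T : cadlag R -> \bar R) (t : R).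

Lemma hitting_time_ge0 A w : 0 <= hitting_time A w.
Proof. by apply: le_ereal_inf_tmp => _ [t [t0 _] <-]; rewrite lee_fin. Qed.

Lemma hitting_time_ltP A w (s : \bar R) : hitting_time A w < s <->
  exists t : R, [/\ (0 <= t)%R, t%:E < s & A (w t)].
Proof.
split=> [/ereal_inf_lt[_ [t [t0 At] <-] ts]|[t [t0 ts At]]].
  by exists t.
by apply: le_lt_trans ts; apply: ereal_inf_lbound; exists t.
Qed.

Lemma hitting_time_le A w t : (0 <= t)%R -> A (w t) -> hitting_time A w <= t%:E.
Proof. by move=> t0 At; apply: ereal_inf_lbound; exists t. Qed.

Lemma hitting_time_subset A B w : A `<=` B -> hitting_time B w <= hitting_time A w.
Proof.
by move=> AB; apply: ereal_inf_le_tmp => _ [t [t0 At] <-]; exists t => //; split => //; exact: AB.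
Qed.

Lemma hitting_time_fin A w : hitting_time A w < +oo ->
  hitting_time A w = (fine (hitting_time A w))%:E.
Proof. by move=> Aoo; rewrite fineK// ge0_fin_numE// hitting_time_ge0. Qed.

Lemma fine_hitting_time_ge0 A w : (0 <= fine (hitting_time A w))%R.
Proof. exact/fine_ge0/hitting_time_ge0. Qed.

(** The infimum is approached from above by times spent in [A], so right-continuity places the path
    at its hitting time in the closure of [A], though perhaps not in [A]. *)
Lemma hitting_time_near A w (e : R) : (0 < e)%R -> hitting_time A w < +oo ->
  exists2 t : R, A (w t) & (`|w t - w (fine (hitting_time A w))| < e)%R.
Proof.
move=> e0 Aoo; set u := fine _.
have [delta delta0 wd] := cadlag_right w (fine_hitting_time_ge0 A w) e0.
have : hitting_time A w < (u + delta)%:E.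
  by rewrite hitting_time_fin// lte_fin ltrDl.
move=> /hitting_time_ltP[t [t0 tu At]]; exists t => //; apply: wd.
rewrite -lte_fin tu andbT -lee_fin -hitting_time_fin//.
exact: hitting_time_le.
Qed.

Lemma hitting_time_shift A w t : (0 <= t)%R -> t%:E < hitting_time A w ->
  hitting_time A w = t%:E + hitting_time A (path_shift t w).
Proof.
move=> t0 tA; apply/eqP; rewrite eq_le; apply/andP; split.
  rewrite addeC -leeBlDr//; apply: le_ereal_inf_tmp => _ [s [s0 As] <-].
  rewrite leeBlDr// -EFinD; apply: hitting_time_le; first by rewrite addr_ge0.
  by rewrite addrC -path_shiftE.
apply: le_ereal_inf_tmp => _ [s [s0 As] <-].
have ts : (t <= s)%R.
  by rewrite -lee_fin (le_trans (ltW tA))//; exact: hitting_time_le.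
rewrite addeC -leeBrDr// -EFinB; apply: hitting_time_le; first by rewrite subr_ge0.
by rewrite path_shiftE// ?subr_ge0// addrC subrK.
Qed.

(** A path that visits an open set stays there for a while by right-continuity, so visits before s
    can be looked for at rational times. *)
Lemma optional_hitting_time_open G : open G -> optional_time (hitting_time G).
Proof.
move=> oG; split; first exact: hitting_time_ge0.
move=> s; pose C (q : rat) :=
  [set w : cadlag R | (0 <= (ratr q : R) < s)%R /\ G (w (ratr q))].
rewrite (_ : [set w | _] = \bigcup_q C q).
  apply: (@bigcupT_measurable_rat _ (filtered s)) => q.
  have [/andP[q0 qs]|qs] := boolP (0 <= (ratr q : R) < s)%R.
    apply: sub_sigma_algebra; exists (ratr q), G; split => //=.
    - by rewrite q0 ltW.
    - exact: open_measurable.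
    - by apply/seteqP; split => w; rewrite /C /=; [case|move=> Gq; rewrite q0 qs].
  rewrite (_ : C q = set0); first exact: (@measurable0 _ (filtered s)).
  by apply/seteqP; split => w //= -[qs' _]; move: qs; rewrite qs'.
apply/seteqP; split => w /=; last first.
  move=> [q _ [/andP[q0 qs] Gq]]; apply/hitting_time_ltP; exists (ratr q).
  by rewrite lte_fin.
move=> /hitting_time_ltP[t [t0]]; rewrite lte_fin => ts Gt.
have /open_nbhs_nbhs/nbhs_ballP[e /= e0 eG] : open_nbhs (w t) G by [].
have [delta delta0 wd] := cadlag_right w t0 e0.
have : (t < Num.min s (t + delta))%R by rewrite lt_min ts ltrDl.
move=> /rat_in_itvoo[q]; rewrite in_itv/= lt_min => /and3P[tq qs qd].
exists q => //; rewrite /C /= qs (le_trans t0 (ltW tq)); split => //.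
by apply: eG; rewrite -ball_normE /= distrC; apply: wd; rewrite qd ltW.
Qed.

Lemma optional_time_sup (T : nat -> cadlag R -> \bar R) :
  (forall n, optional_time (T n)) ->
  optional_time (fun w => ereal_sup (range (T^~ w))).
Proof.
move=> oT; split=> [w|s].
  by apply: le_trans ((oT 0%N).1 w) _; apply: ereal_sup_ubound; exists 0%N.
(* All [T n] may lie below s while their supremum equals s, hence the margin 1/(m+1), uniform in
   n. *)
rewrite (_ : [set w | _] =
  \bigcup_m \bigcap_n [set w | T n w < (s - m.+1%:R^-1)%:E]); last first.
  apply/seteqP; split => w /=.
    move=> Ts; have [r Tr rs] : exists2 r : R,
        ereal_sup (range (T^~ w)) < r%:E & (r < s)%R.
      have Tfin : ereal_sup (range (T^~ w)) \is a fin_num.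
        rewrite ge0_fin_numE; first by rewrite (lt_trans Ts)// ltry.
        by apply: le_trans ((oT 0%N).1 w) _; apply: ereal_sup_ubound; exists 0%N.
      move: Ts; rewrite -(fineK Tfin) lte_fin => Ts.
      exists ((fine (ereal_sup (range (T^~ w))) + s) / 2)%R; rewrite ?lte_fin; lra.
    have sr : (0 < s - r)%R by rewrite subr_gt0.
    exists (Num.truncn (s - r)^-1) => // n _ /=.
    apply: (@le_lt_trans _ _ (ereal_sup (range (T^~ w)))).
      by apply: ereal_sup_ubound; exists n.
    apply: lt_le_trans Tr _; rewrite lee_fin lerBrDr -lerBrDl.
    by rewrite invf_ple ?posrE// ltW// truncnS_gt.
  move=> [m _ Tm]; apply: (@le_lt_trans _ _ (s - m.+1%:R^-1)%:E).
    by apply: ge_ereal_sup => _ [n _ <-]; exact/ltW/Tm.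
  by rewrite lte_fin ltrBlDr ltrDl.
apply: (@bigcupT_measurable _ (filtered s)) => m.
apply: (@bigcapT_measurable _ (filtered s)) => n.
by apply: natural_filtration_mono ((oT n).2 _); rewrite lerBlDr lerDl.
Qed.

Lemma optional_time_inf (T : nat -> cadlag R -> \bar R) :
  (forall n, optional_time (T n)) ->
  optional_time (fun w => ereal_inf (range (T^~ w))).
Proof.
move=> oT; split=> [w|s].
  by apply: le_ereal_inf_tmp => _ [n _ <-]; exact: (oT n).1.
rewrite (_ : [set w | _] = \bigcup_n [set w | T n w < s%:E]).
  by apply: (@bigcupT_measurable _ (filtered s)) => n; exact: (oT n).2.
apply/seteqP; split => w /=.
  by move=> /ereal_inf_lt[_ [n _ <-] Ts]; exists n.
by move=> [n _ /=]; apply: le_lt_trans; apply: ereal_inf_lbound; exists n.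
Qed.

Lemma optional_time_right_filtration T t : optional_time T ->
  right_filtration t [set w | t%:E < T w].
Proof.
move=> oT s /= ts.
rewrite (_ : [set _ | _] = ~` \bigcap_n [set w | T w < (t + (s - t) / n.+1%:R)%:E]).
  apply: (@measurableC _ (filtered s)); apply: (@bigcapT_measurable _ (filtered s)) => n.
  apply: natural_filtration_mono (oT.2 _).
  rewrite addrC -lerBrDr ler_pdivrMr// ler_peMr ?ler1n// subr_ge0 ltW//.
apply/seteqP; split => w /=.
  move=> tT Tn; have : T w <= t%:E; last by rewrite leNgt tT.
  apply/lee_addgt0Pr => e e0.
  apply: (@le_trans _ _ (t + (s - t) / (Num.truncn ((s - t) / e)).+1%:R)%:E).
    exact/ltW/(Tn (Num.truncn ((s - t) / e))).
  rewrite -EFinD lee_fin lerD2l ler_pdivrMr// mulrC -ler_pdivrMr//.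
  by rewrite ltW// truncnS_gt.
move=> nT; rewrite ltNge; apply/negP => Tt; apply: nT => n _ /=.
by rewrite (le_lt_trans Tt)// lte_fin ltrDl divr_gt0// subr_gt0.
Qed.

End hitting_times.

(** * Quasi-left-continuity *)

Section quasi_left_continuity.
Context {R : realType} {P : R -> probability (cadlag R) R}.
Hypothesis hlevy : levy_family P.
Local Open Scope ereal_scope.
Implicit Types (w : cadlag R) (x t s : R) (B : set R) (T : cadlag R -> \bar R).

(** Bounded and continuous, so that bounded convergence applies to displacements whatever the
    moments of the process. *)
Let trunc1 (y : R) : R := (Num.min `|y| 1)%R.

Let trunc1_itv y : (0 <= trunc1 y <= 1)%R.
Proof. by rewrite /trunc1 le_min normr_ge0 ler01 ge_min lexx orbT. Qed.

Let trunc1_continuous : continuous trunc1.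
Proof.
move=> y; apply: (@continuous_min _ _ (fun z : R => `|z|%R) (cst 1%R)).
  exact: norm_continuous.
exact: cvg_cst.
Qed.

Let measurable_trunc1 : measurable_fun setT trunc1.
Proof. exact: continuous_measurable_fun. Qed.

Let displacement s := \int[P 0%R]_w (trunc1 (w s))%:E.

Let displacement_itv s : 0 <= displacement s <= 1.
Proof.
apply/andP; split.
  by apply: integral_ge0 => w _; rewrite lee_fin; case/andP : (trunc1_itv (w s)).
rewrite -(@probability_setT _ _ _ (P 0%R)) -[leRHS]mul1e -integral_cst//.
apply: ge0_le_integral => //.
- by move=> w _; rewrite lee_fin; case/andP : (trunc1_itv (w s)).
- by apply/measurable_EFinP; exact: measurableT_comp measurable_trunc1 (measurable_eval s).
- by move=> w _; rewrite lee_fin; case/andP : (trunc1_itv (w s)).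
Qed.

Let displacement_fin s : displacement s \is a fin_num.
Proof.
have /andP[d0 d1] := displacement_itv s.
by rewrite ge0_fin_numE// (le_lt_trans d1)// ltry.
Qed.

Let cvg_displacement : displacement (n.+1%:R^-1)%R @[n --> \oo] --> 0.
Proof.
have -> : 0 = \int[P 0%R]_w (trunc1 (w 0%R))%:E.
  have m0 : measurable [set w : cadlag R | w 0%R = 0%R].
    rewrite -[X in measurable X]setTI.
    exact: (measurable_eval 0 measurableT (measurable_set1 0%R)).
  have P0 : P 0%R (~` [set w : cadlag R | w 0%R = 0%R]) = 0.
    by rewrite probability_setC// (levy_start hlevy) subee.
  rewrite -(integral0 (P 0%R) setT).
  apply: (@integral_off_null _ _ _ _ (~` [set w : cadlag R | w 0%R = 0%R])) => //.
  - exact: measurableC.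
  - by move=> w /contrapT/= ->; rewrite /trunc1 normr0 (min_idPl _).
apply: (@cvg_integral_bounded _ _ _ (P 0%R) _ _ 1%R).
- by move=> n; exact: measurableT_comp measurable_trunc1 (measurable_eval _).
- by move=> n w; have /andP[d0 d1] := trunc1_itv (w (n.+1%:R^-1)%R); rewrite ger0_norm.
- move=> w; apply: continuous_cvg; first exact: trunc1_continuous.
  by apply: cadlag_cvg => //; exact: cvg_harmonic.
Qed.

(** After T the path moves like a new one started at 0. Only an inequality results, since T may be
    infinite with positive probability. *)
Let displacement_optional x T s : optional_time T -> (0 <= s)%R ->
  \int[P x]_(w in [set w | T w < +oo])
     (trunc1 (w (fine (T w) + s) - w (fine (T w))))%R%:E <= displacement s.
Proof.
move=> oT s0; pose c := fine (displacement s).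
have cE : c%:E = displacement s by rewrite fineK.
have mD : measurable [set w | T w < +oo].
  rewrite -[X in measurable X]setTI; apply: emeasurable_fun_infty_o => //.
  exact: measurable_optional_time.
rewrite (@strong_markov_principle _ P x 1%R T oT
  (fun t w => trunc1 (w (t + s) - w t))%R (fun _ _ => c)).
- rewrite integral_cst// cE -[leRHS]mule1 lee_wpmul2l ?probability_le1//.
  by case/andP : (displacement_itv s).
- move=> t t0; apply: measurableT_comp measurable_trunc1 _.
  by apply: measurable_funB; exact: measurable_eval.
- by move=> t _; exact: measurable_cst.
- by move=> t w _; exact: trunc1_itv.
- by move=> t w _; rewrite -!lee_fin cE; exact: displacement_itv.
- move=> t w t0; apply: continuous_cvg; first exact: trunc1_continuous.
  apply: cvgB; last exact: cvg_eval_grid.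
  apply: cadlag_cvg; first by rewrite addr_ge0.
  + by move=> n; rewrite lerD2r grid_above_ge.
  + by apply: cvgD; [exact: grid_above_cvg|exact: cvg_cst].
- by move=> t w _; exact: cvg_cst.
- move=> t C t0 tC; have mC := natural_filtration_measurable tC.
  rewrite integral_cst// cE.
  pose g (z : filtered t * R) := (\1_C (z.1 : cadlag R))%:E * (trunc1 z.2)%:E.
  have mg : measurable_fun setT g.
    apply: emeasurable_funM; apply/measurable_EFinP.
      exact: measurableT_comp (@measurable_indic _ (filtered t) R setT C tC) measurable_fst.
    exact: measurableT_comp measurable_trunc1 measurable_snd.
  transitivity (\int[P x]_w g (w, w (t + s) - w t)%R).
    rewrite integral_mkcond; apply: eq_integral => w _.
    by rewrite patchE /g indicE; case: ifPn => _ /=; rewrite ?mul1e ?mul0e.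
  rewrite (expect_increment hlevy)//; first last.
  + move=> z; rewrite /g mule_ge0// lee_fin//.
    by case/andP : (trunc1_itv z.2).
  + by rewrite t0 lerDl.
  transitivity (\int[P x]_w ((\1_C w)%:E * displacement s)).
    apply: eq_integral => w _; rewrite /g /= addrAC subrr add0r ge0_integralZl//.
    * by apply/measurable_EFinP; exact: measurableT_comp measurable_trunc1 (measurable_eval s).
    * by move=> v _; rewrite lee_fin; case/andP : (trunc1_itv (v s)).
  rewrite ge0_integralZr//.
  + by rewrite integral_indic// setIT muleC.
  + by apply/measurable_EFinP; exact: measurable_indic.
  + by case/andP : (displacement_itv s).
Qed.

Section increasing_times.
Variable T : nat -> cadlag R -> \bar R.
Hypothesis oT : forall k, optional_time (T k).
Hypothesis ndT : forall w, nondecreasing_seq (T^~ w).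

Let S w := ereal_sup (range (T^~ w)).

Let TS k w : T k w <= S w.
Proof. by apply: ereal_sup_ubound; exists k. Qed.

Let jump j k w : \bar R :=
  (trunc1 (w (fine (T k w) + j.+1%:R^-1) - w (fine (T k w))))%R%:E.

(** Suppose that the path converges along [T k] to a limit other than its value at S. For each j,
    once k is large the window of length 1/(j+1) after [T k] contains S, so the displacement over it
    sees the jump; this is why the inner limit is the one in k. *)
Let residual w : \bar R := limn_einf (fun j => limn_einf (fun k => jump j k w)).

Let mjump j k : measurable_fun setT (jump j k).
Proof.
have mT : measurable_fun setT (fun w => fine (T k w)).
  exact: measurableT_comp (fine_measurable measurableT) (measurable_optional_time (oT k)).
apply/measurable_EFinP; apply: measurableT_comp measurable_trunc1 _.
apply: measurable_funB; apply: measurable_eval_comp => //.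
exact: measurable_funD.
Qed.

Let jump_ge0 j k w : 0 <= jump j k w.
Proof.
rewrite lee_fin.
by have /andP[] := trunc1_itv (w (fine (T k w) + j.+1%:R^-1) - w (fine (T k w)))%R.
Qed.

Let limn_einf_ge (u : (\bar R)^nat) (c : \bar R) (K : nat) :
  (forall k, (K <= k)%N -> c <= u k) -> c <= limn_einf u.
Proof.
move=> cu; rewrite limn_einf_lim; have /cvg_lim -> // := @cvg_einfs_sup _ u.
apply: le_trans (ereal_sup_ubound _); last by exists K.
by apply: le_ereal_inf_tmp => _ [k /= Kk <-]; exact: cu.
Qed.

Let lee_limn_einf (u v : (\bar R)^nat) :
  (forall k, u k <= v k) -> limn_einf u <= limn_einf v.
Proof.
move=> uv; rewrite !limn_einf_lim; apply: lee_lim; try exact: is_cvg_einfs.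
apply: nearW => n; apply: le_ereal_inf_tmp => _ [k /= nk <-].
by apply: le_trans (uv k); apply: ereal_inf_lbound; exists k.
Qed.

Let measurable_limn_einf (f : nat -> cadlag R -> \bar R) :
  (forall k, measurable_fun setT (f k)) ->
  measurable_fun setT (fun w => limn_einf (f^~ w)).
Proof.
move=> mf; rewrite (_ : (fun w => _) = (fun w => - limn_esup (fun k => - f k w))).
  by apply: measurableT_comp => //; apply: measurable_fun_limn_esup => k;
    exact: measurableT_comp (mf k).
by apply/funext => w; rewrite -[fun k => - _]/(-%E \o (f^~ w)) limn_esupN oppeK.
Qed.

Let mresidual : measurable_fun setT residual.
Proof. by apply: measurable_limn_einf => j; apply: measurable_limn_einf. Qed.

(* The paths that do not converge along [T k] have [residual w <> 0], while its expectation is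
   at most the liminf of [displacement (1/(j+1))], which is 0: this is quasi-left-continuity. *)
Definition exceptional_paths : set (cadlag R) :=
  [set w | S w < +oo] `&` [set w | residual w != 0].

Let oS : optional_time S.
Proof. exact: optional_time_sup. Qed.

Let mSoo : measurable [set w | S w < +oo].
Proof.
rewrite -[X in measurable X]setTI; apply: emeasurable_fun_infty_o => //.
exact: measurable_optional_time.
Qed.

Lemma measurable_exceptional_paths : measurable exceptional_paths.
Proof.
apply: measurableI => //; rewrite -[X in measurable X]setTI.
rewrite (_ : [set w | _] = residual @^-1` (~` [set 0])).
  by apply: mresidual => //; apply: measurableC; exact: emeasurable_set1.
by apply/seteqP; split => w /= /eqP.
Qed.

Lemma exceptional_paths_null x : P x exceptional_paths = 0.
Proof.
have res0 w : 0 <= residual w.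
  by apply: (@limn_einf_ge _ _ 0) => j _; exact: (@limn_einf_ge _ _ 0).
(* Fatou in j and then in k; the strong Markov bound on each window is uniform in k. *)
have int0 : \int[P x]_(w in [set w | S w < +oo]) residual w <= 0.
  apply: (@le_trans _ _ (limn_einf (fun j => \int[P x]_(w in [set w | S w < +oo])
      limn_einf (fun k => jump j k w)))).
    apply: fatou => //.
    - by move=> j; apply: measurable_funTS; exact: measurable_limn_einf.
    - by move=> j w _; exact: (@limn_einf_ge _ _ 0).
  have -> : 0 = limn_einf (fun j => displacement (j.+1%:R^-1)%R).
    by have /cvg_limn_einf_sup[-> _] := cvg_displacement.
  apply: lee_limn_einf => j.
  apply: (@le_trans _ _ (limn_einf (fun k =>
      \int[P x]_(w in [set w | S w < +oo]) jump j k w))).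
    by apply: fatou => // k; exact: measurable_funTS.
  have cst_lim (c : \bar R) : limn_einf (fun _ : nat => c) = c.
    have cc : (fun _ : nat => c) @ \oo --> c by exact: cvg_cst.
    by have [-> _] := cvg_limn_einf_sup cc.
  rewrite -[leRHS]cst_lim.
  apply: lee_limn_einf => k.
  have j0 : (0 <= j.+1%:R^-1 :> R)%R by rewrite invr_ge0.
  apply: le_trans (displacement_optional x (oT k) j0).
  apply: ge0_subset_integral => //.
  - rewrite -[X in measurable X]setTI; apply: emeasurable_fun_infty_o => //.
    exact: measurable_optional_time.
  - exact: measurable_funTS.
  - by move=> w /=; apply: le_lt_trans (TS k w).
have : \int[P x]_(w in [set w | S w < +oo]) `|residual w| = 0.
  apply/eqP; rewrite eq_le integral_ge0 ?andbT//.
  by under eq_integral do rewrite gee0_abs//.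
move=> /ae_eq_integral_abs => /(_ mSoo (measurable_funTS mresidual)) res_ae.
apply/negligibleP; first exact: measurable_exceptional_paths.
apply: negligibleS res_ae => w [/= Sw resw] H.
by move: resw; rewrite (H Sw) eqxx.
Qed.

Let trunc1_le (y z e : R) : (0 <= e)%R -> (`|y| <= `|z| + e)%R ->
  (trunc1 y <= trunc1 z + e)%R.
Proof.
move=> e0 yz; rewrite /trunc1.
have [z1|z1] := leP `|z|%R 1%R; first by rewrite ge_min yz.
by rewrite (@le_trans _ _ 1%R) ?ge_min ?lexx ?orbT// lerDl.
Qed.

Section regular_path.
Variable w : cadlag R.
Hypothesis nw : ~ exceptional_paths w.
Hypothesis Soo : S w < +oo.

Let tau k := fine (T k w).
Let sigma := fine (S w).

Let S0 : 0 <= S w.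
Proof. by apply: le_trans (TS 0 w); exact: (oT 0%N).1. Qed.

Let sigmaE : S w = sigma%:E.
Proof. by rewrite fineK// ge0_fin_numE. Qed.

Let tauE k : T k w = (tau k)%:E.
Proof. by rewrite fineK// ge0_fin_numE ?(oT k).1// (le_lt_trans (TS k w)). Qed.

Let sigma0 : (0 <= sigma)%R.
Proof. exact: fine_ge0. Qed.

Let tau_sigma k : (tau k <= sigma)%R.
Proof. by rewrite -lee_fin -tauE -sigmaE; exact: TS. Qed.

Let cvg_tau : tau k @[k --> \oo] --> sigma.
Proof. by apply: fine_cvg; rewrite -sigmaE; exact: ereal_nondecreasing_cvgn. Qed.

(** Either the times reach S and are constant from then on, or they stay strictly below S, where the
    path has a left limit. *)
Let left_limit : exists L : R, w (tau k) @[k --> \oo] --> L.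
Proof.
have [[K tK]|nK] := pselect (exists k, tau k = sigma).
  exists (w sigma); apply: cvg_near_cst; exists K => // k /= Kk.
  congr (w _); apply/eqP; rewrite eq_le tau_sigma/= -tK -lee_fin -!tauE.
  exact: ndT.
have tau_lt k : (tau k < sigma)%R.
  by rewrite lt_neqAle tau_sigma andbT; apply/eqP => tk; apply: nK; exists k.
have sigma_gt0 : (0 < sigma)%R.
  by apply: le_lt_trans (tau_lt 0%N); exact/fine_ge0/(oT _).1.
have [L wL] := cadlag_left w sigma_gt0; exists L.
apply/cvgrPdist_lt => e e0; have [delta delta0 wd] := wL _ e0.
move/cvgrPdist_lt : cvg_tau => /(_ _ delta0); apply: filterS => k /=.
rewrite ltr_norml => /andP[_ kd]; rewrite distrC; apply: wd.
by rewrite tau_lt andbT; lra.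
Qed.

Lemma cvg_position_optional_time : w (fine (T k w)) @[k --> \oo] --> w (fine (S w)).
Proof.
have [L wL] := left_limit.
have [<- //|/eqP Lsigma] := pselect (L = w sigma).
pose eta := trunc1 (L - w sigma).
have eta0 : (0 < eta)%R by rewrite /eta /trunc1 lt_min ltr01 normr_gt0 subr_eq0 Lsigma.
(* Of the gap eta, one quarter is lost between [w (tau k)] and L and one between the end of the
   window and [w sigma]; one half is left for the displacement. *)
have e0 : (0 < eta / 4)%R by rewrite divr_gt0.
have cL : trunc1 (w (tau k) - w sigma)%R @[k --> \oo] --> eta.
  apply: continuous_cvg; first exact: trunc1_continuous.
  by apply: cvgB => //; exact: cvg_cst.
have [delta delta0 wd] := cadlag_right w sigma0 e0.
have /cvgrPdist_lt /(_ _ e0)[K1 _ HK1] := cL.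
(* Windows shorter than delta end where the path is still close to [w sigma]. *)
pose J := Num.truncn delta^-1.
suff resid : (eta / 2)%:E <= residual w.
  exfalso; apply: nw; split => //=.
  by rewrite gt_eqF// (lt_le_trans _ resid)// lte_fin divr_gt0.
apply: (@limn_einf_ge _ _ J) => j Jj.
have j0 : (0 < j.+1%:R^-1 :> R)%R by rewrite invr_gt0.
have jd : (j.+1%:R^-1 < delta)%R.
  rewrite invf_plt ?posrE// (lt_le_trans (truncnS_gt _))// ler_nat.
  by rewrite ltnS.
have /cvgrPdist_lt /(_ _ j0)[K2 _ HK2] := cvg_tau.
apply: (@limn_einf_ge _ _ (maxn K1 K2)) => k; rewrite geq_max => /andP[K1k K2k].
have /= := HK1 k K1k; rewrite ltr_norml => /andP[_ h1].
have /= := HK2 k K2k; rewrite ltr_norml => /andP[_ h2].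
rewrite lee_fin -/(tau k); set sj := (j.+1%:R^-1)%R in j0 jd h2 *.
have ts := tau_sigma k.
have h3 : (`|w (tau k + sj) - w sigma| < eta / 4)%R.
  by apply: wd; apply/andP; split; lra.
have h4 : (trunc1 (w (tau k) - w sigma) <=
    trunc1 (w (tau k + sj) - w (tau k)) + eta / 4)%R.
  apply: trunc1_le; first exact: ltW.
  rewrite (_ : w (tau k) - w sigma = (w (tau k + sj) - w sigma) -
    (w (tau k + sj) - w (tau k)))%R; last by ring.
  by rewrite (le_trans (ler_normB _ _))// addrC lerD2l ltW.
by lra.
Qed.

End regular_path.

End increasing_times.

End quasi_left_continuity.

(** * Hitting times of closed sets *)

Section hitting_closed.
Context {R : realType}.
Local Open Scope ereal_scope.
Implicit Types (w : cadlag R) (B : set R).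

Definition thickening B (k : nat) : set R :=
  [set y | exists2 z, B z & (`|y - z| < k.+1%:R^-1)%R].

Lemma open_thickening B k : open (thickening B k).
Proof.
rewrite (_ : thickening B k = \bigcup_(z in B) ball z k.+1%:R^-1).
  by apply: bigcup_open => z _; exact: ball_open.
apply/seteqP; split => y /=.
  by move=> [z Bz yz]; exists z => //; rewrite -ball_normE /= distrC.
by move=> [z Bz]; rewrite -ball_normE /= distrC => yz; exists z.
Qed.

Lemma sub_thickening B k : B `<=` thickening B k.
Proof. by move=> y By; exists y => //; rewrite subrr normr0 invr_gt0. Qed.

Lemma thickening_mono B j k : (j <= k)%N -> thickening B k `<=` thickening B j.
Proof.
move=> jk y [z Bz yz]; exists z => //; apply: lt_le_trans yz _.
by rewrite lef_pV2 ?posrE// ler_nat ltnS.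
Qed.

Definition approx_hitting_time B k w := hitting_time (thickening B k) w.

Lemma optional_approx_hitting_time B k : optional_time (approx_hitting_time B k).
Proof. exact/optional_hitting_time_open/open_thickening. Qed.

Lemma approx_hitting_time_mono B w : nondecreasing_seq (approx_hitting_time B ^~ w).
Proof. by move=> j k jk; apply: hitting_time_subset; exact: thickening_mono. Qed.

Definition hitting_null_set B := exceptional_paths (approx_hitting_time B).

(** The hitting times of the thickenings increase to S. By quasi-left-continuity the path converges
    along them to its value at S, while its positions approach [B]; as [B] is closed, it is hit at
    S. *)
Lemma hitting_timeE_closed B w : closed B -> ~ hitting_null_set B w ->
  hitting_time B w = ereal_sup (range (approx_hitting_time B ^~ w)).
Proof.
move=> cB nw; set S := ereal_sup _.
have SB : S <= hitting_time B w.
  by apply: ge_ereal_sup => _ [k _ <-]; apply: hitting_time_subset; exact: sub_thickening.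
apply/eqP; rewrite eq_le SB andbT.
have [Soo|] := ltP S +oo; last by rewrite leye_eq => /eqP ->; exact: leey.
have cw := cvg_position_optional_time (optional_approx_hitting_time B)
  (@approx_hitting_time_mono B) nw Soo.
have S0 : 0 <= S.
  by apply: le_trans (hitting_time_ge0 _ _) _; last (apply: ereal_sup_ubound; exists 0%N).
rewrite -[leRHS]fineK ?ge0_fin_numE//; apply: hitting_time_le; first exact: fine_ge0.
apply: contrapT => nB.
have /open_nbhs_nbhs/nbhs_ballP[e /= e0 eB] : open_nbhs (w (fine S)) (~` B).
  by split => //; exact: closed_openC.
(* The radius e is split into e/2 from the path at S to the path at the k-th hitting time, e/4 from
   there to a nearby visit of the thickening, and e/4 from that visit to a point of [B]. *)
have e20 : (0 < e / 2)%R by rewrite divr_gt0.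
have /cvgrPdist_lt /(_ _ e20)[K1 _ HK1] := cw.
pose k := maxn K1 (Num.truncn (4 / e)).
have ke : (k.+1%:R^-1 < e / 4)%R.
  rewrite -[ltRHS]invf_div ltf_pV2 ?posrE ?divr_gt0//.
  by rewrite (lt_le_trans (truncnS_gt _))// ler_nat ltnS leq_maxr.
have Tk : approx_hitting_time B k w < +oo.
  by apply: le_lt_trans Soo; apply: ereal_sup_ubound; exists k.
have k0 : (0 < k.+1%:R^-1 :> R)%R by rewrite invr_gt0.
have [t [z Bz tz] tT] : exists2 t : R, thickening B k (w t) &
    (`|w t - w (fine (approx_hitting_time B k w))| < k.+1%:R^-1)%R.
  exact: hitting_time_near k0 Tk.
have /= := HK1 k (leq_maxl _ _) => h.
suff : (~` B) z by exact.
apply: eB; rewrite -ball_normE /=.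
rewrite (_ : w (fine S) - z = (w (fine S) - w (fine (approx_hitting_time B k w)))
  - (w t - w (fine (approx_hitting_time B k w))) + (w t - z))%R; last by ring.
apply: le_lt_trans (ler_normD _ _) _.
have := ler_normB (w (fine S) - w (fine (approx_hitting_time B k w)))%R
  (w t - w (fine (approx_hitting_time B k w)))%R.
set inv := (k.+1%:R^-1)%R in ke tz tT * => hB; lra.
Qed.

End hitting_closed.

Section convergence_off_null.
Local Open Scope ereal_scope.
Context d (T : measurableType d) (R : realType) (P : probability T R).

Lemma cvg_integral_off_null (N : set T) (f_ : nat -> T -> R) (f : T -> R) (M : R) :
  measurable N -> P N = 0 ->
  (forall n, measurable_fun setT (f_ n \_ (~` N))) ->
  (forall n x, `|f_ n x| <= M)%R ->
  (forall x, ~ N x -> f_ n x @[n --> \oo] --> f x) ->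
  \int[P]_x (f_ n x)%:E @[n --> \oo] --> \int[P]_x (f x)%:E.
Proof.
move=> mN N0 mf fM ff.
have E (g : T -> R) : \int[P]_x (g x)%:E = \int[P]_x ((g \_ (~` N)) x)%:E.
  by apply: (integral_off_null mN N0) => x Nx; rewrite patchE mem_set.
rewrite E (_ : (fun n => _) = (fun n => \int[P]_x ((f_ n \_ (~` N)) x)%:E)); last first.
  by apply/funext => n; exact: E.
apply: (@cvg_integral_bounded _ _ _ P (fun n => f_ n \_ (~` N)) _ M) => //.
  move=> n x; rewrite patchE; case: ifPn => // _; rewrite normr0.
  exact: le_trans (fM n x).
move=> x; have [Nx|Nx] := pselect (N x).
  have nNx : ~ (~` N) x by move/(_ Nx).
  rewrite patchE memNset//; under eq_cvg do rewrite patchE memNset//.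
  exact: cvg_cst.
rewrite patchE mem_set//; under eq_cvg do rewrite patchE mem_set//.
exact: ff.
Qed.

End convergence_off_null.

(** * Hitting times of F_sigma sets and discounted positions *)

Section discounted_hit.
Context {R : realType} {P : R -> probability (cadlag R) R}.
Hypothesis hlevy : levy_family P.
Local Open Scope ereal_scope.
Implicit Types (w : cadlag R) (x q : R) (A B : set R) (u : R -> R).

(** A genuine optional time that agrees with the hitting time outside [N]. One [N] serves all
    starting points, as the Markov property restarts the process from random ones. *)
Definition hitting_version A (T : cadlag R -> \bar R) (N : set (cadlag R)) :=
  [/\ optional_time T, measurable N, (forall x, P x N = 0) &
      forall w, ~ N w -> hitting_time A w = T w].

Lemma hitting_version_closed B : closed B -> hitting_version B
  (fun w => ereal_sup (range (approx_hitting_time B ^~ w))) (hitting_null_set B).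
Proof.
move=> cB; split.
- by apply: optional_time_sup => n; exact: optional_approx_hitting_time.
- by apply: measurable_exceptional_paths => n; exact: optional_approx_hitting_time.
- move=> x; apply: (exceptional_paths_null hlevy) => n.
  exact: optional_approx_hitting_time.
- by move=> w nw; exact: hitting_timeE_closed.
Qed.

Lemma hitting_time_bigcup (B : nat -> set R) w :
  hitting_time (\bigcup_n B n) w = ereal_inf (range (fun n => hitting_time (B n) w)).
Proof.
apply/eqP; rewrite eq_le; apply/andP; split.
  apply: le_ereal_inf_tmp => _ [n _ <-]; apply: hitting_time_subset.
  exact: bigcup_sup.
apply: le_ereal_inf_tmp => _ [t [t0 [n _ Bt]] <-].
apply: le_trans (hitting_time_le t0 Bt).
by apply: ereal_inf_lbound; exists n.
Qed.

Lemma hitting_version_bigcup (B : nat -> set R) T N :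
  (forall n, hitting_version (B n) (T n) (N n)) ->
  hitting_version (\bigcup_n B n) (fun w => ereal_inf (range (T ^~ w))) (\bigcup_n N n).
Proof.
move=> BTN; split.
- by apply: optional_time_inf => n; case: (BTN n).
- by apply: bigcupT_measurable => n; case: (BTN n).
- move=> x; apply/negligibleP.
    by apply: bigcupT_measurable => n; case: (BTN n).
  by apply: negligible_bigcup => n; case: (BTN n) => _ mN N0 _; apply/negligibleP => //; exact: N0.
- move=> w nw; rewrite hitting_time_bigcup.
  suff -> : (fun n => hitting_time (B n) w) = T ^~ w by [].
  apply/funext => n; case: (BTN n) => _ _ _; apply => Nw.
  by apply: nw; exists n.
Qed.

Lemma Fsigma_nondecreasing A : Fsigma A -> exists2 B : nat -> set R,
  (forall n, closed (B n)) & nondecreasing_seq B /\ A = \bigcup_n B n.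
Proof.
move=> [F cF ->]; exists (fun n => \bigcup_(i in `I_n.+1) F i).
  by move=> n; apply: closed_bigcup => // ; exact: finite_II.
split.
  move=> m n mn; apply/subsetPset => y [i /= im Fy]; exists i => //=.
  exact: leq_trans im _.
apply/seteqP; split => y [n _].
  by move=> Fy; exists n => //; exists n => //=.
by move=> [i _ Fy]; exists i.
Qed.

Definition discounted_hit q u A w : R :=
  if hitting_time A w < +oo
  then (expR (- (q * fine (hitting_time A w))) * u (w (fine (hitting_time A w))))%R
  else 0%R.

Lemma discounted_hit_le q u A w M : (0 <= q)%R -> (forall y, `|u y| <= M)%R ->
  (`|discounted_hit q u A w| <= M)%R.
Proof.
move=> q0 uM; rewrite /discounted_hit; case: ifPn => _; last first.
  by rewrite normr0; exact: le_trans (uM 0%R).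
rewrite normrM ger0_norm ?expR_ge0// (le_trans _ (uM (w (fine (hitting_time A w)))))//.
rewrite ler_piMl// -expR0 ler_expR oppr_le0 mulr_ge0//.
exact: fine_hitting_time_ge0.
Qed.

Lemma measurable_discounted_hit q u A T N : continuous u -> hitting_version A T N ->
  measurable_fun setT (discounted_hit q u A \_ (~` N)).
Proof.
move=> cu [oT mN _ AT].
have mT := measurable_optional_time oT.
have mfT : measurable_fun setT (fun w => fine (T w)).
  exact: measurableT_comp (fine_measurable measurableT) mT.
have mD : measurable (~` N `&` [set w | T w < +oo]).
  apply: measurableI; first exact: measurableC.
  by rewrite -[X in measurable X]setTI; apply: emeasurable_fun_infty_o.
rewrite (_ : _ \_ _ = (fun w => expR (- (q * fine (T w))) * u (w (fine (T w))))%R \_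
   (~` N `&` [set w | T w < +oo])); last first.
  apply/funext => w; rewrite !patchE /discounted_hit in_setI.
  have [Nw|Nw] := pselect (N w); first by rewrite memNset//; exact.
  rewrite mem_set//= AT//.
  case: ifPn => Tw; first by rewrite mem_set.
  by rewrite memNset//; exact/negP.
apply/(measurable_restrictT _ mD); apply: measurable_funTS.
apply: measurable_funM.
  apply: measurableT_comp => //; apply: measurableT_comp => //.
  exact: measurable_funM.
apply: (measurableT_comp (continuous_measurable_fun cu)).
exact: measurable_eval_comp.
Qed.

Lemma measurable_discounted_hit_open q u G : continuous u -> open G ->
  measurable_fun setT (discounted_hit q u G).
Proof.
move=> cu oG; have : hitting_version G (hitting_time G) set0.
  split; [exact: optional_hitting_time_open|exact: measurable0| |by []].
  by move=> x; exact: measure0.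
by move=> /(measurable_discounted_hit q cu); rewrite setC0 patch_setT.
Qed.

(** Where [B] is hit, quasi-left-continuity gives the convergence of the positions; where it is not,
    the hitting times of the thickenings tend to infinity and the discount tends to 0. *)
Lemma cvg_discounted_hit_closed q u M B w : (0 < q)%R -> continuous u ->
  (forall y, `|u y| <= M)%R -> closed B -> ~ hitting_null_set B w ->
  discounted_hit q u (thickening B k) w @[k --> \oo] --> discounted_hit q u B w.
Proof.
move=> q0 cu uM cB nw; have SB := hitting_timeE_closed cB nw.
have ndT := @approx_hitting_time_mono _ B.
have cT : approx_hitting_time B k w @[k --> \oo] --> hitting_time B w.
  by rewrite SB; exact: ereal_nondecreasing_cvgn.
have TB k : approx_hitting_time B k w <= hitting_time B w.
  by rewrite SB; apply: ereal_sup_ubound; exists k.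
rewrite /discounted_hit; have [Boo|Boo] := ltP (hitting_time B w) +oo.
  under eq_cvg do rewrite (le_lt_trans (TB _) Boo).
  apply: cvgM.
    apply: continuous_cvg; first exact: continuous_expR.
    apply: cvgN; apply: cvgM; first exact: cvg_cst.
    by apply: fine_cvg; rewrite -hitting_time_fin.
  apply: continuous_cvg; first exact: cu.
  rewrite SB; apply: cvg_position_optional_time => //.
  - exact: optional_approx_hitting_time.
  - by rewrite -SB.
move: Boo; rewrite leye_eq => /eqP Boo; rewrite Boo in cT.
have M0 : (0 <= M)%R by exact: le_trans (uM 0%R).
(* Beyond the time M/(e q) the discounted value is below e, because exp(y) >= 1 + y. *)
apply/cvgrPdist_lt => e e0; move/cvgeyPgt : cT => /(_ (M / e / q)%R).
apply: filterS => k kT; rewrite sub0r normrN; case: ifPn => [Tk|_]; last by rewrite normr0.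
set s := fine _; have sq : (M < e * (1 + q * s))%R.
  move: kT; rewrite [approx_hitting_time _ _ _]hitting_time_fin// lte_fin.
  rewrite -/s ltr_pdivrMr// ltr_pdivrMr// => Ms.
  by rewrite mulrDr mulr1; move: Ms; rewrite [(s * q)%R]mulrC [(_ * e)%R]mulrC; lra.
have qs0 : (0 <= q * s)%R by rewrite mulr_ge0 ?fine_hitting_time_ge0// ltW.
rewrite normrM ger0_norm ?expR_ge0// expRN mulrC ltr_pdivrMr ?expR_gt0//.
apply: le_lt_trans (uM _) _; apply: lt_le_trans sq _.
by rewrite ler_pM2l// expR_ge1Dx.
Qed.

(** Here the hitting times decrease to their limit, so right-continuity suffices and no path is
    excluded. *)
Lemma cvg_discounted_hit_bigcup q u (B : nat -> set R) w : continuous u ->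
  nondecreasing_seq B ->
  discounted_hit q u (B n) w @[n --> \oo] --> discounted_hit q u (\bigcup_n B n) w.
Proof.
move=> cu ndB; set A := \bigcup_n B n.
have AB n : hitting_time A w <= hitting_time (B n) w.
  exact/hitting_time_subset/bigcup_sup.
have niT : nonincreasing_seq (fun n => hitting_time (B n) w).
  by move=> m n mn; apply: hitting_time_subset; exact/subsetPset/ndB.
have cT : hitting_time (B n) w @[n --> \oo] --> hitting_time A w.
  by rewrite hitting_time_bigcup; exact: ereal_nonincreasing_cvgn.
rewrite /discounted_hit; have [Aoo|Aoo] := ltP (hitting_time A w) +oo; last first.
  under eq_cvg => n do rewrite ltNge (le_trans Aoo (AB n)) /=.
  exact: cvg_cst.
have cfT : fine (hitting_time (B n) w) @[n --> \oo] --> fine (hitting_time A w).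
  by apply: fine_cvg; rewrite -hitting_time_fin.
have [K _ BK] : \forall n \near \oo, hitting_time (B n) w < +oo.
  have := Aoo; rewrite hitting_time_bigcup => /ereal_inf_lt[_ [K _ <-] Koo].
  by exists K => // n Kn; apply: le_lt_trans Koo; exact: niT.
rewrite -(cvg_shiftn K) /=.
under eq_cvg => n do rewrite (BK _ (leq_addl n K)).
apply: cvgM.
  apply: continuous_cvg; first exact: continuous_expR.
  apply: cvgN; apply: cvgM; first exact: cvg_cst.
  by rewrite (cvg_shiftn K (fun n => fine (hitting_time (B n) w))).
apply: continuous_cvg; first exact: cu.
apply: cadlag_cvg; first exact: fine_hitting_time_ge0.
  move=> n; rewrite -lee_fin -!hitting_time_fin//.
  exact: BK (leq_addl n K).
by rewrite (cvg_shiftn K (fun n => fine (hitting_time (B n) w))).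
Qed.

End discounted_hit.

(** * Potentials *)

Section occupation.
Context {R : realType}.
Local Open Scope ereal_scope.
Local Notation mu := (@lebesgue_measure R).
Implicit Types (w : cadlag R) (f : R -> R) (q t : R).

Definition occupation q f w : \bar R :=
  \int[mu]_(t in `[0%R, +oo[) (expR (- (q * t)) * f (w t))%:E.

Let integrand q f (z : cadlag R * R) : \bar R :=
  (\1_(`[0%R, +oo[%classic : set R) z.2 * (expR (- (q * z.2)) * f (z.1 z.2)))%:E.

Lemma occupationE q f w : occupation q f w = \int[mu]_t integrand q f (w, t).
Proof.
rewrite /occupation integral_mkcond; apply: eq_integral => t _.
by rewrite patchE /integrand indicE /=; case: ifPn => _; rewrite ?mul1r ?mul0r.
Qed.

Lemma measurable_discounted q f (w : cadlag R) : measurable_fun setT f ->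
  measurable_fun setT (fun t => expR (- (q * t)) * f (w t))%R.
Proof.
move=> mf; apply: measurable_funM.
  by apply: measurableT_comp => //; apply: measurableT_comp => //; exact: measurable_funM.
by apply: measurableT_comp mf _; exact: measurable_eval_comp.
Qed.

Let measurable_integrand q f : measurable_fun setT f ->
  measurable_fun setT (integrand q f).
Proof.
move=> mf; apply/measurable_EFinP; apply: measurable_funM.
  have mI : measurable_fun setT (\1_(`[0%R, +oo[%classic) : R -> R).
    exact: measurable_indic.
  exact: measurableT_comp mI measurable_snd.
apply: measurable_funM.
  apply: measurableT_comp => //; apply: measurableT_comp => //.
  by apply: measurable_funM => //; exact: measurable_snd.
apply: measurableT_comp mf _; apply: measurable_eval_comp; first exact: measurable_snd.
exact: measurable_fst.
Qed.

Let integrand_ge0 q f z : (forall y, 0 <= f y)%R -> 0 <= integrand q f z.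
Proof. by move=> f0; rewrite lee_fin !mulr_ge0 ?expR_ge0// indicE. Qed.

Lemma occupation_ge0 q f w : (forall y, 0 <= f y)%R -> 0 <= occupation q f w.
Proof. by move=> f0; apply: integral_ge0 => t _; rewrite lee_fin mulr_ge0 ?expR_ge0. Qed.

Lemma measurable_occupation q f : measurable_fun setT f -> (forall y, 0 <= f y)%R ->
  measurable_fun setT (occupation q f).
Proof.
move=> mf f0; rewrite (_ : occupation q f = fun w => \int[mu]_t integrand q f (w, t)).
  apply: (@measurable_fun_fubini_tonelli_F _ _ _ _ _ mu (integrand q f)).
    exact: measurable_integrand.
  by move=> z; exact: integrand_ge0.
by apply/funext => w; exact: occupationE.
Qed.

Lemma occupation_fubini (Q : probability (cadlag R) R) q f :
  measurable_fun setT f -> (forall y, 0 <= f y)%R ->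
  \int[Q]_w occupation q f w =
  \int[mu]_(t in `[0%R, +oo[) ((expR (- (q * t)))%:E * \int[Q]_w (f (w t))%:E).
Proof.
move=> mf f0; under eq_integral do rewrite occupationE.
rewrite (@fubini_tonelli _ _ _ _ _ Q mu (integrand q f) (measurable_integrand q mf)); last first.
  by move=> z; exact: integrand_ge0.
rewrite [RHS]integral_mkcond; apply: eq_integral => t _; rewrite patchE.
rewrite /integrand /= indicE; case: ifPn => _; last first.
  by under eq_integral do rewrite mul0r; rewrite integral0.
under eq_integral do rewrite mul1r EFinM.
rewrite ge0_integralZl ?lee_fin ?expR_ge0//; last by move=> w _; rewrite lee_fin.
by apply/measurable_EFinP; exact: measurableT_comp mf (measurable_eval t).
Qed.

Lemma occupation_tail q f w t : measurable_fun setT f -> (forall y, 0 <= f y)%R ->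
  (0 <= t)%R ->
  \int[mu]_(s in `[t, +oo[) (expR (- (q * s)) * f (w s))%:E =
  (expR (- (q * t)))%:E * occupation q f (path_shift t w).
Proof.
move=> mf f0 t0; rewrite occupationE.
have mi (v : cadlag R) : measurable_fun setT (fun s => integrand q f (v, s)).
  exact: measurableT_comp (measurable_integrand q mf) _.
rewrite -ge0_integralZl ?lee_fin ?expR_ge0//; last 2 first.
- exact: mi.
- by move=> s _; exact: integrand_ge0.
pose g s := (\1_(`[t, +oo[%classic : set R) s * (expR (- (q * s)) * f (w s)))%:E.
have mg : measurable_fun setT g.
  apply/measurable_EFinP; apply: measurable_funM; last exact: measurable_discounted.
  exact: measurable_indic.
transitivity (\int[mu]_s g s).
  rewrite integral_mkcond; apply: eq_integral => s _.
  by rewrite patchE /g indicE /=; case: ifPn => _; rewrite ?mul1r ?mul0r.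
rewrite -(ge0_integral_translation t mg); last first.
  by move=> s; rewrite lee_fin !mulr_ge0 ?expR_ge0// indicE.
apply: eq_integral => s _; rewrite /g /integrand -EFinM; congr EFin.
have -> : \1_(`[t, +oo[%classic : set R) (s + t)%R = \1_(`[0%R, +oo[%classic : set R) s :> R.
  by rewrite !indicE !mem_setE !in_itv /= !andbT lerDr.
have [s0|s0] := leP 0%R s; last first.
  by rewrite indicE mem_setE in_itv /= leNgt s0 !mul0r mulr0.
rewrite path_shiftE// addrC mulrDr opprD expRD.
by rewrite [(t + s)%R]addrC; ring.
Qed.

(** The factor exp(q t) turns the weights of the first t units of time into exp(q (t - s)), which
    increase with q, and restarts the discounting at t for the rest. *)
Lemma occupation_split q f w t : measurable_fun setT f -> (forall y, 0 <= f y)%R ->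
  (0 <= t)%R ->
  (expR (q * t))%:E * occupation q f w =
  \int[mu]_(s in `[0%R, t[) (expR (q * (t - s)) * f (w s))%:E +
  occupation q f (path_shift t w).
Proof.
move=> mf f0 t0; rewrite {1}/occupation.
have md := measurable_discounted q w mf.
have -> : (`[0%R, +oo[%classic : set R) = `[0%R, t[ `|` `[t, +oo[.
  by rewrite -itv_bndbnd_setU// bnd_simp.
rewrite ge0_integral_setU//; last 3 first.
- by apply/measurable_EFinP; exact: measurable_funTS.
- by move=> s _; rewrite lee_fin mulr_ge0 ?expR_ge0.
- apply/disj_set2P; apply/seteqP; split => // s /= [].
  by rewrite !in_itv/= andbT => /andP[_ st] ts; move: st; rewrite ltNge ts.
rewrite occupation_tail// ge0_muleDr; last 2 first.
- by apply: integral_ge0 => s _; rewrite lee_fin mulr_ge0 ?expR_ge0.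
- by rewrite mule_ge0 ?lee_fin ?expR_ge0// occupation_ge0.
congr (_ + _); last by rewrite muleA -EFinM expRN mulfV ?gt_eqF ?expR_gt0// mul1e.
rewrite -ge0_integralZl ?lee_fin ?expR_ge0//.
- apply: eq_integral => s _; rewrite -EFinM mulrA -expRD; congr ((expR _ * _)%:E).
  by rewrite mulrBr.
- by apply/measurable_EFinP; exact: measurable_funTS.
- by move=> s _; rewrite lee_fin mulr_ge0 ?expR_ge0.
Qed.

Lemma occupation_shift_le q f w t : measurable_fun setT f -> (forall y, 0 <= f y)%R ->
  (0 <= t)%R ->
  occupation q f (path_shift t w) <= (expR (q * t))%:E * occupation q f w.
Proof.
move=> mf f0 t0; rewrite occupation_split// leeDr//.
by apply: integral_ge0 => s _; rewrite lee_fin mulr_ge0 ?expR_ge0.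
Qed.

(** After splitting at t, the parts after t are the same on both sides, and exp(c (t - s)) increases
    with c. Sums stand in for differences, as occupations may be infinite. *)
Lemma occupation_rate_le p q f w t : measurable_fun setT f -> (forall y, 0 <= f y)%R ->
  (0 <= t)%R -> (p <= q)%R ->
  (expR (p * t))%:E * occupation p f w + occupation q f (path_shift t w) <=
  (expR (q * t))%:E * occupation q f w + occupation p f (path_shift t w).
Proof.
move=> mf f0 t0 pq; rewrite !occupation_split// addeAC leeD2r// leeD2r//.
have m c : measurable_fun `[0%R, t[ (fun s => (expR (c * (t - s)) * f (w s))%:E).
  apply/measurable_EFinP; apply: measurable_funTS; apply: measurable_funM.
    apply: measurableT_comp => //; apply: measurable_funM => //.
    exact: measurable_funB.
  by apply: measurableT_comp mf _; exact: measurable_eval_comp.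
apply: ge0_le_integral => //.
- by move=> s _; rewrite lee_fin mulr_ge0 ?expR_ge0.
- exact: m.
- exact: m.
- move=> s /=; rewrite in_itv/= => /andP[s0 st].
  by rewrite lee_fin ler_wpM2r// ler_expR ler_wpM2r// subr_ge0 ltW.
Qed.

Lemma integral_exp q : (0 < q)%R ->
  \int[mu]_(s in `[0%R, +oo[) (expR (- (q * s)))%:E = (q^-1)%:E.
Proof.
move=> q0; have qI := @integral_exponential_pdf R q q0.
have E : \int[mu]_x (exponential_pdf q x)%:E =
    q%:E * \int[mu]_(s in `[0%R, +oo[) (expR (- (q * s)))%:E.
  rewrite -ge0_integralZl ?lee_fin ?(ltW q0)//.
  - rewrite [RHS]integral_mkcond; apply: eq_integral => s _.
    rewrite /exponential_pdf !patchE; case: ifPn => //= _.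
    by rewrite EFinM mulNr.
  - apply/measurable_EFinP; apply: measurable_funTS.
    by apply: measurableT_comp => //; apply: measurableT_comp => //; exact: measurable_funM.
by rewrite -[RHS]mule1 -qI E muleA -EFinM mulVf ?gt_eqF// mul1e.
Qed.

Lemma occupation_le q f w : (0 < q)%R -> measurable_fun setT f ->
  (forall y, 0 <= f y <= 1)%R -> occupation q f w <= (q^-1)%:E.
Proof.
move=> q0 mf f01; rewrite -integral_exp//; apply: ge0_le_integral => //.
- by move=> s _; rewrite lee_fin mulr_ge0 ?expR_ge0//; case/andP : (f01 (w s)).
- by apply/measurable_EFinP; apply: measurable_funTS; exact: measurable_discounted.
- apply/measurable_EFinP; apply: measurable_funTS.
  by apply: measurableT_comp => //; apply: measurableT_comp => //; exact: measurable_funM.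
- move=> s _; rewrite lee_fin ler_piMr ?expR_ge0//.
  by case/andP : (f01 (w s)).
Qed.

Lemma cvg_occupation_grid q f w t : (0 < q)%R -> continuous f ->
  (forall y, 0 <= f y <= 1)%R -> (0 <= t)%R ->
  occupation q f (path_shift (grid_above n t) w) @[n --> \oo] -->
  occupation q f (path_shift t w).
Proof.
move=> q0 cf f01 t0; have mf := continuous_measurable_fun cf.
have [] // := @dominated_convergence _ _ _ mu `[0%R, +oo[%classic (measurable_itv _)
  (fun n s => (expR (- (q * s)) * f (path_shift (grid_above n t) w s))%:E)
  (fun s => (expR (- (q * s)) * f (path_shift t w s))%:E)
  (fun s => (expR (- (q * s)))%:E).
- move=> n; apply/measurable_EFinP; apply: measurable_funTS.
  exact: measurable_discounted.
- by apply/measurable_EFinP; apply: measurable_funTS; exact: measurable_discounted.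
- apply/aeW => s sI; have s0 : (0 <= s)%R by move: sI; rewrite /= in_itv/= andbT.
  apply: cvg_EFin; first exact: nearW.
  apply: cvgM; first exact: cvg_cst.
  apply: continuous_cvg; first exact: cf.
  rewrite path_shiftE//; under eq_cvg => n do rewrite path_shiftE ?(le_trans t0 (grid_above_ge _ t0))//.
  apply: cadlag_cvg; first by rewrite addr_ge0.
  + by move=> n; rewrite lerD2r grid_above_ge.
  + by apply: cvgD; [exact: grid_above_cvg|exact: cvg_cst].
- apply/integrableP; split.
    apply/measurable_EFinP; apply: measurable_funTS.
    by apply: measurableT_comp => //; apply: measurableT_comp => //; exact: measurable_funM.
  under eq_integral do rewrite /= ger0_norm ?expR_ge0//.
  by rewrite integral_exp// ltry.
- apply/aeW => s n _; rewrite lee_fin normrM !ger0_norm ?expR_ge0//; last first.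
    by case/andP : (f01 (path_shift (grid_above n t) w s)).
  rewrite ler_piMr ?expR_ge0//.
  by case/andP : (f01 (path_shift (grid_above n t) w s)).
Qed.

End occupation.

Section hat_function.
Context {R : realType}.
Local Open Scope ereal_scope.
Local Notation mu := (@lebesgue_measure R).

(** A tent of half-width 1/(n+1): continuous, so that occupations pass to the limit along the grid,
    and of height 1 rather than mass 1, so that they are at most 1/q. *)
Definition hat (n : nat) (y : R) : R := Num.max 0%R (1 - n.+1%:R * `|y|)%R.

Lemma hat_continuous n : continuous (hat n).
Proof.
move=> y; pose g (z : R) : R := (1 - n.+1%:R * `|z|)%R.
apply: (@continuous_max _ _ (cst 0%R) g); first exact: cvg_cst.
apply: cvgB; first exact: cvg_cst.
by apply: cvgM; [exact: cvg_cst|exact: norm_continuous].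
Qed.

Lemma measurable_hat n : measurable_fun setT (hat n).
Proof. apply: continuous_measurable_fun; exact: hat_continuous. Qed.

Lemma hat_itv01 n y : (0 <= hat n y <= 1)%R.
Proof. by rewrite /hat le_max lexx/= ge_max ler01/= gerBl mulr_ge0. Qed.

Lemma hat_ge0 n y : (0 <= hat n y)%R.
Proof. by case/andP : (hat_itv01 n y). Qed.

Lemma hat_eq0 n y : (n.+1%:R^-1 <= `|y|)%R -> hat n y = 0%R.
Proof.
move=> ny; apply/max_idPl; rewrite subr_le0.
by rewrite -ler_pdivrMl// mulr1.
Qed.

Definition hat_mass n : R := fine (\int[mu]_y (hat n y)%:E).

Lemma hat_massE n : \int[mu]_y (hat n y)%:E = (hat_mass n)%:E.
Proof.
have le2 : \int[mu]_y (hat n y)%:E <= mu `[(-1)%R, 1%R].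
  rewrite -[X in _ <= mu X]setIT -integral_indic//; apply: ge0_le_integral => //.
  - by move=> y _; rewrite lee_fin hat_ge0.
  - by apply/measurable_EFinP; exact: measurable_hat.
  - by apply/measurable_EFinP; exact: measurable_indic.
  - move=> y _; rewrite lee_fin indicE; have [yI|yI] := boolP (_ \in _).
      by case/andP : (hat_itv01 n y).
    rewrite hat_eq0//; move: yI; rewrite mem_setE in_itv/= -ler_norml -ltNge => y1.
    by rewrite (le_trans _ (ltW y1))// invf_le1// ler1n.
rewrite /hat_mass fineK// ge0_fin_numE; last first.
  by apply: integral_ge0 => y _; rewrite lee_fin hat_ge0.
apply: le_lt_trans le2 _; rewrite lebesgue_measure_itv/=.
by case: ifP => _; rewrite ltry.
Qed.

Lemma hat_mass_gt0 n : (0 < hat_mass n)%R.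
Proof.
rewrite -lte_fin -hat_massE.
(* On [0, d], half of the half-width, the tent is at least 1/2. *)
pose d : R := (n.+1%:R^-1 / 2)%R.
have d0 : (0 < d)%R by rewrite divr_gt0.
apply: (@lt_le_trans _ _ ((2^-1)%:E * mu `[0%R, d])).
  by rewrite lebesgue_measure_itv/= lte_fin d0 sube0 -EFinM lte_fin mulr_gt0.
rewrite -[X in _ * mu X]setIT -integral_indic// -ge0_integralZl ?lee_fin//; last first.
  by apply/measurable_EFinP; exact: measurable_indic.
apply: ge0_le_integral => //.
- by apply/measurable_EFinP; apply: measurable_funM => //; exact: measurable_indic.
- by apply/measurable_EFinP; exact: measurable_hat.
- move=> y _; rewrite -EFinM lee_fin indicE; have [yI|yI] := boolP (_ \in _); last first.
    by rewrite mulr0 hat_ge0.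
  move: yI; rewrite mem_setE in_itv/= mulr1 => /andP[y0 yd].
  rewrite /hat le_max ger0_norm//; apply/orP; right.
  have : (n.+1%:R * y <= 2^-1)%R.
    rewrite (le_trans (ler_wpM2l _ yd))// /d mulrA mulfV ?mul1r//.
  lra.
Qed.

End hat_function.

(* [r q (a - x)] is the q-potential density at a of the process started from x. *)
Record levy_resolvent (R : realType) (P : R -> probability (cadlag R) R)
    (r : R -> R -> R) : Prop := LevyResolvent {
  resolvent_levy : levy_family P ;
  resolvent_bounded : forall q : R, 0 < q -> exists M : R, forall x : R, `|r q x| <= M ;
  resolvent_continuous : forall q : R, 0 < q -> continuous (r q) ;
  resolvent_is_density : forall q : R, 0 < q -> resolvent_density P q (r q) }.

Section potential.
Context {R : realType} {P : R -> probability (cadlag R) R} {r : R -> R -> R}.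
Hypothesis hres : levy_resolvent P r.
Let hlevy := resolvent_levy hres.
Let hr_bounded := resolvent_bounded hres.
Let hr_continuous := @resolvent_continuous _ _ _ hres.
Let hr_density := @resolvent_is_density _ _ _ hres.
Local Open Scope ereal_scope.
Local Notation mu := (@lebesgue_measure R).
Implicit Types (w : cadlag R) (f u : R -> R) (p q t x a b M : R).

Let mr q : (0 < q)%R -> measurable_fun setT (r q).
Proof. by move=> q0; apply: continuous_measurable_fun; exact: hr_continuous. Qed.

(** A density is determined only up to a null set. Testing it on the indicator of the set where it
    is negative shows that its negative part has integral 0, and continuity then excludes a negative
    value at b. *)
Lemma resolvent_ge0 q b : (0 < q)%R -> (0 <= r q b)%R.
Proof.
move=> q0; rewrite leNgt; apply/negP => rb.
pose f y : R := \1_[set y | r q y < 0]%R y.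
have oN : measurable [set y | r q y < 0]%R.
  rewrite (_ : [set _ | _] = r q @^-1` `]-oo, 0%R[%classic).
    by rewrite -[X in measurable X]setTI; exact: mr.
  by apply/seteqP; split => y /=; rewrite in_itv.
have mf : measurable_fun setT f by exact: measurable_indic.
have f0 y : (0 <= f y)%R by rewrite /f indicE.
have fE y : (f y * - r q y = Num.max 0 (- r q y))%R.
  rewrite /f indicE; have [yN|yN] := boolP (_ \in _).
    rewrite mul1r; apply/esym/max_idPr; rewrite oppr_ge0.
    by move: yN => /set_mem/= /ltW.
  rewrite mul0r; apply/esym/max_idPl; rewrite oppr_le0 leNgt.
  by apply/negP => ry; move: yN; rewrite mem_set.
have fr0 y : 0 <= (f y * - r q y)%:E by rewrite lee_fin fE le_max lexx.
have mfr : measurable_fun setT (fun y => (f y * - r q y)%:E).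
  apply/measurable_EFinP; apply: measurable_funM => //.
  by apply: measurableT_comp => //; exact: mr.
have int0 : \int[mu]_y (f y * - r q y)%:E = 0.
  apply/eqP; rewrite eq_le; apply/andP; split; last exact: integral_ge0.
  have := hr_density q0 mf f0.
  under eq_integral => y _ do rewrite -[(f y * r q y)%R]opprK -mulrN EFinN.
  rewrite integral_ge0N// => E; rewrite -oppe_ge0 E.
  by apply: integral_ge0 => w _; exact: occupation_ge0.
have e0 : (0 < - r q b / 2)%R by rewrite divr_gt0// oppr_gt0.
have /cvgrPdist_lt /(_ _ e0)/nbhs_ballP[d /= d0 rd] := @hr_continuous q q0 b.
have : 0 < \int[mu]_y (f y * - r q y)%:E.
  apply: (@lt_le_trans _ _ ((- r q b / 2)%:E * mu `[b, (b + d / 2)%R])).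
    rewrite lebesgue_measure_itv/= lte_fin ltrDl divr_gt0//.
    by rewrite -EFinB -EFinM lte_fin mulr_gt0// addrAC subrr add0r divr_gt0.
  rewrite -[X in _ * mu X]setIT -integral_indic// -ge0_integralZl ?lee_fin ?(ltW e0)//; last first.
    by apply/measurable_EFinP; exact: measurable_indic.
  apply: ge0_le_integral => //.
  - by move=> y _; rewrite -EFinM lee_fin mulr_ge0 ?(ltW e0)// indicE.
  - by apply/measurable_EFinP; apply: measurable_funM => //; exact: measurable_indic.
  - move=> y _; rewrite -EFinM lee_fin indicE; have [yI|yI] := boolP (_ \in _); last first.
      by rewrite mulr0 -lee_fin.
    rewrite mulr1 fE le_max; apply/orP; right.
    move: yI; rewrite mem_setE in_itv/= => /andP[yb yd].
    have : (`|r q b - r q y| < - r q b / 2)%R.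
      by apply: rd; rewrite -ball_normE /= distrC ger0_norm ?subr_ge0//; lra.
    by rewrite ltr_norml => /andP[]; lra.
by rewrite int0 ltxx.
Qed.

(* [smoothed n q] converges to [r q], and [hat_mass n * smoothed n q (a - x)] is the discounted
   time spent near a, to which the Markov properties apply. *)
Definition smoothed n q b : R :=
  (fine (\int[mu]_y (hat n y * r q (y + b))%:E) / hat_mass n)%R.

Let mhr n q b : (0 < q)%R -> measurable_fun setT (fun y => (hat n y * r q (y + b))%:E).
Proof.
move=> q0; apply/measurable_EFinP; apply: measurable_funM; first exact: measurable_hat.
by apply: measurableT_comp (mr q0) _; exact: measurable_funD.
Qed.

Let hr0 n q b y : (0 < q)%R -> 0 <= (hat n y * r q (y + b))%:E.
Proof. by move=> q0; rewrite lee_fin mulr_ge0 ?hat_ge0 ?resolvent_ge0. Qed.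

Let integral_hat_le n q b (c : R) : (0 < q)%R ->
  (forall y, `|y| < n.+1%:R^-1 -> r q (y + b) <= c)%R ->
  \int[mu]_y (hat n y * r q (y + b))%:E <= (hat_mass n * c)%:E.
Proof.
move=> q0 rc; have c0 : (0 <= c)%R.
  by rewrite (le_trans (resolvent_ge0 (0 + b) q0))// rc// normr0 invr_gt0.
rewrite EFinM -hat_massE -ge0_integralZr ?lee_fin//; last 2 first.
- by apply/measurable_EFinP; exact: measurable_hat.
- by move=> y _; rewrite lee_fin hat_ge0.
apply: ge0_le_integral => //.
- by move=> y _; exact: hr0.
- exact: mhr.
- by apply/measurable_EFinP; apply: measurable_funM => //; exact: measurable_hat.
- move=> y _; rewrite -EFinM lee_fin; have [ny|ny] := leP (n.+1%:R^-1)%R `|y|%R.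
    by rewrite hat_eq0// !mul0r.
  by rewrite ler_wpM2l ?hat_ge0// rc.
Qed.

Lemma smoothedE n q b : (0 < q)%R ->
  \int[mu]_y (hat n y * r q (y + b))%:E = (hat_mass n * smoothed n q b)%:E.
Proof.
move=> q0; rewrite /smoothed mulrCA mulfV ?gt_eqF ?hat_mass_gt0// mulr1 fineK//.
have [M rM] := hr_bounded q0.
rewrite ge0_fin_numE; last by apply: integral_ge0 => y _; exact: hr0.
apply: (@le_lt_trans _ _ (hat_mass n * M)%:E); last by rewrite ltry.
by apply: integral_hat_le => // y _; rewrite (le_trans (ler_norm _)).
Qed.

Lemma smoothed_ge0 n q b : (0 < q)%R -> (0 <= smoothed n q b)%R.
Proof.
move=> q0; rewrite divr_ge0 ?(ltW (hat_mass_gt0 n))//.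
by apply: fine_ge0; apply: integral_ge0 => y _; exact: hr0.
Qed.

Lemma smoothed_le n q b (c : R) : (0 < q)%R ->
  (forall y, `|y| < n.+1%:R^-1 -> r q (y + b) <= c)%R -> (smoothed n q b <= c)%R.
Proof.
move=> q0 rc; have := integral_hat_le q0 rc.
by rewrite smoothedE// lee_fin ler_pM2l// hat_mass_gt0.
Qed.

Lemma smoothed_ge n q b (c : R) : (0 < q)%R ->
  (forall y, `|y| < n.+1%:R^-1 -> c <= r q (y + b))%R -> (c <= smoothed n q b)%R.
Proof.
move=> q0 rc; have [c0|/ltW c0] := leP 0%R c; last exact: le_trans c0 (smoothed_ge0 _ _ q0).
rewrite -(@ler_pM2l _ (hat_mass n)) ?hat_mass_gt0// -lee_fin -smoothedE//.
rewrite EFinM -hat_massE -ge0_integralZr ?lee_fin//; last 2 first.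
- by apply/measurable_EFinP; exact: measurable_hat.
- by move=> y _; rewrite lee_fin hat_ge0.
apply: ge0_le_integral => //.
- by move=> y _; rewrite -EFinM lee_fin mulr_ge0 ?hat_ge0.
- by apply/measurable_EFinP; apply: measurable_funM => //; exact: measurable_hat.
- exact: mhr.
- move=> y _; rewrite -EFinM lee_fin; have [ny|ny] := leP (n.+1%:R^-1)%R `|y|%R.
    by rewrite hat_eq0// !mul0r.
  by rewrite ler_wpM2l ?hat_ge0// rc.
Qed.

Lemma smoothed_cvg q b : (0 < q)%R -> smoothed n q b @[n --> \oo] --> r q b.
Proof.
move=> q0; apply/cvgrPdist_le => e e0.
have /cvgrPdist_lt /(_ _ e0)/nbhs_ballP[d /= d0 rd] := @hr_continuous q q0 b.
exists (Num.truncn d^-1) => // n /= dn.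
have nd : (n.+1%:R^-1 < d)%R.
  by rewrite invf_plt ?posrE// (lt_le_trans (truncnS_gt _))// ler_nat ltnS.
have ry y : (`|y| < n.+1%:R^-1 -> `|r q b - r q (y + b)| < e)%R.
  move=> yn; apply: rd; rewrite -ball_normE /= opprD addrCA subrr addr0 normrN.
  exact: lt_trans nd.
rewrite ler_norml; apply/andP; split.
  rewrite lerBrDr addrC -lerBrDr opprK; apply: smoothed_le => // y /ry.
  by rewrite ltr_norml => /andP[]; lra.
rewrite lerBlDr addrC -lerBlDr; apply: smoothed_ge => // y /ry.
by rewrite ltr_norml => /andP[]; lra.
Qed.

Lemma smoothed_continuous n q : (0 < q)%R -> continuous (smoothed n q).
Proof.
move=> q0 b; apply/(@cvg_nbhsP _ R^o) => v vb; apply: cvgM; last exact: cvg_cst.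
have [M rM] := hr_bounded q0.
have Efin : \int[mu]_y (hat n y * r q (y + b))%:E \is a fin_num by rewrite smoothedE.
apply: fine_cvg; rewrite fineK//.
have [] // := @dominated_convergence _ _ _ mu setT measurableT
  (fun k y => (hat n y * r q (y + v k))%:E)
  (fun y => (hat n y * r q (y + b))%:E) (fun y => (hat n y * M)%:E).
- by move=> k; exact: mhr.
- exact: mhr.
- apply/aeW => y _; apply: cvg_EFin; first exact: nearW.
  apply: cvgM; first exact: cvg_cst.
  apply: continuous_cvg; first exact: hr_continuous.
  by apply: cvgD => //; exact: cvg_cst.
- apply/integrableP; split.
    by apply/measurable_EFinP; apply: measurable_funM => //; exact: measurable_hat.
  under eq_integral do rewrite /= normrM (ger0_norm (hat_ge0 _ _)) EFinM.
  rewrite ge0_integralZr ?hat_massE -?EFinM ?ltry//.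
  + by apply/measurable_EFinP; exact: measurable_hat.
  + by move=> y _; rewrite lee_fin hat_ge0.
- apply/aeW => y k _ /=; rewrite lee_fin normrM (ger0_norm (hat_ge0 _ _)).
  by rewrite ler_wpM2l ?hat_ge0.
Qed.

Lemma expect_occupation x q f : (0 < q)%R -> measurable_fun setT f ->
  (forall y, 0 <= f y)%R ->
  \int[P x]_w occupation q f w = \int[mu]_y (f (x + y) * r q y)%:E.
Proof.
move=> q0 mf f0; rewrite (expect_translate hlevy); last 2 first.
- exact: measurable_occupation.
- by move=> w; exact: occupation_ge0.
rewrite (@hr_density q q0 (fun y => f (x + y))%R)//.
by apply: measurableT_comp mf _; exact: measurable_funD.
Qed.

Definition hat_at n a y : R := hat n (y - a).

Lemma hat_at_continuous n a : continuous (hat_at n a).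
Proof.
move=> y; apply: (@continuous_comp _ _ _ (fun z => z - a)%R (hat n)).
  by apply: (@continuousB _ _ _ id (cst a)); [exact: cvg_id|exact: cvg_cst].
exact: hat_continuous.
Qed.

Lemma measurable_hat_at n a : measurable_fun setT (hat_at n a).
Proof. apply: continuous_measurable_fun; exact: hat_at_continuous. Qed.

Lemma expect_occupation_hat_at x n q a : (0 < q)%R ->
  \int[P x]_w occupation q (hat_at n a) w = (hat_mass n * smoothed n q (a - x))%:E.
Proof.
move=> q0; rewrite expect_occupation//; last 2 first.
- exact: measurable_hat_at.
- by move=> y; exact: hat_ge0.
rewrite -smoothedE// -(ge0_integral_translation (a - x)%R); last 2 first.
- apply/measurable_EFinP; apply: measurable_funM; last exact: mr.
  apply: measurableT_comp (measurable_hat_at n a) _; exact: measurable_funD.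
- by move=> y; rewrite lee_fin mulr_ge0 ?hat_ge0 ?resolvent_ge0.
apply: eq_integral => y _; rewrite /hat_at; congr ((hat n _ * _)%:E); ring.
Qed.

End potential.

Section resolvent_hitting.
Context {R : realType} {P : R -> probability (cadlag R) R} {r : R -> R -> R}.
Hypothesis hres : levy_resolvent P r.
Let hlevy := resolvent_levy hres.
Let hr_bounded := resolvent_bounded hres.
Let hr_continuous := @resolvent_continuous _ _ _ hres.
Local Open Scope ereal_scope.
Implicit Types (w : cadlag R) (f u : R -> R) (p q t x a b M : R).

Let smooth := @smoothed R r.

Let smooth_norm_le n q b M : (0 < q)%R -> (forall y, `|r q y| <= M)%R ->
  (`|smooth n q b| <= M)%R.
Proof.
move=> q0 rM; rewrite ger0_norm; last exact: (smoothed_ge0 hres).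
apply: (smoothed_le hres) => // y _.
exact: le_trans (ler_norm _) _.
Qed.

Let hat_at01 n a y : (0 <= hat_at n a y <= 1)%R.
Proof. exact: hat_itv01. Qed.

Let hat_at_ge0 n a y : (0 <= hat_at n a y)%R.
Proof. exact: hat_ge0. Qed.

Lemma markov_occupation x t n q a (C : set (cadlag R)) : (0 < q)%R -> (0 <= t)%R ->
  right_filtration t C ->
  \int[P x]_(w in C) occupation q (hat_at n a) (path_shift t w) =
  \int[P x]_(w in C) (hat_mass n * smooth n q (a - w t))%:E.
Proof.
move=> q0 t0 tC.
rewrite integral_mkcond [RHS]integral_mkcond.
transitivity (\int[P x]_w ((\1_C w)%:E * occupation q (hat_at n a) (path_shift t w))).
  apply: eq_integral => w _; rewrite patchE indicE.
  by case: ifPn => _; rewrite ?mul1e ?mul0e.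
rewrite (@markov_property _ _ hlevy x t (fun w => (\1_C w)%:E) (occupation q (hat_at n a)))//.
- apply: eq_integral => w _; rewrite (expect_occupation_hat_at hres)//.
  by rewrite patchE indicE; case: ifPn => _; rewrite ?mul1e ?mul0e.
- apply/measurable_EFinP.
  exact: (@measurable_indic _ (right_filtered t) R setT C (measurable_right_filteredE tC)).
- by apply: measurable_occupation => //; exact: measurable_hat_at.
- by move=> w; exact: occupation_ge0.
Qed.

Definition semigroup (t : R) (u : R -> R) (x : R) : R := fine (\int[P x]_w (u (w t))%:E).

Let integrable_eval t u M x : measurable_fun setT u -> (forall y, `|u y| <= M)%R ->
  (P x).-integrable setT (fun w => (u (w t))%:E).
Proof.
move=> mu uM; apply: (@integrable_bounded _ _ _ _ (fun w : cadlag R => u (w t)) M) => //.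
exact: measurableT_comp mu (measurable_eval t).
Qed.

Lemma semigroupE t u M x : measurable_fun setT u -> (forall y, `|u y| <= M)%R ->
  \int[P x]_w (u (w t))%:E = (semigroup t u x)%:E.
Proof.
by move=> mu uM; rewrite fineK//; apply: integrable_fin_num => //; exact: integrable_eval mu uM.
Qed.

Lemma cvg_semigroup t (u_ : nat -> R -> R) u M x :
  (forall n, measurable_fun setT (u_ n)) -> measurable_fun setT u ->
  (forall n y, `|u_ n y| <= M)%R -> (forall y, u_ n y @[n --> \oo] --> u y) ->
  semigroup t (u_ n) x @[n --> \oo] --> semigroup t u x.
Proof.
move=> mu_ mu uM uu.
have uM' y : (`|u y| <= M)%R.
  have h : (fun n => `|u_ n y|%R) @ \oo --> `|u y|%R by apply: cvg_norm; exact: uu.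
  move/cvg_lim : (h) => <- //; apply: limr_le; first exact: cvgP h.
  by apply: nearW => n; exact: uM.
apply: fine_cvg; rewrite -(semigroupE t x mu uM').
apply: (@cvg_integral_bounded _ _ _ (P x) (fun n (w : cadlag R) => u_ n (w t)) _ M) => //.
by move=> n; apply: measurableT_comp (mu_ n) (measurable_eval t).
Qed.

Let mr_opp q : (0 < q)%R -> measurable_fun setT (fun y : R => r q (- y)).
Proof.
move=> q0; apply: measurableT_comp (continuous_measurable_fun (hr_continuous q0)) _.
exact: measurable_funN.
Qed.

Let msmooth n q a : (0 < q)%R -> measurable_fun setT (fun y : R => smooth n q (a - y)).
Proof.
move=> q0; apply: measurableT_comp
  (continuous_measurable_fun (smoothed_continuous hres q0)) _.
exact: measurable_funB.
Qed.

Let smooth_semigroup n q x t : (0 < q)%R -> (0 <= t)%R ->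
  \int[P x]_w occupation q (hat_at n 0) (path_shift t w) =
  (hat_mass n * semigroup t (fun y : R => smooth n q (0 - y)) x)%:E.
Proof.
move=> q0 t0; rewrite markov_occupation//; last first.
  by apply: measurable_right_filtered; exact: measurableT.
have [M rM] := hr_bounded q0.
rewrite EFinM -(@semigroupE t (fun y : R => smooth n q (0 - y)) M)//; first last.
- by move=> y; exact: smooth_norm_le.
- exact: msmooth.
under eq_integral do rewrite EFinM.
rewrite integralZl//.
by apply: (@integrable_eval t (fun y : R => smooth n q (0 - y)) M) => [|y];
  [exact: msmooth|exact: smooth_norm_le].
Qed.

Let cvg_smooth_semigroup q x t : (0 < q)%R ->
  semigroup t (fun y : R => smooth n q (0 - y)) x @[n --> \oo] -->
  semigroup t (fun y : R => r q (- y)) x.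
Proof.
move=> q0; have [M rM] := hr_bounded q0.
apply: (@cvg_semigroup _ _ _ M).
- by move=> n; exact: msmooth.
- exact: mr_opp.
- by move=> n y; exact: smooth_norm_le.
- by move=> y; rewrite sub0r; exact: (smoothed_cvg hres).
Qed.

Let mocc n q : measurable_fun setT (occupation q (hat_at n 0)).
Proof. by apply: measurable_occupation => //; exact: measurable_hat_at. Qed.

Let mocc_shift n q t : measurable_fun setT (fun w : cadlag R => occupation q (hat_at n 0) (path_shift t w)).
Proof. exact: measurableT_comp (mocc n q) (measurable_path_shift t). Qed.

(** Discard what happens before t: the discounted time spent near 0 after t is part of the total.
    This is an inequality between smoothed densities, then passed to the limit. *)
Lemma semigroup_resolvent_le q x t : (0 < q)%R -> (0 <= t)%R ->
  (semigroup t (fun y : R => r q (- y)) x <= expR (q * t) * r q (- x))%R.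
Proof.
move=> q0 t0.
have cr : (expR (q * t) * smooth n q (0 - x))%R @[n --> \oo] -->
    (expR (q * t) * r q (- x))%R.
  by apply: cvgM; [exact: cvg_cst|rewrite sub0r; exact: (smoothed_cvg hres)].
have cs := @cvg_smooth_semigroup q x t q0.
apply: (ler_cvg_to cs cr); apply: nearW => n /=.
rewrite -(@ler_pM2l _ (hat_mass n)) ?hat_mass_gt0// -lee_fin -smooth_semigroup//.
rewrite mulrCA EFinM -(expect_occupation_hat_at hres)//.
rewrite -ge0_integralZl ?lee_fin ?expR_ge0//; last first.
  by move=> w _; exact: occupation_ge0.
apply: ge0_le_integral => //.
- by move=> w _; exact: occupation_ge0.
- by apply: measurable_funeM; exact: mocc.
- by move=> w _; apply: occupation_shift_le => //; exact: measurable_hat_at.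
Qed.

(* [exp (p t) * rho_p - P_t rho_p] is the density of the measure
   [int_0^t exp (p (t - s)) P_s ds], which increases with p. *)
Lemma semigroup_resolvent_rate p q x t : (0 < p)%R -> (p <= q)%R -> (0 <= t)%R ->
  (expR (p * t) * r p (- x) + semigroup t (fun y : R => r q (- y)) x <=
   expR (q * t) * r q (- x) + semigroup t (fun y : R => r p (- y)) x)%R.
Proof.
move=> p0 pq t0; have q0 : (0 < q)%R by exact: lt_le_trans pq.
have cr a : (0 < a)%R -> (expR (a * t) * smooth n a (0 - x))%R @[n --> \oo] -->
    (expR (a * t) * r a (- x))%R.
  by move=> a0; apply: cvgM; [exact: cvg_cst|rewrite sub0r; exact: (smoothed_cvg hres)].
have c2 a b : (0 < a)%R -> (0 < b)%R ->
    (expR (a * t) * smooth n a (0 - x) +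
      semigroup t (fun y : R => smooth n b (0 - y)) x)%R @[n --> \oo] -->
    (expR (a * t) * r a (- x) + semigroup t (fun y : R => r b (- y)) x)%R.
  by move=> a0 b0; apply: cvgD; [exact: cr|exact: cvg_smooth_semigroup].
apply: (ler_cvg_to (c2 p q p0 q0) (c2 q p q0 p0)); apply: nearW => n /=.
have moccZ c a : measurable_fun setT (fun w => c%:E * occupation a (hat_at n 0) w).
  by apply: measurable_funeM; exact: mocc.
have occ0 a w : 0 <= occupation a (hat_at n 0) w by exact: occupation_ge0.
have occZ0 c a w : 0 <= (expR c)%:E * occupation a (hat_at n 0) w.
  by rewrite mule_ge0 ?lee_fin ?expR_ge0.
have E a b : (0 < a)%R -> (0 < b)%R ->
    (hat_mass n * (expR (a * t) * smooth n a (0 - x) +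
      semigroup t (fun y : R => smooth n b (0 - y)) x))%:E =
    \int[P x]_w ((expR (a * t))%:E * occupation a (hat_at n 0) w +
      occupation b (hat_at n 0) (path_shift t w)).
  move=> a0 b0; rewrite mulrDr mulrCA EFinD -smooth_semigroup// EFinM.
  rewrite -(expect_occupation_hat_at hres)//.
  rewrite -ge0_integralZl ?lee_fin ?expR_ge0// -ge0_integralD//.
suff : (hat_mass n * (expR (p * t) * smooth n p (0 - x) +
      semigroup t (fun y : R => smooth n q (0 - y)) x) <=
    hat_mass n * (expR (q * t) * smooth n q (0 - x) +
      semigroup t (fun y : R => smooth n p (0 - y)) x))%R.
  by rewrite ler_pM2l ?hat_mass_gt0.
rewrite -lee_fin (E p q p0 q0) (E q p q0 p0).
apply: ge0_le_integral => //.
- by move=> w _; rewrite adde_ge0.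
- by apply: emeasurable_funD; [exact: moccZ|exact: mocc_shift].
- by apply: emeasurable_funD; [exact: moccZ|exact: mocc_shift].
- by move=> w _; apply: occupation_rate_le => //; exact: measurable_hat_at.
Qed.

End resolvent_hitting.

(** * Potentials at hitting times *)

Section hitting_potential.
Context {R : realType} {P : R -> probability (cadlag R) R} {r : R -> R -> R}.
Hypothesis hres : levy_resolvent P r.
Let hlevy := resolvent_levy hres.
Let hr_bounded := resolvent_bounded hres.
Let hr_continuous := @resolvent_continuous _ _ _ hres.
Local Open Scope ereal_scope.
Implicit Types (w : cadlag R) (f u : R -> R) (p q t x a b M : R) (A B G : set R).

Let smooth := @smoothed R r.

Section open_set.
Variables (q a x : R) (n : nat) (G : set R).
Hypotheses (q0 : (0 < q)%R) (oG : open G).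

Let f := hat_at n a.

Let f01 y : (0 <= f y <= 1)%R.
Proof. exact: hat_itv01. Qed.

Let f0 y : (0 <= f y)%R.
Proof. exact: hat_ge0. Qed.

Let mf : measurable_fun setT f.
Proof. exact: measurable_hat_at. Qed.

Let u y : R := smooth n q (a - y).

Let cu : continuous u.
Proof.
move=> y; apply: (@continuous_comp _ _ _ (fun z => a - z)%R (smooth n q)).
  by apply: (@continuousB _ _ _ (cst a) id); [exact: cvg_cst|exact: cvg_id].
exact: (smoothed_continuous hres).
Qed.

Let u0 y : (0 <= u y)%R.
Proof. exact: (smoothed_ge0 hres). Qed.

Let T w := hitting_time G w.

Let oT : optional_time T.
Proof. exact: optional_hitting_time_open. Qed.

(** Discounted time spent near a after t; at the hitting time of [G] it is the part of the
    occupation that comes after hitting. *)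
Let future t w : R := (expR (- (q * t)) * fine (occupation q f (path_shift t w)))%R.

Let occ_fin v : occupation q f v \is a fin_num.
Proof.
by rewrite ge0_fin_numE ?occupation_ge0// (le_lt_trans (occupation_le v q0 mf f01))// ltry.
Qed.

Let futureE t w : (future t w)%:E = (expR (- (q * t)))%:E * occupation q f (path_shift t w).
Proof. by rewrite /future EFinM fineK. Qed.

Let mfuture t : measurable_fun setT (future t).
Proof.
apply: measurable_funM => //; apply: measurableT_comp (fine_measurable measurableT) _.
apply: measurableT_comp (measurable_path_shift t).
exact: measurable_occupation.
Qed.

Let exp_le1 t : (0 <= t)%R -> (0 <= expR (- (q * t)) <= 1)%R.
Proof. by move=> t0; rewrite expR_ge0 -expR0 ler_expR oppr_le0 mulr_ge0// ltW. Qed.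

Let exp_grid t : (0 <= t)%R ->
  expR (- (q * grid_above k t))%R @[k --> \oo] --> expR (- (q * t))%R.
Proof.
move=> t0; apply: continuous_cvg; first exact: continuous_expR.
by apply: cvgN; apply: cvgM; [exact: cvg_cst|exact: grid_above_cvg].
Qed.

(** The strong Markov principle is applied to [future] and to its conditional expectation given the
    past, which is [present]. *)
Lemma occupation_after_hitting :
  \int[P x]_(w in [set w | T w < +oo]) (future (fine (T w)) w)%:E =
  (hat_mass n)%:E * \int[P x]_w (discounted_hit q u G w)%:E.
Proof.
have [M rM] := hr_bounded q0.
have uM y : (`|u y| <= M)%R.
  rewrite ger0_norm//; apply: (smoothed_le hres) => // z _.
  exact: le_trans (ler_norm _) _.
have M0 : (0 <= M)%R by exact: le_trans (uM 0%R).
have c0 := ltW (@hat_mass_gt0 R n).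
have md := measurable_discounted_hit_open q cu oG.
pose present t w : R := (expR (- (q * t)) * (hat_mass n * u (w t)))%R.
(* A common bound for the two processes: 1/q for the occupation and [hat_mass n * M] for its
   expectation. *)
rewrite (@strong_markov_principle _ P x (q^-1 + hat_mass n * M)%R T oT future present).
- rewrite -ge0_integralZl ?lee_fin//; last 2 first.
  + by apply/measurable_EFinP; exact: md.
  + move=> w _; rewrite lee_fin /discounted_hit; case: ifP => // _.
    by rewrite mulr_ge0 ?expR_ge0.
  rewrite [LHS]integral_mkcond; apply: eq_integral => w _.
  rewrite patchE /discounted_hit -EFinM -/(T w).
  have [Tw|Tw] := ltP (T w) +oo.
    by rewrite mem_set// /present mulrCA.
  by rewrite memNset ?mulr0//= ltNge Tw.
- by move=> t _; exact: mfuture.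
- move=> t _; apply: measurable_funM => //; apply: measurable_funM => //.
  exact: measurableT_comp (continuous_measurable_fun cu) (measurable_eval t).
- move=> t w t0; have /andP[e0 e1] := exp_le1 t0.
  rewrite /future mulr_ge0 ?fine_ge0 ?occupation_ge0//=.
  apply: (@le_trans _ _ (1 * q^-1)%R).
    apply: ler_pM => //; first by rewrite fine_ge0 ?occupation_ge0.
    by rewrite -lee_fin fineK// occupation_le.
  by rewrite mul1r lerDl mulr_ge0.
- move=> t w t0; have /andP[e0 e1] := exp_le1 t0.
  have cu0 : (0 <= hat_mass n * u (w t))%R by apply: mulr_ge0 => //; exact: u0.
  rewrite /present mulr_ge0//=.
  apply: (@le_trans _ _ (1 * (hat_mass n * M))%R).
    apply: ler_pM => //.
    by rewrite ler_wpM2l// (le_trans (ler_norm _)).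
  by rewrite mul1r lerDr invr_ge0 ltW.
- move=> t w t0; apply: cvgM; first exact: exp_grid.
  apply: fine_cvg; rewrite fineK//; apply: cvg_occupation_grid => //.
  exact: hat_at_continuous.
- move=> t w t0; apply: cvgM; first exact: exp_grid.
  apply: cvgM; first exact: cvg_cst.
  by apply: continuous_cvg; [exact: cu|exact: cvg_eval_grid].
- move=> t C t0 tC; have mC := natural_filtration_measurable tC.
  have rC : right_filtration t C.
    by move=> s /= ts; apply: natural_filtration_mono tC; exact: ltW.
  under eq_integral do rewrite futureE.
  rewrite ge0_integralZl ?lee_fin ?expR_ge0//; last 2 first.
  + apply: measurable_funTS; apply: measurableT_comp (measurable_path_shift t).
    exact: measurable_occupation.
  + by move=> w _; exact: occupation_ge0.
  rewrite (markov_occupation hres)//.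
  under [RHS]eq_integral do rewrite EFinM.
  rewrite ge0_integralZl ?lee_fin ?expR_ge0//.
  + apply/measurable_EFinP; apply: measurable_funTS; apply: measurable_funM => //.
    exact: measurableT_comp (continuous_measurable_fun cu) (measurable_eval t).
  + by move=> w _; rewrite lee_fin mulr_ge0.
Qed.

Let mD : measurable [set w | T w < +oo].
Proof.
rewrite -[X in measurable X]setTI; apply: emeasurable_fun_infty_o => //.
exact: measurable_optional_time.
Qed.

Let future_le w : T w < +oo -> (future (fine (T w)) w)%:E <= occupation q f w.
Proof.
move=> Tw; have T0 := fine_hitting_time_ge0 G w.
rewrite futureE expRN -lee_pdivlMl ?invr_gt0 ?expR_gt0// invrK.
exact: occupation_shift_le.
Qed.

Let mfutureT : measurable_fun setT (fun w => (future (fine (T w)) w)%:E).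
Proof.
have mfT : measurable_fun setT (fun w => fine (T w)).
  exact: measurableT_comp (fine_measurable measurableT) (measurable_optional_time oT).
apply/measurable_EFinP; apply: measurable_funM.
  apply: measurableT_comp => //; apply: measurableT_comp => //.
  exact: measurable_funM.
apply: measurableT_comp (fine_measurable measurableT) _.
apply: measurableT_comp (measurable_occupation q mf f0) _.
apply: measurable_cadlag => s s0; rewrite /path_shift /=.
have mmax : measurable_fun setT (fun w => Num.max (fine (T w)) 0%R).
  exact: measurable_maxr.
apply: measurable_funD; first exact: measurable_eval_comp.
apply: measurable_funB; apply: measurable_eval_comp => //.
exact: measurable_funD.
Qed.

Let mocc : measurable_fun setT (occupation q f).
Proof. exact: measurable_occupation. Qed.

(** The time spent near a after hitting [G] is part of the total time spent there. *)
Lemma smoothed_hitting_le :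
  \int[P x]_w (discounted_hit q u G w)%:E <= (smooth n q (a - x))%:E.
Proof.
have c0 := @hat_mass_gt0 R n.
rewrite -(@lee_pmul2l _ (hat_mass n)%:E) ?lte_fin// -EFinM.
rewrite -occupation_after_hitting -(expect_occupation_hat_at hres)//.
apply: (@le_trans _ _ (\int[P x]_(w in [set w | T w < +oo]) occupation q f w)).
  apply: ge0_le_integral => //.
  - by move=> w _; rewrite futureE mule_ge0 ?lee_fin ?expR_ge0// occupation_ge0.
  - exact: measurable_funTS.
  - exact: measurable_funTS.
apply: ge0_subset_integral => //.
by move=> w _; exact: occupation_ge0.
Qed.

(** When [G] contains the support of the tent, no time is spent near a before [G] is hit, and none
    at all if [G] is never hit. *)
Lemma smoothed_hitting_eq : (forall y, `|y - a| < n.+1%:R^-1 -> G y)%R ->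
  \int[P x]_w (discounted_hit q u G w)%:E = (smooth n q (a - x))%:E.
Proof.
move=> aG; have c0 := @hat_mass_gt0 R n.
have fG y : ~ G y -> f y = 0%R.
  by move=> Gy; apply: hat_eq0; rewrite leNgt; apply/negP => /aG.
suff E : (hat_mass n)%:E * \int[P x]_w (discounted_hit q u G w)%:E =
    (hat_mass n)%:E * (smooth n q (a - x))%:E.
  by apply/eqP; rewrite eq_le; apply/andP; split;
    rewrite -(@lee_pmul2l _ (hat_mass n)%:E) ?lte_fin// E.
rewrite -EFinM -occupation_after_hitting -(expect_occupation_hat_at hres)//.
rewrite [LHS]integral_mkcond; apply: eq_integral => w _; rewrite patchE.
case: ifPn => [/set_mem/= Tw|]; last first.
  rewrite notin_setE /= => nT; apply/esym; apply: integral0_eq => s.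
  rewrite /= in_itv/= andbT => s0; rewrite [hat_at _ _ _]fG ?mulr0// => Gs; apply: nT.
  by apply: le_lt_trans (hitting_time_le s0 Gs) _; rewrite ltry.
have T0 := fine_hitting_time_ge0 G w.
have := @occupation_split R q f w (fine (T w)) mf f0 T0.
rewrite integral0_eq ?add0e.
  move=> E; rewrite futureE -E muleA -EFinM expRN mulVf ?mul1e//.
  by rewrite gt_eqF// expR_gt0.
move=> s /=; rewrite in_itv/= => /andP[s0 sT]; rewrite fG ?mulr0// => Gs.
move: sT; rewrite ltNge => /negP; apply; rewrite -lee_fin -hitting_time_fin//.
exact: hitting_time_le.
Qed.

End open_set.

Section resolvent_target.
Variables (q a x : R).
Hypothesis q0 : (0 < q)%R.

Let U y : R := r q (a - y).

Let cU : continuous U.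
Proof.
move=> y; apply: (@continuous_comp _ _ _ (fun z => a - z)%R (r q)).
  by apply: (@continuousB _ _ _ (cst a) id); [exact: cvg_cst|exact: cvg_id].
exact: hr_continuous.
Qed.

Let cvg_smoothed_hitting G : open G ->
  \int[P x]_w (discounted_hit q (fun y => smooth n q (a - y)) G w)%:E @[n --> \oo] -->
  \int[P x]_w (discounted_hit q U G w)%:E.
Proof.
move=> oG; have [M rM] := hr_bounded q0.
apply: (@cvg_integral_bounded _ _ _ (P x) _ _ M).
- move=> n; apply: measurable_discounted_hit_open => // y.
  apply: (@continuous_comp _ _ _ (fun z => a - z)%R (smooth n q)).
    by apply: (@continuousB _ _ _ (cst a) id); [exact: cvg_cst|exact: cvg_id].
  exact: (smoothed_continuous hres).
- move=> n w; apply: discounted_hit_le; first exact: ltW.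
  move=> y; rewrite ger0_norm; last exact: (smoothed_ge0 hres).
  apply: (smoothed_le hres) => // z _.
  exact: le_trans (ler_norm _) _.
- move=> w; rewrite /discounted_hit; case: ifPn => _; last exact: cvg_cst.
  by apply: cvgM; [exact: cvg_cst|exact: (smoothed_cvg hres)].
Qed.

Let cvg_smoothed_target : (smooth n q (a - x))%:E @[n --> \oo] --> (r q (a - x))%:E.
Proof. by apply: cvg_EFin; [exact: nearW|exact: (smoothed_cvg hres)]. Qed.

Lemma resolvent_hitting_open_le G : open G ->
  \int[P x]_w (discounted_hit q U G w)%:E <= (r q (a - x))%:E.
Proof.
move=> oG; apply: (lee_cvg_to (cvg_smoothed_hitting oG) cvg_smoothed_target).
by apply: nearW => n; exact: smoothed_hitting_le.
Qed.

Lemma resolvent_hitting_open_eq G : open G -> G a ->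
  \int[P x]_w (discounted_hit q U G w)%:E = (r q (a - x))%:E.
Proof.
move=> oG Ga; apply: (cvg_unique _ (cvg_smoothed_hitting oG)) => //.
(* From some n on, the tents around a have their support in [G]. *)
have /open_nbhs_nbhs/nbhs_ballP[e /= e0 eG] : open_nbhs a G by split.
apply: cvg_trans cvg_smoothed_target; apply: near_eq_cvg.
exists (Num.truncn e^-1) => // n /= en.
have ne : (n.+1%:R^-1 < e)%R.
  by rewrite invf_plt ?posrE// (lt_le_trans (truncnS_gt _))// ler_nat ltnS.
rewrite smoothed_hitting_eq// => y ya; apply: eG.
by rewrite -ball_normE /= distrC; exact: lt_trans ne.
Qed.

Let cvg_hitting (B : nat -> set R) T N A :
  (forall k, @hitting_version R P (B k) (T k) N) ->
  (forall w, ~ N w ->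
     discounted_hit q U (B k) w @[k --> \oo] --> discounted_hit q U A w) ->
  \int[P x]_w (discounted_hit q U (B k) w)%:E @[k --> \oo] -->
  \int[P x]_w (discounted_hit q U A w)%:E.
Proof.
move=> BTN BA; have [M rM] := hr_bounded q0.
have [_ mN N0 _] := BTN 0%N.
apply: (@cvg_integral_off_null _ _ _ (P x) N _ _ M) => //.
- by move=> k; exact: (measurable_discounted_hit (P := P)) cU (BTN k).
- by move=> k w; apply: discounted_hit_le; [exact: ltW|move=> y; exact: rM].
Qed.

Let cvg_hitting_closed B : closed B ->
  \int[P x]_w (discounted_hit q U (thickening B k) w)%:E @[k --> \oo] -->
  \int[P x]_w (discounted_hit q U B w)%:E.
Proof.
move=> cB; have [M rM] := hr_bounded q0.
have [_ mN N0 _] := hitting_version_closed hlevy cB.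
apply: (@cvg_hitting _ (approx_hitting_time B) (hitting_null_set B)).
  by move=> k; split => //; exact: optional_approx_hitting_time.
by move=> w nw; apply: (cvg_discounted_hit_closed (M := M)) => // y; exact: rM.
Qed.

Let resolvent_hitting_closed_le B : closed B ->
  \int[P x]_w (discounted_hit q U B w)%:E <= (r q (a - x))%:E.
Proof.
move=> cB; apply: cvge_le (cvg_hitting_closed cB); apply: nearW => k.
by apply: resolvent_hitting_open_le; exact: open_thickening.
Qed.

Let resolvent_hitting_closed_eq B : closed B -> B a ->
  \int[P x]_w (discounted_hit q U B w)%:E = (r q (a - x))%:E.
Proof.
move=> cB Ba; apply: (cvg_unique _ (cvg_hitting_closed cB)) => //.
apply: cvg_near_cst; apply: nearW => k; apply: resolvent_hitting_open_eq.
  exact: open_thickening.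
exact: sub_thickening.
Qed.

Let cvg_hitting_bigcup (B : nat -> set R) : (forall n, closed (B n)) ->
  nondecreasing_seq B ->
  \int[P x]_w (discounted_hit q U (B k) w)%:E @[k --> \oo] -->
  \int[P x]_w (discounted_hit q U (\bigcup_k B k) w)%:E.
Proof.
move=> cB ndB; have BTN k := hitting_version_closed hlevy (cB k).
have [_ mN N0 _] := hitting_version_bigcup BTN.
apply: (cvg_hitting (T := fun k w => ereal_sup (range (approx_hitting_time (B k) ^~ w)))
    (N := \bigcup_k hitting_null_set (B k))); last first.
  by move=> w _; exact: cvg_discounted_hit_bigcup.
move=> k; have [oT _ _ BT] := BTN k; split => // w nw.
by apply: BT => Nw; apply: nw; exists k.
Qed.

(** The inequality passes from open sets to closed ones through their thickenings, and then along an
    increasing sequence of closed sets with union [A]. *)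
Lemma resolvent_hitting_le A : Fsigma A ->
  \int[P x]_w (discounted_hit q U A w)%:E <= (r q (a - x))%:E.
Proof.
move=> /Fsigma_nondecreasing[B cB [ndB ->]].
apply: cvge_le (cvg_hitting_bigcup cB ndB); apply: nearW => k.
exact: resolvent_hitting_closed_le.
Qed.

(** In the same two passages, a belongs to all thickenings of a closed set that contains it, and to
    the closed sets of the sequence from some index on. *)
Lemma resolvent_hitting_eq A : Fsigma A -> A a ->
  \int[P x]_w (discounted_hit q U A w)%:E = (r q (a - x))%:E.
Proof.
move=> /Fsigma_nondecreasing[B cB [ndB ->]] [K _ BKa].
apply: (cvg_unique _ (cvg_hitting_bigcup cB ndB)) => //.
apply: cvg_near_cst; exists K => // k /= Kk.
by apply: resolvent_hitting_closed_eq => //; exact: (subsetPset _ _ (ndB _ _ Kk)).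
Qed.

End resolvent_target.

End hitting_potential.

(* [compensated r q] is the function [h_q]. *)
Definition compensated (R : realType) (r : R -> R -> R) (q x : R) : R :=
  r q 0 - r q (- x).

(** * Nonnegativity and subadditivity of h_q *)

Section compensated_resolvent.
Context {R : realType} {P : R -> probability (cadlag R) R} {r : R -> R -> R}.
Hypothesis hres : levy_resolvent P r.
Let hlevy := resolvent_levy hres.
Let hr_continuous := @resolvent_continuous _ _ _ hres.
Local Open Scope ereal_scope.
Local Notation mu := (@lebesgue_measure R).
Local Notation H := (compensated r).
Implicit Types (w : cadlag R) (f u : R -> R) (p q t x y a b M K : R) (A B : set R).

Lemma hitting_point w a : hitting_time [set a] w < +oo ->
  w (fine (hitting_time [set a] w)) = a.
Proof.
move=> Ta; apply/eqP; rewrite -subr_eq0 -normr_le0.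
apply/ler_addgt0Pr => e e0; rewrite add0r.
by have [t /= -> /ltW] := hitting_time_near e0 Ta; rewrite distrC.
Qed.

Lemma discounted_hit_point q u a w :
  discounted_hit q u [set a] w = (u a * discounted_hit q (cst 1%R) [set a] w)%R.
Proof.
rewrite /discounted_hit; case: ifPn => [Ta|_]; last by rewrite mulr0.
by rewrite hitting_point// mulr1 mulrC.
Qed.

Let Fsigma_point (a : R) : Fsigma [set a].
Proof.
exists (fun=> [set a]); first by move=> _; exact: closed_eq.
by rewrite bigcup_const//; exists 0%N.
Qed.

Lemma discounted_hit1_itv q A w : (0 <= q)%R -> (0 <= discounted_hit q (cst 1%R) A w <= 1)%R.
Proof.
move=> q0; apply/andP; split.
  by rewrite /discounted_hit; case: ifPn => // _; rewrite mulr1 expR_ge0.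
apply: le_trans (ler_norm _) _; apply: discounted_hit_le => // y.
by rewrite normr1.
Qed.

(** The factor c is P_x[exp(-qT)], T being the hitting time of 0, at which the path sits at 0. As c
    does not depend on u, two targets can be compared through it. *)
Lemma point_hitting_factor q x : (0 < q)%R -> exists2 c : R, (0 <= c <= 1)%R &
  forall u, \int[P x]_w (discounted_hit q u [set 0%R] w)%:E = (c * u 0)%R%:E.
Proof.
move=> q0; have hv := hitting_version_closed hlevy (@closed_eq R 0%R).
set N := hitting_null_set _ in hv; have [_ mN N0 _] := hv.
pose D := discounted_hit q (cst 1%R) [set 0%R] \_ (~` N).
have mD : measurable_fun setT D.
  by apply: measurable_discounted_hit hv; exact: cst_continuous.
have D01 w : (0 <= D w <= 1)%R.
  rewrite /D patchE; case: ifPn => _; last by rewrite lexx ler01.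
  by apply: discounted_hit1_itv; exact: ltW.
have I01 : 0 <= \int[P x]_w (D w)%:E <= 1.
  rewrite integral_ge0/=; last by move=> w _; rewrite lee_fin; case/andP : (D01 w).
  rewrite -(@probability_setT _ _ _ (P x)) -[leRHS]mul1e -integral_cst//.
  apply: ge0_le_integral => //.
  - by move=> w _; rewrite lee_fin; case/andP : (D01 w).
  - exact/measurable_EFinP.
  - by move=> w _; rewrite lee_fin; case/andP : (D01 w).
have Ifin : \int[P x]_w (D w)%:E \is a fin_num.
  by case/andP : I01 => I0 I1; rewrite ge0_fin_numE// (le_lt_trans I1)// ltry.
exists (fine (\int[P x]_w (D w)%:E)); first by rewrite -!lee_fin fineK.
move=> u; rewrite EFinM fineK//.
transitivity (\int[P x]_w ((u 0%R)%:E * (D w)%:E)).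
  apply: (integral_off_null mN (N0 x)) => w nw.
  by rewrite -EFinM discounted_hit_point /D patchE mem_set.
rewrite integralZl//; first by rewrite muleC.
apply: (@integrable_bounded _ _ _ _ D 1%R) => // w.
by have /andP[d0 d1] := D01 w; rewrite ger0_norm.
Qed.

(** Hitting 0 from the starting point -b gives [r q b = c * r q 0] with c <= 1. *)
Lemma resolvent_le0 q b : (0 < q)%R -> (r q b <= r q 0)%R.
Proof.
move=> q0; have [c /andP[c0 c1] cE] := point_hitting_factor (- b)%R q0.
have := resolvent_hitting_eq hres (- b)%R q0 (Fsigma_point 0) (erefl : [set 0%R] 0%R).
rewrite cE !sub0r oppr0 opprK => -[<-].
by rewrite ler_piMl// (resolvent_ge0 hres).
Qed.

(** From x, hitting 0 gives [r q (- x) = c * r q 0], and counting only the visits to -y made after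
    hitting 0 gives [c * r q (- y) <= r q (- (x + y))]. Eliminate c. *)
Lemma resolvent_supmult q x y : (0 < q)%R ->
  (r q (- x) * r q (- y) <= r q 0 * r q (- (x + y)))%R.
Proof.
move=> q0; have [c /andP[c0 c1] cE] := point_hitting_factor x q0.
have := resolvent_hitting_eq hres x q0 (Fsigma_point 0) (erefl : [set 0%R] 0%R).
have := @resolvent_hitting_le _ _ _ hres _ (- y)%R x q0 _ (Fsigma_point 0).
rewrite !cE !sub0r subr0 oppr0 lee_fin opprD [(- y - x)%R]addrC => cy [cx].
rewrite -cx [(c * _)%R]mulrC -mulrA ler_wpM2l//.
exact: (resolvent_ge0 hres).
Qed.

Lemma resolvent_mass q : (0 < q)%R -> \int[mu]_y (r q y)%:E = (q^-1)%:E.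
Proof.
move=> q0.
transitivity (\int[P 0%R]_w occupation q (cst 1%R) w).
  rewrite (expect_occupation hres)//.
  by apply: eq_integral => y _; rewrite mul1r.
transitivity (\int[P 0%R]_w (q^-1)%:E).
  apply: eq_integral => w _; rewrite -integral_exp// /occupation.
  by apply: eq_integral => s _; rewrite mulr1.
rewrite integral_cst// -[RHS]mule1; congr (_ * _).
exact: probability_setT.
Qed.

(** As [r q] is largest at 0, it would vanish identically if it did at 0, against its mass 1/q. *)
Lemma resolvent0_gt0 q : (0 < q)%R -> (0 < r q 0)%R.
Proof.
move=> q0; rewrite lt_neqAle (resolvent_ge0 hres) ?andbT//; apply/eqP => r0.
have := resolvent_mass q0; rewrite integral0_eq.
  by move=> [/esym/eqP]; rewrite invr_eq0 gt_eqF.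
move=> y _; congr EFin; apply/eqP; rewrite eq_le (resolvent_ge0 hres)// andbT r0.
exact: resolvent_le0.
Qed.

Lemma compensated_ge0 q x : (0 < q)%R -> (0 <= H q x)%R.
Proof. by move=> q0; rewrite subr_ge0 resolvent_le0. Qed.

Lemma compensated_le q x : (0 < q)%R -> (H q x <= r q 0)%R.
Proof. by move=> q0; rewrite gerBl (resolvent_ge0 hres). Qed.

Lemma compensated0 q : H q 0 = 0%R.
Proof. by rewrite /compensated oppr0 subrr. Qed.

(** With g = rho_q / rho_q 0, supermultiplicativity reads g x * g y <= g (x + y), and 1 - g x * g y
    <= (1 - g x) + (1 - g y) because g <= 1. *)
Lemma compensatedD q x y : (0 < q)%R -> (H q (x + y) <= H q x + H q y)%R.
Proof.
move=> q0; have r0 := resolvent0_gt0 q0.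
rewrite -(ler_pM2l r0) /compensated.
have := resolvent_supmult x y q0; have := resolvent_le0 (- x) q0.
have := resolvent_le0 (- y) q0; set a := r q 0 in r0 *; set b := r q (- x).
set c := r q (- y); set e := r q (- (x + y)) => h1 h2 h3.
by have := mulr_ge0 (_ : 0 <= a - b)%R (_ : 0 <= a - c)%R; nra.
Qed.

Lemma compensatedMn q x n : (0 < q)%R -> (H q (x *+ n) <= H q x *+ n)%R.
Proof.
move=> q0; elim: n => [|n IH]; first by rewrite !mulr0n compensated0.
by rewrite !mulrS (le_trans (compensatedD _ _ q0))// lerD2l.
Qed.

Lemma compensated_continuous q : (0 < q)%R -> continuous (H q).
Proof.
move=> q0 y; apply: cvgB; first exact: cvg_cst.
apply: (@continuous_comp _ _ _ (fun z : R => - z)%R (r q)).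
  by apply: continuousN; exact: cvg_id.
exact: hr_continuous.
Qed.

Lemma measurable_compensated q : (0 < q)%R -> measurable_fun setT (H q).
Proof. by move=> q0; apply: continuous_measurable_fun; exact: compensated_continuous. Qed.

Lemma compensated_norm_le q x : (0 < q)%R -> (`|H q x| <= r q 0)%R.
Proof. by move=> q0; rewrite ger0_norm ?compensated_ge0 ?compensated_le. Qed.

Let mrN q : (0 < q)%R -> measurable_fun setT (fun y : R => r q (- y)).
Proof.
move=> q0; apply: measurableT_comp (continuous_measurable_fun (hr_continuous q0)) _.
exact: measurable_funN.
Qed.

Let rN_norm q y : (0 < q)%R -> (`|r q (- y)| <= r q 0)%R.
Proof. by move=> q0; rewrite ger0_norm ?(resolvent_ge0 hres)// resolvent_le0. Qed.

Lemma semigroup_compensated q x t : (0 < q)%R ->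
  semigroup (P := P) t (H q) x =
  (r q 0 - semigroup (P := P) t (fun y : R => r q (- y)) x)%R.
Proof.
move=> q0; apply: EFin_inj; rewrite EFinB.
rewrite -(semigroupE t x (measurable_compensated q0) (fun y => compensated_norm_le y q0)).
rewrite -(semigroupE t x (mrN q0) (fun y => rN_norm y q0)).
under eq_integral do rewrite EFinB.
have m1 : measurable_fun setT (fun w : cadlag R => r q (- w t)).
  exact: measurableT_comp (mrN q0) (measurable_eval t).
rewrite integralB//.
- congr (_ - _); rewrite integral_cst// -[RHS]mule1; congr (_ * _).
  exact: probability_setT.
- by apply: (@integrable_bounded _ _ _ _ (cst (r q 0)) (`|r q 0|)%R).
- by apply: (@integrable_bounded _ _ _ _ (fun w : cadlag R => r q (- w t)) (r q 0)) => // w; exact: rN_norm.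
Qed.

End compensated_resolvent.

(** * Bounds uniform in the killing rate *)

Section compensated_bounds.
Context {R : realType} {P : R -> probability (cadlag R) R} {r : R -> R -> R}.
Hypothesis hres : levy_resolvent P r.
Let hr_continuous := @resolvent_continuous _ _ _ hres.
Local Open Scope ereal_scope.
Local Notation mu := (@lebesgue_measure R).
Local Notation H := (compensated r).
Implicit Types (w : cadlag R) (f u : R -> R) (p q t x y a b M K : R) (A B : set R).

Let integral_indic_itv (a : R) : (0 < a)%R ->
  \int[mu]_y (\1_(`[(- a)%R, a]%classic : set R) y)%:E = (a + a)%:E.
Proof.
move=> a0; transitivity (mu `[(- a)%R, a]%classic).
  by rewrite integral_indic// setIT.
by rewrite lebesgue_measure_itv/= lte_fin ifT -?EFinB ?opprK//; lra.
Qed.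

Lemma semigroup_ge0 t u x : (forall y, 0 <= u y)%R -> (0 <= semigroup (P := P) t u x)%R.
Proof. by move=> u0; apply: fine_ge0; apply: integral_ge0 => w _; rewrite lee_fin. Qed.

(** Compare the rates p and 1 at the point 0: exp(pt) rho_p 0 - P_t rho_p 0 is at least P_t h_p 0,
    and at most its value at rate 1, hence at most exp(t) rho_1 0. The bounds uniform in p come from
    here. *)
Lemma semigroup_compensated0_le p t : (0 < p <= 1)%R -> (0 <= t)%R ->
  (semigroup (P := P) t (H p) 0 <= expR t * r 1 0)%R.
Proof.
move=> /andP[p0 p1] t0; rewrite (semigroup_compensated hres)//.
have := semigroup_resolvent_rate hres 0%R p0 p1 t0.
rewrite oppr0 mul1r.
have := semigroup_ge0 t 0%R (fun y => resolvent_ge0 hres (- y) (@ltr01 R)).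
have := resolvent_ge0 hres 0 p0.
have : (1 <= expR (p * t))%R by rewrite -expR0 ler_expR mulr_ge0// ltW.
set e1 := expR _; set s1 := semigroup _ _ _; set s2 := semigroup _ _ _.
set e2 := expR _; set a := r p 0; set b := r 1 0 => h1 h2 h3 h4.
have : (0 <= (e1 - 1) * a)%R by rewrite mulr_ge0// subr_ge0.
by rewrite mulrBl mul1r; lra.
Qed.

(** Integrate the preceding bound in time: the rate 2 beats its growth exp(t), and the integral of
    exp(-2t) exp(t) is 1. *)
Lemma resolvent_compensated_le p : (0 < p <= 1)%R ->
  \int[mu]_y (H p y * r 2 y)%:E <= (r 1 0)%:E.
Proof.
move=> p01; have /andP[p0 _] := p01.
have mH := measurable_compensated hres p0.
have H0 y := compensated_ge0 hres y p0.
rewrite [leLHS](_ : _ = \int[P 0%R]_w occupation 2 (H p) w); last first.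
  rewrite (expect_occupation hres)//.
  by apply: eq_integral => y _; rewrite add0r.
rewrite occupation_fubini//.
rewrite [leRHS](_ : _ = (r 1 0)%:E * \int[mu]_(s in `[0%R, +oo[) (expR (- (1 * s)))%:E); last first.
  by rewrite integral_exp// invr1 mule1.
have mexp (c : R) : measurable_fun setT (fun s : R => expR (- (c * s))).
  by apply: measurableT_comp => //; apply: measurableT_comp => //; exact: measurable_funM.
rewrite -ge0_integralZl ?lee_fin ?(resolvent_ge0 hres)//; last first.
  by apply/measurable_EFinP; apply: measurable_funTS; exact: mexp.
apply: ge0_le_integral => //.
- by move=> s _; rewrite mule_ge0 ?lee_fin ?expR_ge0// integral_ge0// => w _; rewrite lee_fin.
- apply: measurable_funTS; apply: emeasurable_funM.
    by apply/measurable_EFinP; exact: mexp.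
  apply: (@measurable_fun_fubini_tonelli_F _ _ _ _ _ (P 0%R)
    (fun z : R * cadlag R => (H p (z.2 z.1))%:E)).
    by apply/measurable_EFinP; exact: measurableT_comp mH measurable_eval2.
  by move=> z; rewrite lee_fin.
- apply: measurable_funTS; apply: measurable_funeM.
  by apply/measurable_EFinP; exact: mexp.
- move=> s /=; rewrite in_itv/= andbT => s0.
  rewrite (semigroupE s 0 mH (fun y => compensated_norm_le hres y p0)) -!EFinM lee_fin.
  apply: le_trans (ler_wpM2l (expR_ge0 _) (semigroup_compensated0_le p01 s0)) _.
  rewrite mulrA -expRD mulrC (_ : - (2 * s) + s = - (1 * s))%R//.
  by ring.
Qed.

(** An averaged bound becomes pointwise by subadditivity: integrate H p x <= H p y + H p (x - y)
    over small y, where the weight [r 2] is bounded below by c. *)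
Let compensated_local_bound : exists d M : R, (0 < d)%R /\
  forall p x, (0 < p <= 1)%R -> (`|x| <= d)%R -> (H p x <= M)%R.
Proof.
have r20 := resolvent0_gt0 hres (@ltr0Sn R 1).
pose c := (r 2 0 / 2)%R; have c0 : (0 < c)%R by rewrite divr_gt0.
have /cvgrPdist_lt /(_ _ c0)/nbhs_ballP[e /= e0 re] := @hr_continuous 2 (@ltr0Sn R 1) 0%R.
have rc y : (`|y| < e)%R -> (c <= r 2 y)%R.
  move=> ye; have : (`|r 2 0 - r 2 y| < c)%R.
    by apply: re; rewrite -ball_normE /= sub0r normrN.
  by rewrite ltr_norml => /andP[_]; rewrite /c; lra.
(* With d = e/3, both y and x - y stay within e of 0. Each of the two terms contributes at most
   [r 1 0], to be divided by c and by the length d + d. *)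
pose d := (e / 3)%R; have d0 : (0 < d)%R by rewrite divr_gt0.
exists d, ((2 * r 1 0) / (c * (d + d)))%R; split=> // p x p01 xd.
have /andP[p0 _] := p01.
have mH := measurable_compensated hres p0.
have H0 y := compensated_ge0 hres y p0.
have mr2 : measurable_fun setT (r 2).
  by apply: continuous_measurable_fun; apply: hr_continuous; exact: ltr0Sn.
have r2_ge0 y := resolvent_ge0 hres y (@ltr0Sn R 1).
rewrite ler_pdivlMr; last by rewrite mulr_gt0// addr_gt0.
pose g y := (H p y * r 2 y)%R.
have g0 y : 0 <= (g y)%:E by rewrite lee_fin mulr_ge0.
have mg : measurable_fun setT (fun y => (g y)%:E).
  by apply/measurable_EFinP; exact: measurable_funM.
have I1 := resolvent_compensated_le p01.
have mgx : measurable_fun setT (fun y => (g (x - y))%:E).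
  by apply: measurableT_comp mg _; exact: measurable_funB.
have I2 : \int[mu]_y (g (x - y))%:E <= (r 1 0)%:E.
  by rewrite (@ge0_integral_reflection _ x (fun y => (g y)%:E)).
have : \int[mu]_y ((H p x * c)%:E * (\1_(`[(- d)%R, d]%classic : set R) y)%:E) <=
    \int[mu]_y ((g y)%:E + (g (x - y))%:E).
  apply: ge0_le_integral => //.
  - by move=> y _; rewrite mule_ge0// lee_fin ?indicE// mulr_ge0// ltW.
  - by apply: measurable_funeM; apply/measurable_EFinP; exact: measurable_indic.
  - exact: emeasurable_funD.
  - move=> y _; rewrite indicE; have [yI|yI] := boolP (_ \in _); last first.
      by rewrite mule0 adde_ge0.
    move: yI; rewrite mem_setE in_itv/= -ler_norml => yd.
    rewrite mule1 -EFinD lee_fin /g.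
    have h1 : (c <= r 2 y)%R by apply: rc; apply: le_lt_trans yd _; rewrite /d; lra.
    have h2 : (c <= r 2 (x - y))%R.
      apply: rc; apply: le_lt_trans (ler_normB _ _) _.
      by move: xd yd; rewrite /d; lra.
    have := compensatedD hres y (x - y) p0; rewrite addrC subrK => hD.
    apply: (@le_trans _ _ ((H p y + H p (x - y)) * c)%R).
      by rewrite ler_wpM2r// ltW.
    by rewrite mulrDl lerD// ler_wpM2l.
rewrite ge0_integralD// ge0_integralZl ?lee_fin ?mulr_ge0 ?(ltW c0)//; last first.
  by apply/measurable_EFinP; exact: measurable_indic.
rewrite integral_indic_itv// -EFinM => /le_trans /(_ (leeD I1 I2)); rewrite -EFinD lee_fin.
by move=> h; rewrite mulrA mulr_natl mulr2n.
Qed.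

(** Divide x into n steps of length at most d and add up the local bounds by subadditivity. *)
Lemma compensated_bounded K : exists M : R, forall p x, (0 < p <= 1)%R ->
  (`|x| <= K)%R -> (H p x <= M)%R.
Proof.
have [d [M [d0 dM]]] := compensated_local_bound.
pose n := (Num.truncn (K / d)).+1.
exists (M *+ n)%R => p x p01 xK; have /andP[p0 _] := p01.
have n0 : (0 < n%:R :> R)%R by rewrite ltr0n.
have Kn : (K < d * n%:R)%R by rewrite mulrC -ltr_pdivrMr// truncnS_gt.
rewrite -[x](@divfK _ n%:R%R) ?gt_eqF// mulr_natr.
apply: le_trans (compensatedMn hres _ _ p0) _; rewrite lerMn2r; apply/orP; right.
apply: dM => //; rewrite normrM normfV (ger0_norm (ltW n0)) ler_pdivrMr//.
exact: le_trans xK (ltW Kn).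
Qed.

(** On [-K, K] the density is at least rho_q 0 - M, and its total mass is 1/q; hence 2 K q (rho_q 0
    - M) <= 1. Take K large first, which fixes M, and then q small. *)
Lemma cvg_rate_resolvent0 : (q * r q 0)%R @[q --> 0^'+] --> 0%R.
Proof.
apply/cvgrPdist_lt => e e0.
(* This K makes 1/(2K) equal to e/4, and the radius [b] below makes q M less than e/4. *)
pose K := (2 / e)%R; have K0 : (0 < K)%R by rewrite divr_gt0.
have [M HM] := compensated_bounded K.
have M0 : (0 <= M)%R.
  apply: le_trans (compensated_ge0 hres 0 (@ltr01 R)) (HM _ _ _ _).
    by rewrite ltr01 lexx.
  by rewrite normr0 ltW.
pose b : R := Num.min 1%R (e / (4 * (M + 1)))%R.
have b0 : (0 < b)%R by rewrite lt_min ltr01 divr_gt0// mulr_gt0// ltr_wpDl.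
exists b => //= q qb q0; move: qb; rewrite /= sub0r normrN gtr0_norm// lt_min => /andP[q1 qe].
rewrite sub0r normrN ger0_norm; last by rewrite mulr_ge0 ?(resolvent_ge0 hres)// ltW.
have q01 : (0 < q <= 1)%R by rewrite q0 ltW.
have rq y : (`|y| <= K -> r q 0 - M <= r q y)%R.
  move=> yK; have := HM q (- y)%R q01; rewrite normrN /compensated opprK => /(_ yK); lra.
have : (q^-1)%:E >= ((r q 0 - M) * (K + K))%:E.
  have [rM|/ltW rM] := leP (r q 0 - M)%R 0%R.
    by rewrite lee_fin (@le_trans _ _ 0%R) ?invr_ge0 ?(ltW q0)// mulr_le0_ge0// addr_ge0// ltW.
  rewrite -(resolvent_mass hres q0).
  rewrite [leLHS](_ : _ = \int[mu]_y ((r q 0 - M)%:E * (\1_(`[(- K)%R, K]%classic : set R) y)%:E)).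
    apply: ge0_le_integral => //.
    - by move=> y _; rewrite mule_ge0// lee_fin// indicE.
    - by apply: measurable_funeM; apply/measurable_EFinP; exact: measurable_indic.
    - by apply/measurable_EFinP; apply: continuous_measurable_fun; exact: hr_continuous.
    - move=> y _; rewrite indicE; have [yI|yI] := boolP (_ \in _); last first.
        by rewrite mule0 lee_fin (resolvent_ge0 hres).
      move: yI; rewrite mem_setE in_itv/= -ler_norml => yK.
      by rewrite mule1 lee_fin rq.
  rewrite ge0_integralZl ?lee_fin//; last first.
    by apply/measurable_EFinP; exact: measurable_indic.
  by rewrite integral_indic_itv// EFinM.
rewrite lee_fin -[leRHS]mul1r ler_pdivlMr// => h.
have h1 : (q * (4 * (M + 1)) < e)%R.
  by rewrite -ltr_pdivlMr// mulr_gt0// ltr_wpDl.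
have h2 : (K * e = 2)%R by rewrite /K divfK// gt_eqF.
have h3 : (e * ((r q 0 - M) * (K + K) * q) <= e)%R by rewrite ler_piMr// ltW.
have E : (e * ((r q 0 - M) * (K + K) * q) = 4 * (q * r q 0) - 4 * (q * M))%R.
  transitivity (2 * (K * e) * (q * r q 0 - q * M))%R; first by ring.
  by rewrite h2; ring.
by rewrite E in h3; lra.
Qed.

End compensated_bounds.

(** * Convergence of the expectations of h_q at a fixed time *)

Section uniform_integrability.
Context {R : realType} {P : R -> probability (cadlag R) R} {r : R -> R -> R}.
Hypothesis hres : levy_resolvent P r.
Let hlevy := resolvent_levy hres.
Let hr_continuous := @resolvent_continuous _ _ _ hres.
Local Open Scope ereal_scope.
Local Notation H := (compensated r).
Local Notation Pi := (semigroup (P := P)).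
Implicit Types (w : cadlag R) (f u : R -> R) (p q t x y a b c M K : R) (A B : set R).

Variables (h : R -> R) (q_ : nat -> R).
Hypothesis h_limit : forall x, H (q_ n) x @[n --> \oo] --> h x.
Hypothesis h_continuous : continuous h.
Hypothesis q01 : forall n, (0 < q_ n <= 1)%R.
Hypothesis q_cvg : q_ n @[n --> \oo] --> 0%R.

Let q0 n : (0 < q_ n)%R. Proof. by case/andP : (q01 n). Qed.

Lemma limit_compensated_ge0 x : (0 <= h x)%R.
Proof.
apply: (cvgr_to_ge (@h_limit x)).
by apply: nearW => n; exact: (compensated_ge0 hres).
Qed.
Let h0 := limit_compensated_ge0.

Lemma limit_compensated0 : h 0 = 0%R.
Proof.
apply: (cvg_unique _ (@h_limit 0%R)) => //.
by apply: cvg_near_cst; apply: nearW => n; exact: compensated0.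
Qed.

Lemma limit_compensatedD x y : (h (x + y) <= h x + h y)%R.
Proof.
have c2 : (H (q_ n) x + H (q_ n) y)%R @[n --> \oo] --> (h x + h y)%R by exact: cvgD.
apply: (ler_cvg_to (@h_limit _) c2); apply: nearW => n.
exact: (compensatedD hres).
Qed.

Let mh : measurable_fun setT h.
Proof. exact: continuous_measurable_fun. Qed.

Let mH n : measurable_fun setT (H (q_ n)).
Proof. exact: (measurable_compensated hres). Qed.

Section fixed_time.
Variable t : R.
Hypothesis t0 : (0 <= t)%R.

Let meval u : measurable_fun setT u -> measurable_fun setT (fun w : cadlag R => u (w t)).
Proof. by move=> mu; exact: measurableT_comp mu (measurable_eval t). Qed.

(** Fatou along the sequence, with the uniform bound available at the starting point 0;
    subadditivity of h then carries integrability to the other points. *)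
Let expect_limit0 : \int[P 0%R]_w (h (w t))%:E < +oo.
Proof.
apply: (@le_lt_trans _ _ (expR t * r 1 0)%:E); last by rewrite ltry.
apply: (@le_trans _ _ (limn_einf (fun n => \int[P 0%R]_w (H (q_ n) (w t))%:E))).
  have E w : (h (w t))%:E = limn_einf (fun n => (H (q_ n) (w t))%:E).
    have c : (H (q_ n) (w t))%:E @[n --> \oo] --> (h (w t))%:E.
      by apply: cvg_EFin; [exact: nearW|exact: h_limit].
    by have [-> _] := cvg_limn_einf_sup c.
  under eq_integral do rewrite E.
  apply: fatou => // n.
    by apply/measurable_EFinP; exact: meval.
  by move=> w _; rewrite lee_fin (compensated_ge0 hres).
rewrite limn_einf_lim; apply: lime_le; first exact: is_cvg_einfs.
apply: nearW => n; apply: (@le_trans _ _ (\int[P 0%R]_w (H (q_ n) (w t))%:E)).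
  by apply: ereal_inf_lbound; exists n => /=.
rewrite (semigroupE t 0%R (mH n) (fun y => compensated_norm_le hres y (q0 n))) lee_fin.
exact: (semigroup_compensated0_le hres).
Qed.

Let evaluable u x := (P x).-integrable setT (fun w => (u (w t))%:E).

Let evaluable_bounded u M x : measurable_fun setT u -> (forall y, `|u y| <= M)%R ->
  evaluable u x.
Proof.
move=> mu uM; apply: (@integrable_bounded _ _ _ _ (fun w : cadlag R => u (w t)) M) => //.
exact: meval.
Qed.

Let expect_shift u x : measurable_fun setT u -> (forall z, 0 <= u z)%R ->
  \int[P x]_w (u (w t))%:E = \int[P 0%R]_w (u (x + w t))%:E.
Proof.
move=> mu u0; rewrite (expect_translate hlevy)//.
  by apply/measurable_EFinP; exact: meval.
by move=> w; rewrite lee_fin.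
Qed.

Let evaluableP u x : measurable_fun setT u -> (forall z, 0 <= u z)%R ->
  evaluable u x <-> \int[P x]_w (u (w t))%:E < +oo.
Proof.
move=> mu u0; split.
  move=> /integrableP[_]; under eq_integral do rewrite gee0_abs ?lee_fin//.
  by [].
move=> ufin; apply/integrableP; split; first by apply/measurable_EFinP; exact: meval.
by under eq_integral do rewrite gee0_abs ?lee_fin//.
Qed.

Let evaluableE u x : evaluable u x -> \int[P x]_w (u (w t))%:E = (Pi t u x)%:E.
Proof. by move=> /(integrable_fin_num measurableT) ufin; rewrite fineK. Qed.

Let PiB u v x : evaluable u x -> evaluable v x ->
  Pi t (fun y => u y - v y)%R x = (Pi t u x - Pi t v x)%R.
Proof.
move=> iu iv; apply: EFin_inj; rewrite EFinB -!evaluableE//; last first.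
  by apply: eq_integrable (integrableB measurableT iu iv) => // w _; rewrite EFinB.
by rewrite -integralB//; apply: eq_integral => w _; rewrite EFinB.
Qed.

Let evalH n x : evaluable (H (q_ n)) x.
Proof.
by apply: (@evaluable_bounded _ (r (q_ n) 0)) => // y; exact: (compensated_norm_le hres).
Qed.

Let evalh x : evaluable h x.
Proof.
apply/evaluableP => //; rewrite expect_shift//.
apply: (@le_lt_trans _ _ (\int[P 0%R]_w ((h x)%:E + (h (w t))%:E))).
  apply: ge0_le_integral => //.
  - by move=> w _; rewrite lee_fin.
  - apply/measurable_EFinP; apply: measurableT_comp mh _.
    by apply: measurable_funD => //; exact: measurable_eval.
  - by apply: emeasurable_funD => //; apply/measurable_EFinP; exact: meval.
  - by move=> w _; rewrite -EFinD lee_fin limit_compensatedD.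
rewrite ge0_integralD ?integral_cst//.
- by rewrite lte_add_pinfty// lte_mul_pinfty ?lee_fin// (le_lt_trans (probability_le1 _ _))// ltry.
- by move=> w _; rewrite lee_fin.
- by move=> w _; rewrite lee_fin.
- by apply/measurable_EFinP; exact: meval.
Qed.

Let Pi_shift u x : measurable_fun setT u -> (forall z, 0 <= u z)%R ->
  Pi t u x = Pi t (fun y => u (x + y)%R) 0.
Proof. by move=> mu u0; rewrite /semigroup expect_shift. Qed.

Let eval_shift u x : measurable_fun setT u -> (forall z, 0 <= u z)%R ->
  evaluable u x -> evaluable (fun y => u (x + y)%R) 0.
Proof.
move=> mu u0 /(evaluableP x mu u0); rewrite expect_shift// => ufin.
apply/evaluableP => //; apply: measurableT_comp mu _; exact: measurable_funD.
Qed.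

Let drift n x := (Pi t (H (q_ n)) x - Pi t h x)%R.

(** By subadditivity, h_q (x + y) - h_q y is bounded, uniformly in y and q, by the values of h_q at
    x and -x; so bounded convergence applies to the part of the drift that depends on x. *)
Let cvg_drift_diff x : (drift n x - drift n 0)%R @[n --> \oo] --> 0%R.
Proof.
have [M HM] := compensated_bounded hres `|x|%R.
pose g n y := ((H (q_ n) (x + y) - H (q_ n) y) - (h (x + y) - h y))%R.
have H0 n y : (0 <= H (q_ n) y)%R by exact: (compensated_ge0 hres).
have iH n := eval_shift (mH n) (H0 n) (evalH n x).
have ih := eval_shift mh h0 (evalh x).
have mHx n : measurable_fun setT (fun y => H (q_ n) (x + y)%R).
  by apply: measurableT_comp (mH n) _; exact: measurable_funD.
have mhx : measurable_fun setT (fun y => h (x + y)%R).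
  by apply: measurableT_comp mh _; exact: measurable_funD.
have evB u v : evaluable u 0%R -> evaluable v 0%R -> evaluable (fun y => u y - v y)%R 0%R.
  by move=> iu iv; apply: eq_integrable (integrableB measurableT iu iv) => // w _; rewrite EFinB.
have E n : (drift n x - drift n 0)%R = Pi t (g n) 0.
  rewrite /drift /g (@PiB (fun y => H (q_ n) (x + y) - H (q_ n) y)%R
    (fun y => h (x + y) - h y)%R); [|exact: evB|exact: evB].
  rewrite (@PiB (fun y => H (q_ n) (x + y))%R (H (q_ n)))//.
  rewrite (@PiB (fun y => h (x + y))%R h)//.
  by rewrite (Pi_shift x (mH n) (H0 n)) (Pi_shift x mh h0); ring.
under eq_cvg do rewrite E.
have Pi0 : Pi t (cst 0%R) 0 = 0%R by rewrite /semigroup integral0.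
suff : Pi t (g n) 0 @[n --> \oo] --> Pi t (cst 0%R) 0 by rewrite Pi0.
have norm_le (k : R -> R) (y : R) : (forall a b, k (a + b) <= k a + k b)%R ->
    (k x <= M)%R -> (k (- x) <= M)%R -> (`|k (x + y) - k y| <= M)%R.
  move=> kD kx kNx; rewrite ler_norml; apply/andP; split.
    by have := kD (- x)%R (x + y)%R; rewrite addKr; lra.
  by have := kD x y; lra.
apply: (@cvg_semigroup _ P t g (cst 0%R) (M + M)%R).
- by move=> n; apply: measurable_funB; apply: measurable_funB.
- exact: measurable_cst.
- move=> n y; rewrite (le_trans (ler_normB _ _))// lerD//; apply: norm_le.
  + by move=> a b; exact: (compensatedD hres).
  + exact: HM.
  + by apply: HM; rewrite ?normrN.
  + exact: limit_compensatedD.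
  + by apply: (cvgr_to_le (@h_limit x)); apply: nearW => k; exact: HM.
  + apply: (cvgr_to_le (@h_limit (- x)%R)); apply: nearW => k.
    by apply: HM; rewrite ?normrN.
- move=> y; rewrite (_ : cst _ _ = (h (x + y) - h y) - (h (x + y) - h y))%R; last first.
    by rewrite subrr.
  by apply: cvgB; [apply: cvgB; exact: h_limit|exact: cvg_cst].
Qed.

Let resolvent_evaluable q x : (0 < q)%R -> evaluable (fun y : R => r q (- y)) x.
Proof.
move=> qp; apply: (@evaluable_bounded _ (r q 0)).
  apply: measurableT_comp (continuous_measurable_fun (hr_continuous qp)) _.
  exact: measurable_funN.
move=> y; rewrite ger0_norm ?(resolvent_ge0 hres)//; exact: (resolvent_le0 hres).
Qed.

(* Otherwise [h x + expR (n q t) r q (- x) >= n c] for all n, by iterating the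
   semigroup, and x = 0, q = 1/n would contradict [q * r q 0 --> 0]. *)
Let near_invariant c : (0 < c)%R -> exists x q, (0 < q)%R /\
  (h x + (expR (q * t) * r q (- x) - Pi t (fun y : R => r q (- y)) x) < Pi t h x + c)%R.
Proof.
move=> c0; apply: contrapT => nex.
have ge x q : (0 < q)%R ->
    (Pi t h x + c <= h x + (expR (q * t) * r q (- x) - Pi t (fun y : R => r q (- y)) x))%R.
  by move=> qp; rewrite leNgt; apply/negP => lt; apply: nex; exists x, q.
have iter q n x : (0 < q)%R -> (n%:R * c <= h x + expR (n%:R * (q * t)) * r q (- x))%R.
  move=> qp; elim: n x => [|n IH] x.
    by rewrite !mul0r addr_ge0// mulr_ge0 ?expR_ge0 ?(resolvent_ge0 hres).
  have mr : measurable_fun setT (fun y : R => r q (- y)).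
    apply: measurableT_comp (continuous_measurable_fun (hr_continuous qp)) _.
    exact: measurable_funN.
  set E := expR (n%:R * (q * t)) in IH *.
  have E1 : (1 <= E)%R by rewrite -expR0 ler_expR !mulr_ge0// ltW.
  (* The induction hypothesis at the point [w t], integrated under [P x]. *)
  have step : (n%:R * c <= Pi t h x + E * Pi t (fun y : R => r q (- y)) x)%R.
    rewrite -lee_fin EFinD (EFinM E) -evaluableE// -evaluableE; last exact: resolvent_evaluable.
    rewrite -ge0_integralZl ?lee_fin ?(le_trans ler01 E1)//; last 2 first.
    - by apply/measurable_EFinP; exact: (meval mr).
    - by move=> w _; rewrite lee_fin (resolvent_ge0 hres).
    rewrite -ge0_integralD//; last 4 first.
    - by move=> w _; rewrite lee_fin.
    - by apply/measurable_EFinP; exact: meval.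
    - by move=> w _; rewrite mule_ge0// lee_fin ?expR_ge0 ?(resolvent_ge0 hres).
    - by apply: measurable_funeM; apply/measurable_EFinP; exact: (meval mr).
    rewrite [leLHS](_ : _ = \int[P x]_w (n%:R * c)%:E); last first.
      rewrite integral_cst// -[LHS]mule1; congr (_ * _).
      exact/esym/probability_setT.
    apply: ge0_le_integral => //.
    - by move=> w _; rewrite lee_fin mulr_ge0// ltW.
    - apply: emeasurable_funD; first by apply/measurable_EFinP; exact: meval.
      by apply: measurable_funeM; apply/measurable_EFinP; exact: (meval mr).
    - by move=> w _; rewrite -EFinM -EFinD lee_fin IH.
  have := ge x q qp; have := semigroup_resolvent_le hres x qp t0.
  have -> : (n.+1%:R * (q * t) = n%:R * (q * t) + q * t)%R by rewrite mulrSr mulrDl mul1r.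
  rewrite expRD -/E mulrSr mulrDl mul1r -mulrA.
  move: step; set b := Pi t h x; set a := Pi t _ x; set e := (expR (q * t) * _)%R.
  (* The gain e - a is nonnegative by [semigroup_resolvent_le], so the factor E >= 1 in front of it
     only helps the induction. *)
  move=> h1 h2 h3; have : (0 <= (E - 1) * (e - a))%R by rewrite mulr_ge0 ?subr_ge0.
  by rewrite mulrBl mul1r mulrBr; lra.
have ct : (0 < c / expR t)%R by rewrite divr_gt0// expR_gt0.
have /cvgrPdist_lt /(_ _ ct)[b /= b0 qb] := cvg_rate_resolvent0 hres.
pose n := (Num.truncn b^-1).+1.
have n0 : (0 < n%:R :> R)%R by rewrite ltr0n.
have nb : (n%:R^-1 < b)%R by rewrite invf_plt ?posrE// truncnS_gt.
have ni0 : (0 < n%:R^-1 :> R)%R by rewrite invr_gt0.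
have : (n%:R^-1 * r n%:R^-1 0 < c / expR t)%R.
  have := qb n%:R^-1%R; rewrite /= sub0r normrN gtr0_norm// => /(_ nb ni0).
  by rewrite sub0r normrN ger0_norm// mulr_ge0 ?(resolvent_ge0 hres)// ltW.
have := iter n%:R^-1%R n 0%R ni0.
rewrite limit_compensated0 add0r oppr0 mulrA mulfV ?gt_eqF// mul1r.
rewrite ltr_pdivlMr ?expR_gt0// -mulrA ltr_pdivrMl// [(r _ _ * _)%R]mulrC.
by move=> /le_lt_trans /[apply]; rewrite ltxx.
Qed.

(** At the point x of [near_invariant], P_t h_{q_n} x is at most h_{q_n} x + k as soon as q_n <= q,
    by monotonicity in the rate, and the limit of this bound is below P_t h x + c. [cvg_drift_diff]
    moves the estimate from x to 0. *)
Let drift0_lt c : (0 < c)%R -> \forall n \near \oo, (drift n 0 < c)%R.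
Proof.
move=> c0; have [x [q [qp]]] := near_invariant c0.
(* Half of the slack left by [near_invariant], to be spent on two approximations. *)
set k := (_ - _)%R => hk; pose e := ((Pi t h x + c - (h x + k)) / 2)%R.
have e0 : (0 < e)%R by rewrite divr_gt0// subr_gt0.
have /cvgrPdist_lt /(_ _ e0) near1 := @h_limit x.
have /cvgrPdist_lt /(_ _ e0) near2 := @cvg_drift_diff x.
have /cvgrPdist_lt /(_ _ qp) near3 := q_cvg.
near=> n.
have n1 : (`|h x - H (q_ n) x| < e)%R by near: n.
have n2 : (`|0 - (drift n x - drift n 0)| < e)%R by near: n.
have n3 : (`|0 - q_ n| < q)%R by near: n.
have := q0 n; move: n3; rewrite sub0r normrN gtr0_norm// => /ltW nq nq0.
have := semigroup_resolvent_rate hres x nq0 nq t0.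
have : (drift n x = r (q_ n) 0 - Pi t (fun y : R => r (q_ n) (- y)) x - Pi t h x)%R.
  by rewrite /drift (semigroup_compensated hres).
have : (0 <= (expR (q_ n * t) - 1) * r (q_ n) (- x))%R.
  by rewrite mulr_ge0 ?(resolvent_ge0 hres)// subr_ge0 -expR0 ler_expR mulr_ge0// ltW.
move: n1 n2; rewrite !ltr_norml => /andP[n1 _] /andP[_ n2].
rewrite mulrBl mul1r => h1 h2 h3.
by move: n1 n2; rewrite h2 /e /k /compensated; lra.
Unshelve. all: by end_near.
Qed.

Let cvg_minl (u : nat -> R) a b : u n @[n --> \oo] --> a ->
  Num.min (u n) b @[n --> \oo] --> Num.min a b.
Proof.
move=> ua; have cm : {for a, continuous (fun z : R => Num.min z b)}.
  by apply: (@continuous_min _ _ id (cst b)); [exact: cvg_id|exact: cvg_cst].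
exact: (continuous_cvg _ cm ua).
Qed.

Let cvg_expect_min x :
  Pi t (fun y => Num.min (H (q_ n) y) (h y)) x @[n --> \oo] --> Pi t h x.
Proof.
apply: fine_cvg; rewrite -evaluableE//.
have [] // := @dominated_convergence _ _ _ (P x) setT measurableT
  (fun n w => (Num.min (H (q_ n) (w t)) (h (w t)))%:E)
  (fun w => (h (w t))%:E) (fun w => (h (w t))%:E).
- move=> n; apply/measurable_EFinP.
  by apply: (@meval (fun y => Num.min (H (q_ n) y) (h y))); exact: measurable_minr.
- by apply/measurable_EFinP; exact: meval.
- apply/aeW => w _; apply: cvg_EFin; first exact: nearW.
  rewrite -[X in _ --> X](minxx (h (w t))).
  by apply: cvg_minl; exact: h_limit.
- exact: evalh.
- apply/aeW => w n _; rewrite lee_fin ger0_norm ?ge_min ?lexx ?orbT//.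
  by rewrite le_min h0 (compensated_ge0 hres).
Qed.

(** The excess is h_q - min(h_q, h), and the expectations of the minima converge by domination. As
    the excess is nonnegative, an upper bound on the drift suffices. *)
Let cvg_expect_excess x :
  Pi t (fun y => Num.max 0%R (H (q_ n) y - h y)%R) x @[n --> \oo] --> 0%R.
Proof.
have imin n : evaluable (fun y => Num.min (H (q_ n) y) (h y)) x.
  apply: (@evaluable_bounded _ (r (q_ n) 0)); first exact: measurable_minr.
  move=> y; rewrite ger0_norm ?ge_min ?(compensated_le hres)//.
  by rewrite le_min h0 (compensated_ge0 hres).
have E n : Pi t (fun y => Num.max 0%R (H (q_ n) y - h y)%R) x =
    (Pi t (H (q_ n)) x - Pi t (fun y => Num.min (H (q_ n) y) (h y)) x)%R.
  rewrite -(@PiB (H (q_ n)) (fun y => Num.min (H (q_ n) y) (h y)))//.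
  congr (Pi t _ x); apply/funext => y; set a := H _ _; set b := h y.
  by have [ab|/ltW ab] := leP a b; [rewrite (max_idPl _) ?subrr|rewrite (max_idPr _)]; rewrite ?subr_le0 ?subr_ge0.
apply/cvgrPdist_lt => e e0; have e20 : (0 < e / 2)%R by rewrite divr_gt0.
have e40 : (0 < e / 4)%R by rewrite divr_gt0.
have near1 := drift0_lt e40.
have /cvgrPdist_lt /(_ _ e40) near2 := @cvg_drift_diff x.
have /cvgrPdist_lt /(_ _ e20) near3 := @cvg_expect_min x.
near=> n.
have n1 : (drift n 0 < e / 4)%R by near: n.
have n2 : (`|0 - (drift n x - drift n 0)| < e / 4)%R by near: n.
have n3 : (`|Pi t h x - Pi t (fun y => Num.min (H (q_ n) y) (h y)) x| < e / 2)%R by near: n.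
rewrite sub0r normrN ger0_norm; last first.
  by apply: semigroup_ge0 => y; rewrite le_max lexx.
rewrite E; move: n2 n3; rewrite !ltr_norml => /andP[n2 _] /andP[_ n3].
by move: n1 n2; rewrite /drift; lra.
Unshelve. all: by end_near.
Qed.

Lemma integrable_limit_compensated x : (P x).-integrable setT (fun w => (h (w t))%:E).
Proof. exact: evalh. Qed.

(** Split g_n into min(g_n, h), dominated by M h once multiplied by [Z], and its excess over h, at
    most that of h_q, whose expectation tends to 0. *)
Lemma cvg_expect_dominated x (Z : cadlag R -> R) M (g_ : nat -> R -> R) (g : R -> R) :
  measurable_fun setT Z -> (forall w, `|Z w| <= M)%R ->
  (forall n, measurable_fun setT (g_ n)) -> (forall n y, 0 <= g_ n y <= H (q_ n) y)%R ->
  (forall y, g_ n y @[n --> \oo] --> g y) ->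
  \int[P x]_w (Z w * g_ n (w t))%:E @[n --> \oo] --> \int[P x]_w (Z w * g (w t))%:E.
Proof.
move=> mZ ZM mg_ g_H g_g.
have M0 : (0 <= M)%R by exact: le_trans (normr_ge0 _) (ZM point).
have g0 y : (0 <= g y)%R.
  by apply: (cvgr_to_ge (@g_g y)); apply: nearW => n; case/andP : (g_H n y).
have gh y : (g y <= h y)%R.
  apply: (ler_cvg_to (@g_g y) (@h_limit y)); apply: nearW => n.
  by case/andP : (g_H n y).
have mg : measurable_fun setT g.
  by apply: (measurable_fun_cvg mg_) => y _; exact: g_g.
pose low n w := (Z w * Num.min (g_ n (w t)) (h (w t)))%R.
pose high n w := (Z w * Num.max 0 (g_ n (w t) - h (w t)))%R.
have mlow n : measurable_fun setT (low n).
  apply: measurable_funM => //.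
  by apply: (@meval (fun y => Num.min (g_ n y) (h y))); exact: measurable_minr.
have mhigh n : measurable_fun setT (high n).
  apply: measurable_funM => //.
  apply: (@meval (fun y => Num.max 0%R (g_ n y - h y)%R)); apply: measurable_maxr => //.
  exact: measurable_funB.
have iMh : (P x).-integrable setT (fun w => (M * h (w t))%:E).
  by apply: eq_integrable (integrableZl measurableT M (evalh x)) => // w _; rewrite EFinM.
have low_le n w : (`|low n w| <= M * h (w t))%R.
  rewrite /low normrM; apply: ler_pM => //.
  rewrite ger0_norm ?ge_min ?lexx ?orbT// le_min h0 andbT.
  by case/andP : (g_H n (w t)).
have ilow n : (P x).-integrable setT (fun w => (low n w)%:E).
  apply: le_integrable iMh => //; first exact/measurable_EFinP.
  by move=> w _; rewrite lee_fin (le_trans (low_le n w))// ler_norm.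
have high_le n w : (`|high n w| <= M * Num.max 0 (H (q_ n) (w t) - h (w t)))%R.
  have m0 (a : R) : (0 <= Num.max 0 a)%R by rewrite le_max lexx.
  rewrite /high normrM; apply: ler_pM => //; rewrite ger0_norm//.
  rewrite ge_max m0/= le_max lerD2r.
  by case/andP : (g_H n (w t)) => _ ->; rewrite orbT.
have imax n : evaluable (fun y => Num.max 0%R (H (q_ n) y - h y)%R) x.
  apply: (@evaluable_bounded _ (r (q_ n) 0)).
    by apply: measurable_maxr => //; exact: measurable_funB.
  move=> y; rewrite ger0_norm ?le_max ?lexx// ge_max (resolvent_ge0 hres)//=.
  by rewrite lerBlDr (le_trans (compensated_le hres _ _))// lerDl.
have iMmax n : (P x).-integrable setT (fun w => (M * Num.max 0 (H (q_ n) (w t) - h (w t)))%:E).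
  by apply: eq_integrable (integrableZl measurableT M (imax n)) => // w _; rewrite EFinM.
have ihigh n : (P x).-integrable setT (fun w => (high n w)%:E).
  apply: le_integrable (iMmax n) => //; first exact/measurable_EFinP.
  by move=> w _; rewrite lee_fin (le_trans (high_le n w))// ler_norm.
have split_int n : \int[P x]_w (Z w * g_ n (w t))%:E =
    \int[P x]_w (low n w)%:E + \int[P x]_w (high n w)%:E.
  rewrite -integralD//; apply: eq_integral => w _; rewrite -EFinD -mulrDr.
  congr ((_ * _)%:E); set a := g_ n _; set b := h _.
  by have [ab|/ltW ab] := leP a b; [rewrite (max_idPl _) ?addr0|rewrite (max_idPr _) ?subrKC];
    rewrite ?subr_le0 ?subr_ge0// addrC subrK.
rewrite [X in X @ _ --> _](_ : _ = fun n =>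
    \int[P x]_w (low n w)%:E + \int[P x]_w (high n w)%:E); last first.
  by apply/funext => n; exact: split_int.
rewrite -[X in _ --> X]adde0; apply: cvgeD; first by rewrite fin_num_adde_defl.
  have [] // := @dominated_convergence _ _ _ (P x) setT measurableT
    (fun n w => (low n w)%:E) (fun w => (Z w * g (w t))%:E) (fun w => (M * h (w t))%:E).
  - by move=> n; exact/measurable_EFinP.
  - by apply/measurable_EFinP; apply: measurable_funM => //; exact: meval.
  - apply/aeW => w _; apply: cvg_EFin; first exact: nearW.
    apply: cvgM; first exact: cvg_cst.
    rewrite -[X in _ --> X](min_idPl (gh (w t))).
    by apply: cvg_minl; exact: g_g.
  - by apply/aeW => w n _; rewrite lee_fin.
have bound n : `|\int[P x]_w (high n w)%:E| <=
    (M * Pi t (fun y => Num.max 0%R (H (q_ n) y - h y)%R) x)%:E.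
  apply: le_trans (le_abse_integral _ measurableT _) _; first exact/measurable_EFinP.
  rewrite EFinM -evaluableE; last exact: imax.
  rewrite -integralZl; [|exact: measurableT|exact: imax].
  apply: ge0_le_integral => //.
  - by apply: measurableT_comp => //; exact/measurable_EFinP.
  - by apply: measurable_funeM; exact: measurable_int (imax n).
  - by move=> w _; rewrite -EFinM /= lee_fin.
apply/cvg_abse0P.
apply: (@squeeze_cvge _ _ _ _ (cst 0) _
  (fun n => (M * Pi t (fun y => Num.max 0%R (H (q_ n) y - h y)%R) x)%:E)).
- by apply: nearW => n; rewrite abse_ge0 bound.
- exact: cvg_cst.
- apply: cvg_EFin; first exact: nearW.
  suff : (M * Pi t (fun y => Num.max 0 (H (q_ n) y - h y)) x)%R @[n --> \oo] --> (M * 0)%R.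
    by rewrite mulr0.
  by apply: cvgM; [exact: cvg_cst|exact: cvg_expect_excess].
Qed.

End fixed_time.

End uniform_integrability.

(** * Conditioning to avoid a set *)

(** Writing a as (a + M) - M leaves two nonnegative integrands, so that identities proved for
    nonnegative factors extend to bounded ones. *)
Lemma integral_shift_factor d (T : measurableType d) (R : realType) (m : probability T R)
    (a b : T -> R) (M : R) :
  measurable_fun setT a -> measurable_fun setT b -> (forall v, `|a v| <= M)%R ->
  (forall v, 0 <= b v <= 1)%R ->
  (\int[m]_v (a v * b v)%:E = \int[m]_v ((a v + M) * b v)%:E - \int[m]_v (M * b v)%:E)%E.
Proof.
move=> ma mb aM b01.
have M0 : 0 <= M by exact: le_trans (aM point).
have bn v : `|b v| <= 1 by have /andP[b0 b1] := b01 v; rewrite ger0_norm.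
rewrite -integralB//; first by apply: eq_integral => v _; rewrite -EFinB; congr EFin; ring.
- apply: (@integrable_bounded _ _ _ _ (fun v => (a v + M) * b v) ((M + M) * 1)).
    by apply: measurable_funM => //; exact: measurable_funD.
  move=> v; rewrite normrM; apply: ler_pM => //; apply: le_trans (ler_normD _ _) _.
  by rewrite lerD// ger0_norm.
- apply: (@integrable_bounded _ _ _ _ (fun v => M * b v) (M * 1)).
    exact: measurable_funM.
  by move=> v; rewrite normrM; apply: ler_pM => //; rewrite ger0_norm.
Qed.

(** * Exponential killing before the hitting time *)

Section killing.
Context {R : realType} {P : R -> probability (cadlag R) R}.
Local Open Scope ereal_scope.
Implicit Types (w : cadlag R) (p q t x y M : R) (A : set R) (N : set (cadlag R)).

(** Outside [N], the conditional probability given the path that the clock rings before [A] is hit;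
    the value 1 on [N] makes it measurable. *)
Definition survival q A N w : R :=
  (1 - (discounted_hit q (cst 1) A \_ (~` N)) w)%R.

Lemma survival_itv q A N w : (0 <= q)%R -> (0 <= survival q A N w <= 1)%R.
Proof.
move=> q0; rewrite /survival patchE; case: ifPn => _; last by rewrite subr0 lexx ler01.
have /andP[d0 d1] := discounted_hit1_itv A w q0.
by rewrite subr_ge0 d1 gerBl.
Qed.

Lemma measurable_survival q A T N : @hitting_version R P A T N ->
  measurable_fun setT (survival q A N).
Proof.
move=> hv; apply: measurable_funB => //.
apply: (measurable_discounted_hit (P := P)) hv; exact: cst_continuous.
Qed.

Lemma exponential_prob_lt q (tau : \bar R) : (0 < q)%R -> 0 <= tau ->
  exponential_prob q [set s | s%:E < tau] =
  (if (tau < +oo)%E then 1 - expR (- (q * fine tau)) else 1)%R%:E.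
Proof.
move=> q0; case: tau => [c||] //=; last first.
  move=> _; rewrite /exponential_prob (_ : [set s : R | _] = setT).
    exact: integral_exponential_pdf.
  by apply/seteqP; split => s //= _; rewrite ltry.
rewrite lee_fin ltry /exponential_prob le_eqVlt => /predU1P[<-|c0].
  rewrite mulr0 oppr0 expR0 subrr integral0_eq// => s /=.
  by rewrite lte_fin => s0; rewrite lt0_exponential_pdf.
rewrite EFinB -mulNr -exponential_prob_itv0c// /exponential_prob.
rewrite integral_mkcond [RHS]integral_mkcond.
(* The events s < c and s <= c differ by a single point, which is null. *)
apply: (@integral_off_null _ _ R (@lebesgue_measure R) [set c]) => [//||s /= sc].
  exact: lebesgue_measure_set1.
rewrite !patchE; have [s0|s0] := ltP s 0%R.
  by rewrite lt0_exponential_pdf//; case: ifP; case: ifP.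
congr (if _ then _ else _); apply/idP/idP => /set_mem/=.
  by rewrite lte_fin => sc'; rewrite mem_set//= in_itv/= s0 ltW.
rewrite in_itv/= => /andP[_ sc']; rewrite mem_set//= lte_fin lt_neqAle sc' andbT.
exact/eqP.
Qed.

Section clocks.
Context d (T : measurableType d) (Q : R -> probability T R) (Y : T -> cadlag R)
  (e : R -> T -> R).
Hypothesis clocks : exponential_clocks P Q Y e.
Variables (A : set R) (S : cadlag R -> \bar R) (N : set (cadlag R)).
Hypothesis hv : @hitting_version R P A S N.
Variables (x q : R).
Hypothesis q0 : (0 < q)%R.

Let mY : measurable_fun setT Y. Proof. exact: (clock_path_measurable clocks). Qed.
Let me : measurable_fun setT (e q). Proof. exact: (clock_measurable clocks). Qed.
Let mS : measurable_fun setT S.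
Proof. by case: hv => oS _ _ _; exact: measurable_optional_time. Qed.

Let alive : set (cadlag R * R) := [set z | z.2%:E < S z.1].

Let malive : measurable alive.
Proof.
rewrite -[X in measurable X]setTI; apply: measurable_lte => //.
  by apply/measurable_EFinP; exact: measurable_snd.
exact: measurableT_comp mS measurable_fst.
Qed.

Let emix := isMeasurableFun.Build _ _ _ _ _ me.
Let epack : {mfun _ >-> _} := HB.pack (e q) emix.

Let expect_path (k : cadlag R -> \bar R) : measurable_fun setT k -> (forall w, 0 <= k w) ->
  \int[Q x]_v k (Y v) = \int[P x]_w k w.
Proof.
move=> mk k0; rewrite -(@ge0_integral_pushforward _ _ _ _ _ _ mY (Q x) setT)//.
by apply: eq_measure_integral => /= C mC _; exact: (clock_path_law clocks).
Qed.

Let survivalS w : ~ N w -> 0 <= S w ->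
  (survival q A N w)%:E = exponential_prob q [set s | s%:E < S w].
Proof.
move=> nw S0; have [_ _ _ /(_ w nw) AS] := hv.
rewrite exponential_prob_lt// /survival patchE mem_set// /discounted_hit AS.
by case: ifPn => _; rewrite ?mulr1// subr0.
Qed.

Let expect_alive_ge0 (Z : cadlag R -> R) : measurable_fun setT Z -> (forall w, 0 <= Z w)%R ->
  \int[Q x]_v (Z (Y v) * \1_alive (Y v, e q v))%:E = \int[P x]_w (Z w * survival q A N w)%:E.
Proof.
move=> mZ Z0; pose g (z : cadlag R * R) := (Z z.1 * \1_alive z)%:E.
have mg : measurable_fun setT g.
  apply/measurable_EFinP; apply: measurable_funM.
    exact: measurableT_comp mZ measurable_fst.
  exact: measurable_indic.
rewrite (@integral_indep _ _ _ (Q x) _ _ _ _ Y (e q) (distribution (Q x) epack) mY me _ g)//.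
- have [oS mN N0 _] := hv.
  pose k w := \int[distribution (Q x) epack]_s g (w, s).
  have k0 w : 0 <= k w by apply: integral_ge0 => s _; rewrite lee_fin mulr_ge0// indicE.
  have mk : measurable_fun setT k.
    apply: (@measurable_fun_fubini_tonelli_F _ _ _ _ _ (distribution (Q x) epack) g) => // z.
    by rewrite lee_fin mulr_ge0// indicE.
  rewrite (expect_path mk k0); apply: (integral_off_null mN (N0 x)) => w nw.
  have mI : measurable [set s : R | s%:E < S w].
    rewrite -[X in measurable X]setTI; apply: measurable_lte => //.
  rewrite EFinM survivalS//; last exact: oS.1.
  rewrite -(clock_law clocks x q0 mI) /k /g /=.
  under eq_integral do rewrite EFinM.
  rewrite ge0_integralZl ?lee_fin//; last first.
    apply/measurable_EFinP; exact: (measurableT_comp (measurable_indic malive)).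
  congr (_ * _); transitivity (\int[distribution (Q x) epack]_s (\1_[set s : R | (s%:E < S w)%E] s)%:E).
    by apply: eq_integral => s _; rewrite !indicE.
  by rewrite integral_indic// setIT.
- by move=> C B mC mB; exact: (clock_indep clocks).
- by move=> z; rewrite lee_fin mulr_ge0// indicE.
Qed.

(** Replace the hitting time by its version, from which it differs only on the preimage of [N], and
    integrate out the independent clock. *)
Lemma expect_before_clock (Z : cadlag R -> R) M : measurable_fun setT Z ->
  (forall w, `|Z w| <= M)%R ->
  \int[Q x]_(v in [set v | (e q v)%:E < hitting_time A (Y v)]) (Z (Y v))%:E =
  \int[P x]_w (Z w * survival q A N w)%:E.
Proof.
move=> mZ ZM; have [oS mN N0 AS] := hv.
have M0 : (0 <= M)%R by exact: le_trans (ZM point).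
have mYe : measurable_fun setT (fun v => (Y v, e q v)) by exact: measurable_fun_pair.
transitivity (\int[Q x]_v (Z (Y v) * \1_alive (Y v, e q v))%:E).
  rewrite integral_mkcond; apply: (@integral_off_null _ _ _ _ (Y @^-1` N)).
  - by rewrite -[X in measurable X]setTI; exact: mY.
  - by move: (N0 x); rewrite -(clock_path_law clocks x mN).
  - move=> v nv; rewrite patchE indicE.
    have -> : (v \in [set v | (e q v)%:E < hitting_time A (Y v)]) = ((Y v, e q v) \in alive).
      by apply/idP/idP => /set_mem/=; rewrite ?AS// => ?; rewrite mem_set//= ?AS.
    by case: ifPn => _; rewrite ?mulr1 ?mulr0.
rewrite (@integral_shift_factor _ _ _ (Q x) (fun v => Z (Y v)) (fun v => \1_alive (Y v, e q v)) M)//; last 3 first.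
- exact: measurableT_comp mZ mY.
- exact: measurableT_comp (measurable_indic malive) mYe.
- by move=> v; rewrite indicE; case: (_ \in _); rewrite /= ?lexx ?ler01.
rewrite (@integral_shift_factor _ _ _ (P x) Z (survival q A N) M)//; last 2 first.
- exact: measurable_survival hv.
- by move=> w; apply: survival_itv; exact: ltW.
congr (_ - _).
  apply: (@expect_alive_ge0 (fun w => Z w + M)%R); first exact: measurable_funD.
  by move=> w; have := ZM w; rewrite ler_norml => /andP[]; lra.
exact: (@expect_alive_ge0 (fun _ => M)).
Qed.

End clocks.

End killing.

Section markov_expectation.
Context {R : realType} {P : R -> probability (cadlag R) R}.
Hypothesis hlevy : levy_family P.
Local Open Scope ereal_scope.
Implicit Types (w : cadlag R) (p q t x y M : R) (A : set R) (N : set (cadlag R)).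

Lemma measurable_expectation (G : cadlag R -> \bar R) : measurable_fun setT G ->
  (forall w, 0 <= G w) -> measurable_fun setT (fun y => \int[P y]_w G w).
Proof.
move=> mG G0; rewrite (_ : (fun y => _) = fun y => \int[P 0%R]_w G (translate y w)).
  apply: (@measurable_fun_fubini_tonelli_F _ _ _ _ _ (P 0%R)
    (fun z : R * cadlag R => G (translate z.1 z.2))) => //.
  exact: measurableT_comp mG (@measurable_translate R).
by apply/funext => y; exact: expect_translate.
Qed.

Lemma expectation_itv01 y (G : cadlag R -> R) : measurable_fun setT G ->
  (forall w, 0 <= G w <= 1)%R -> 0 <= \int[P y]_w (G w)%:E <= 1.
Proof.
move=> mG G01; rewrite integral_ge0/=; last by move=> w _; rewrite lee_fin; case/andP : (G01 w).
rewrite -(@probability_setT _ _ _ (P y)) -[leRHS]mul1e -integral_cst//.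
apply: ge0_le_integral => //.
- by move=> w _; rewrite lee_fin; case/andP : (G01 w).
- exact/measurable_EFinP.
- by move=> w _; rewrite lee_fin; case/andP : (G01 w).
Qed.

Lemma expectation_fin_num y (G : cadlag R -> R) : measurable_fun setT G ->
  (forall w, 0 <= G w <= 1)%R -> \int[P y]_w (G w)%:E \is a fin_num.
Proof.
move=> mG G01; have /andP[I0 I1] := expectation_itv01 y mG G01.
by rewrite ge0_fin_numE// (le_lt_trans I1)// ltry.
Qed.

Lemma measurable_fine_expectation (G : cadlag R -> R) : measurable_fun setT G ->
  (forall w, 0 <= G w)%R -> measurable_fun setT (fun y => fine (\int[P y]_w (G w)%:E)).
Proof.
move=> mG G0; apply: measurableT_comp (fine_measurable measurableT) _.
apply: measurable_expectation; first exact/measurable_EFinP.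
by move=> w; rewrite lee_fin.
Qed.

Lemma markov_property_bounded x t (F G : cadlag R -> R) M : (0 <= t)%R ->
  @measurable_fun _ _ (right_filtered t) R setT F -> (forall w, `|F w| <= M)%R ->
  measurable_fun setT G -> (forall w, 0 <= G w <= 1)%R ->
  \int[P x]_w (F w * G (path_shift t w))%:E =
  \int[P x]_w (F w * fine (\int[P (w t)]_v (G v)%:E))%:E.
Proof.
move=> t0 mF FM mG G01.
have M0 : (0 <= M)%R by exact: le_trans (FM point).
have mF' := measurable_fun_right_filtered mF.
have G0 w : (0 <= G w)%R by case/andP : (G01 w).
have ge0 (Z : cadlag R -> R) : @measurable_fun _ _ (right_filtered t) R setT Z ->
    (forall w, 0 <= Z w)%R ->
    \int[P x]_w (Z w * G (path_shift t w))%:E =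
    \int[P x]_w (Z w * fine (\int[P (w t)]_v (G v)%:E))%:E.
  move=> mZ Z0; under eq_integral do rewrite EFinM.
  rewrite (@markov_property _ _ hlevy x t (fun w => (Z w)%:E) (fun w => (G w)%:E))//.
  - by apply: eq_integral => w _; rewrite EFinM fineK// expectation_fin_num.
  - exact/measurable_EFinP.
  - exact/measurable_EFinP.
rewrite (@integral_shift_factor _ _ _ (P x) F (fun w => G (path_shift t w)) M)//; last first.
  exact: measurableT_comp mG (measurable_path_shift t).
rewrite (@integral_shift_factor _ _ _ (P x) F (fun w => fine (\int[P (w t)]_v (G v)%:E)) M)//; last 2 first.
- exact: measurableT_comp (measurable_fine_expectation mG G0) (measurable_eval t).
- move=> w; rewrite -!lee_fin fineK ?expectation_fin_num//.
  exact: expectation_itv01.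
congr (_ - _).
  apply: ge0; last by move=> w; have := FM w; rewrite ler_norml => /andP[]; lra.
  exact: (@measurable_funD _ (right_filtered t) R setT F (cst M) mF (measurable_cst _)).
by apply: (ge0 (cst M)) => //; exact: measurable_cst.
Qed.

(** [N] is null from every starting point, in particular from the position at time t. Hence the
    version of the hitting time can be used along the shifted path too. *)
Lemma path_shift_null x t N : (0 <= t)%R -> measurable N -> (forall y, P y N = 0) ->
  P x (path_shift t @^-1` N) = 0.
Proof.
move=> t0 mN N0.
have mtN : measurable (path_shift t @^-1` N).
  by rewrite -[X in measurable X]setTI; exact: measurable_path_shift.
rewrite -[X in P x X]setIT -integral_indic//.
transitivity (\int[P x]_w (1 * (\1_N (path_shift t w))%:E)).
  by apply: eq_integral => w _; rewrite mul1e.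
rewrite (@markov_property _ _ hlevy x t (cst 1) (fun w => (\1_N w)%:E))//.
- rewrite integral0_eq// => w _; rewrite integral_indic// setIT.
  by rewrite [X in _ * X]N0 mule0.
- by apply/measurable_EFinP; exact: measurable_indic.
Qed.

End markov_expectation.

(** * The killed process as the rate tends to 0 *)

Section killed_process.
Context {R : realType} {P : R -> probability (cadlag R) R} {r : R -> R -> R}.
Hypothesis hres : levy_resolvent P r.
Let hlevy := resolvent_levy hres.
Let hr_continuous := @resolvent_continuous _ _ _ hres.
Local Open Scope ereal_scope.
Local Notation H := (compensated r).
Implicit Types (w : cadlag R) (p q t x y M K : R).

Variables (A : set R) (S : cadlag R -> \bar R) (N : set (cadlag R)).
Hypotheses (Fsigma_A : Fsigma A) (A0 : A 0%R).
Hypothesis hv : @hitting_version R P A S N.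

Let oS : optional_time S. Proof. by case: hv. Qed.
Let mN : measurable N. Proof. by case: hv. Qed.
Let N0 y : P y N = 0. Proof. by case: hv. Qed.
Let AS w : ~ N w -> hitting_time A w = S w. Proof. by case: hv => _ _ _; exact. Qed.

Let msurv q : measurable_fun setT (survival q A N).
Proof. exact: measurable_survival hv. Qed.

Let surv01 q w : (0 < q)%R -> (0 <= survival q A N w <= 1)%R.
Proof. by move=> q0; apply: survival_itv; exact: ltW. Qed.

(** The [phi_q] of the overview. The same factor [r q 0] is put on the numerator, so it cancels in
    the conditional probability. *)
Definition scaled_survival q y : R :=
  (r q 0 * fine (\int[P y]_w (survival q A N w)%:E))%R.

Lemma measurable_scaled_survival q : (0 < q)%R -> measurable_fun setT (scaled_survival q).
Proof.
move=> q0; apply: measurable_funM => //; apply: measurable_fine_expectation => //.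
by move=> w; case/andP : (surv01 w q0).
Qed.

Let hit q u : cadlag R -> R := discounted_hit q u A \_ (~` N).

Let mhit q u : continuous u -> measurable_fun setT (hit q u).
Proof. by move=> cu; exact: (measurable_discounted_hit (P := P)) cu hv. Qed.

Let hit_bounded q u M w : (0 <= q)%R -> (forall y, `|u y| <= M)%R -> (`|hit q u w| <= M)%R.
Proof.
move=> q0 uM; rewrite /hit patchE; case: ifPn => _; first exact: discounted_hit_le.
by rewrite normr0 (le_trans _ (uM 0%R)).
Qed.

Let expect_hit q u y : \int[P y]_w (hit q u w)%:E = \int[P y]_w (discounted_hit q u A w)%:E.
Proof. by apply: (integral_off_null mN (N0 y)) => w nw; rewrite /hit patchE mem_set. Qed.

Lemma scaled_survivalE q y : (0 < q)%R ->
  scaled_survival q y =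
  (H q y - fine (\int[P y]_w (discounted_hit q (H q) A w)%:E))%R.
Proof.
move=> q0; have q0' := ltW q0; have mlt := compensated_continuous hres q0.
pose u1 : R -> R := cst 1%R; pose u2 (z : R) : R := r q (0 - z).
have cu2 : continuous u2.
  move=> z; apply: (@continuous_comp _ _ _ (fun z => 0 - z)%R (r q)).
    by apply: (@continuousB _ _ _ (cst 0%R) id); [exact: cvg_cst|exact: cvg_id].
  exact: hr_continuous.
have i1 : (P y).-integrable setT (fun w => (hit q u1 w)%:E).
  apply: (@integrable_bounded _ _ _ _ (hit q u1) 1%R).
    by apply: mhit; exact: cst_continuous.
  by move=> w; apply: hit_bounded => // z; rewrite normr1.
have i2 : (P y).-integrable setT (fun w => (hit q u2 w)%:E).
  apply: (@integrable_bounded _ _ _ _ (hit q u2) (r q 0)); first exact: mhit.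
  move=> w; apply: hit_bounded => // z.
  by rewrite ger0_norm ?(resolvent_ge0 hres)//; exact: (resolvent_le0 hres).
have E2 : \int[P y]_w (hit q u2 w)%:E = (r q (- y))%:E.
  by rewrite expect_hit (resolvent_hitting_eq hres)// sub0r.
have E1 : \int[P y]_w (survival q A N w)%:E = 1 - \int[P y]_w (hit q u1 w)%:E.
  rewrite /survival; under eq_integral do rewrite EFinB.
  rewrite integralB//; last exact: finite_measure_integrable_cst.
  congr (_ - _); rewrite integral_cst// -[RHS]mule1; congr (_ * _).
  exact: probability_setT.
have EH : \int[P y]_w (discounted_hit q (H q) A w)%:E =
    (r q 0)%:E * \int[P y]_w (hit q u1 w)%:E - (r q (- y))%:E.
  rewrite -expect_hit -E2 -integralZl// -integralB//; last exact: integrableZl.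
  apply: eq_integral => w _; rewrite -EFinM -EFinB; congr EFin.
  rewrite /hit !patchE; case: ifPn => _; last by rewrite mulr0 subrr.
  rewrite /discounted_hit; case: ifPn => _; last by rewrite mulr0 subrr.
  by rewrite /u2 /u1 /compensated sub0r /=; ring.
have f1 : \int[P y]_w (hit q u1 w)%:E \is a fin_num by exact: integrable_fin_num i1.
rewrite /scaled_survival EH E1 /compensated -(fineK f1) -EFinM -!EFinB /=; ring.
Qed.

Lemma scaled_survival_ge0 q y : (0 < q)%R -> (0 <= scaled_survival q y)%R.
Proof.
move=> q0; rewrite mulr_ge0 ?(resolvent_ge0 hres)// fine_ge0// integral_ge0// => w _.
by rewrite lee_fin; case/andP : (surv01 w q0).
Qed.

Lemma scaled_survival_le q y : (0 < q)%R -> (scaled_survival q y <= H q y)%R.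
Proof.
move=> q0; rewrite scaled_survivalE// gerBl fine_ge0// integral_ge0// => w _.
rewrite lee_fin /discounted_hit; case: ifPn => // _.
by rewrite mulr_ge0 ?expR_ge0 ?(compensated_ge0 hres).
Qed.

(** The position is only known to lie in the closure of [A]: compare it with a point of [A] at
    distance less than 1. *)
Lemma hitting_position_bounded K w : (forall y, A y -> `|y| <= K)%R ->
  hitting_time A w < +oo -> (`|w (fine (hitting_time A w))| <= K + 1)%R.
Proof.
move=> AK Aoo; have [s As ws] := hitting_time_near (@ltr01 R) Aoo.
have := ler_normB (w s) (w s - w (fine (hitting_time A w)))%R.
by rewrite opprB addrC subrK; have := AK _ As; lra.
Qed.

Section limit.
Variables (h : R -> R) (q_ : nat -> R).
Hypothesis h_limit : forall x, H (q_ n) x @[n --> \oo] --> h x.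
Hypothesis h_continuous : continuous h.
Hypothesis q01 : forall n, (0 < q_ n <= 1)%R.
Hypothesis q_cvg : q_ n @[n --> \oo] --> 0%R.
Hypothesis bounded_A : bounded_set A.

Let q0 n : (0 < q_ n)%R. Proof. by case/andP : (q01 n). Qed.

Let cvg_exp c : expR (- (q_ n * c))%R @[n --> \oo] --> (1%R : R).
Proof.
rewrite -expR0 -oppr0 -(mul0r c); apply: continuous_cvg; first exact: continuous_expR.
by apply: cvgN; apply: cvgM => //; exact: cvg_cst.
Qed.

Lemma cvg_scaled_survival y : scaled_survival (q_ n) y @[n --> \oo] --> phi P h A y.
Proof.
(* [bounded_set] bounds [A] by every number above K, hence K + 1; the second 1 is for the position
   at the hitting time. *)
have [K [_ AK]] := bounded_A.
have AK' z : A z -> (`|z| <= K + 1)%R by move=> Az; apply: AK => //; rewrite ltrDl.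
have [M HM] := compensated_bounded hres (K + 1 + 1)%R.
have M0 : (0 <= M)%R.
  have [k0|/ltW k0] := leP 0%R (K + 1 + 1)%R.
    by apply: le_trans (compensated_ge0 hres 0 (q0 0)) (HM _ _ (q01 0) _); rewrite normr0.
  by have := AK' _ A0; rewrite normr0; lra.
under eq_cvg do rewrite scaled_survivalE//.
rewrite /phi /Rintegral; apply: cvgB; first exact: h_limit.
pose lim w := if hitting_time A w < +oo then h (w (fine (hitting_time A w))) else 0%R.
have -> : \int[P y]_(w in [set w | hitting_time A w < +oo])
    (h (w (fine (hitting_time A w))))%:E = \int[P y]_w (lim w)%:E.
  rewrite integral_mkcond; apply: eq_integral => w _; rewrite patchE /lim.
  case: ifPn => [/set_mem/= -> //|]; rewrite notin_setE /=.
  by move/negP/negbTE => ->.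
have hM w : hitting_time A w < +oo ->
    (forall n, 0 <= H (q_ n) (w (fine (hitting_time A w))) <= M)%R.
  move=> Aoo n; rewrite (compensated_ge0 hres)//= HM//.
  exact: hitting_position_bounded.
have limM w : (0 <= lim w <= M)%R.
  rewrite /lim; case: ifPn => [Aoo|_]; last by rewrite lexx.
  apply/andP; split.
    by apply: (cvgr_to_ge (@h_limit _)); apply: nearW => n; case/andP : (hM w Aoo n).
  by apply: (cvgr_to_le (@h_limit _)); apply: nearW => n; case/andP : (hM w Aoo n).
have dM n w : (`|discounted_hit (q_ n) (H (q_ n)) A w| <= M)%R.
  rewrite /discounted_hit; case: ifPn => [Aoo|_]; last by rewrite normr0.
  have /andP[h0 h1] := hM w Aoo n.
  rewrite ger0_norm ?mulr_ge0 ?expR_ge0// (le_trans _ h1)// ler_piMl//.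
  by rewrite -expR0 ler_expR oppr_le0 mulr_ge0 ?fine_hitting_time_ge0 ?(ltW (q0 n)).
have cd : \int[P y]_w (discounted_hit (q_ n) (H (q_ n)) A w)%:E @[n --> \oo] -->
    \int[P y]_w (lim w)%:E.
  apply: (@cvg_integral_off_null _ _ _ (P y) N _ _ M) => //.
  - by move=> n; apply: mhit; exact: (compensated_continuous hres).
  - move=> w _; rewrite /discounted_hit /lim; case: ifPn => _; last exact: cvg_cst.
    rewrite -[X in _ --> X]mul1r; apply: cvgM; [exact: cvg_exp|exact: h_limit].
have limfin : \int[P y]_w (lim w)%:E \is a fin_num.
  have dI n : 0 <= \int[P y]_w (discounted_hit (q_ n) (H (q_ n)) A w)%:E <= M%:E.
    rewrite -expect_hit; have H0 w : (0 <= hit (q_ n) (H (q_ n)) w)%R.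
      rewrite /hit patchE; case: ifPn => // _; rewrite /discounted_hit; case: ifPn => // _.
      by rewrite mulr_ge0 ?expR_ge0 ?(compensated_ge0 hres).
    rewrite integral_ge0/=; last by move=> w _; rewrite lee_fin.
    apply: (@le_trans _ _ (\int[P y]_w M%:E)); last first.
      by rewrite integral_cst// -[leRHS]mule1 lee_wpmul2l ?lee_fin// probability_le1.
    apply: ge0_le_integral => //.
    - by move=> w _; rewrite lee_fin.
    - by apply/measurable_EFinP; apply: mhit; exact: (compensated_continuous hres).
    - move=> w _; rewrite lee_fin /hit patchE; case: ifPn => // _.
      exact: le_trans (ler_norm _) _.
  rewrite ge0_fin_numE; last first.
    by apply: cvge_ge cd; apply: nearW => n; case/andP : (dI n).
  apply: (@le_lt_trans _ _ M%:E); last by rewrite ltry.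
  by apply: cvge_le cd; apply: nearW => n; case/andP : (dI n).
by apply: fine_cvg; rewrite fineK.
Qed.

Section conditioning.
Variables (x t M : R) (F : cadlag R -> R).
Hypothesis t0 : (0 <= t)%R.
Hypothesis mF : @measurable_fun _ _ (right_filtered t) R setT F.
Hypothesis FM : forall w, (`|F w| <= M)%R.

Let M0 : (0 <= M)%R. Proof. exact: le_trans (FM point). Qed.

Let alive := [set w | t%:E < S w].

Let mFa : @measurable_fun _ _ (right_filtered t) R setT (fun w => F w * \1_alive w)%R.
Proof.
apply: (@measurable_funM _ (right_filtered t) R setT F (\1_alive)) => //.
apply: (@measurable_indic _ (right_filtered t) R setT alive).
by apply: measurable_right_filteredE; exact: optional_time_right_filtration oS.
Qed.

Let FaM w : (`|F w * \1_alive w| <= M)%R.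
Proof.
rewrite normrM -[leRHS]mulr1; apply: ler_pM => //.
by rewrite indicE; case: (_ \in _); rewrite ?normr1 ?normr0.
Qed.

Let mF' : measurable_fun setT F. Proof. exact: measurable_fun_right_filtered mF. Qed.
Let mFa' : measurable_fun setT (fun w => F w * \1_alive w)%R.
Proof. exact: measurable_fun_right_filtered mFa. Qed.

Let defect q w : R := (survival q A N w -
  expR (- (q * t)) * (\1_alive w * survival q A N (path_shift t w)))%R.

(** If the hitting time exceeds t, its discount factorises at t and the defect is exactly 1 -
    exp(-qt); otherwise the defect is the survival itself, which is no larger. Either way it is at
    most the probability that the clock rings before t. *)
Let defect_itv q w : (0 < q)%R -> ~ N w -> ~ N (path_shift t w) ->
  (0 <= defect q w <= q * t)%R.
Proof.
move=> qp nw nsw; have qp' := ltW qp.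
have e1 := expR_ge1Dx (- (q * t)).
have e01 : (expR (- (q * t)) <= 1)%R.
  by rewrite -expR0 ler_expR oppr_le0 mulr_ge0.
rewrite /defect /survival !patchE !mem_set// indicE.
have [ta|/negP ta] := boolP (t%:E < S w).
  rewrite mem_set// mul1r.
  have ta' : t%:E < hitting_time A w by rewrite AS.
  have E : discounted_hit q (cst 1%R) A w =
      (expR (- (q * t)) * discounted_hit q (cst 1%R) A (path_shift t w))%R.
    rewrite /discounted_hit (hitting_time_shift t0 ta').
    have := hitting_time_ge0 A (path_shift t w).
    case: (hitting_time A (path_shift t w)) => [c||]//= _.
      rewrite -EFinD !ltry !mulr1 /= -expRD; congr expR; ring.
    by rewrite mulr0.
  by rewrite E; apply/andP; split; lra.
rewrite memNset// mul0r mulr0 subr0 /discounted_hit.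
move: ta => /negP; rewrite -leNgt -AS// => Tt.
have Too : hitting_time A w < +oo by apply: le_lt_trans Tt _; rewrite ltry.
rewrite Too mulr1 subr_ge0 -expR0 ler_expR oppr_le0 mulr_ge0 ?fine_hitting_time_ge0//=.
have Tt' : (fine (hitting_time A w) <= t)%R by rewrite -lee_fin -hitting_time_fin.
have : (expR (- (q * t)) <= expR (- (q * fine (hitting_time A w))))%R.
  by rewrite ler_expR lerN2 ler_wpM2l.
by rewrite expR0; lra.
Qed.

(** The Markov property turns the survival of the shifted path into [scaled_survival] at [w t]. The
    error comes from the defect, at most q t, multiplied by the bound M on [F] and by [r q 0]. *)
Let survival_estimate q : (0 < q)%R ->
  (`|r q 0 * fine (\int[P x]_w (F w * survival q A N w)%:E) - expR (- (q * t)) *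
     fine (\int[P x]_w (F w * \1_alive w * scaled_survival q (w t))%:E)| <=
   (M * t) * (q * r q 0))%R.
Proof.
move=> qp; have r0 := resolvent_ge0 hres 0 qp.
have msh : measurable_fun setT (fun w => survival q A N (path_shift t w)).
  exact: measurableT_comp (msurv q) (measurable_path_shift t).
have surv_norm w : (`|survival q A N w| <= 1)%R.
  by have /andP[s0 s1] := surv01 w qp; rewrite ger0_norm.
have i1 : (P x).-integrable setT (fun w => (F w * survival q A N w)%:E).
  apply: (@integrable_bounded _ _ _ _ (fun w => F w * survival q A N w)%R (M * 1)%R).
    exact: measurable_funM.
  by move=> w; rewrite normrM; apply: ler_pM.
have i2 : (P x).-integrable setT (fun w =>
    (F w * \1_alive w * survival q A N (path_shift t w))%:E).
  apply: (@integrable_bounded _ _ _ _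
    (fun w => F w * \1_alive w * survival q A N (path_shift t w))%R (M * 1)%R).
    exact: measurable_funM.
  by move=> w; rewrite normrM; apply: ler_pM.
have f1 := integrable_fin_num measurableT i1.
have f2 := integrable_fin_num measurableT i2.
have Ea : \int[P x]_w (F w * \1_alive w * scaled_survival q (w t))%:E =
    (r q 0)%:E * \int[P x]_w (F w * \1_alive w * survival q A N (path_shift t w))%:E.
  rewrite (@markov_property_bounded _ _ hlevy x t _ (survival q A N) M)//; last first.
    by move=> w; exact: surv01.
  rewrite -integralZl//; last first.
    apply: (@integrable_bounded _ _ _ _ (fun w => F w * \1_alive w *
      fine (\int[P (w t)]_v (survival q A N v)%:E))%R (M * 1)%R).
      apply: measurable_funM => //.
      apply: measurableT_comp (measurable_fine_expectation hlevy (msurv q) _) (measurable_eval t).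
      by move=> w; case/andP : (surv01 w qp).
    move=> w; rewrite normrM; apply: ler_pM => //.
    have /andP[s0 s1] := @expectation_itv01 _ P (w t) _ (msurv q) (fun v => surv01 v qp).
    rewrite ger0_norm ?fine_ge0// -lee_fin fineK//.
    exact: expectation_fin_num (fun v => surv01 v qp).
  by apply: eq_integral => w _; rewrite -EFinM /scaled_survival; congr EFin; ring.
rewrite Ea fineM//= mulrCA -mulrBr normrM ger0_norm//.
rewrite [leRHS](_ : _ = r q 0 * (M * (q * t)))%R; last by ring.
rewrite ler_wpM2l//.
have mD : measurable_fun setT (fun w => F w * defect q w)%R.
  apply: measurable_funM => //; apply: measurable_funB => //.
  apply: measurable_funM => //; apply: measurable_funM => //.
  apply: measurable_indic; apply: (@right_filtered_measurable _ t).
  by apply: measurable_right_filteredE; exact: optional_time_right_filtration oS.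
have E3 : \int[P x]_w (F w * defect q w)%:E = \int[P x]_w (F w * survival q A N w)%:E -
    (expR (- (q * t)))%:E * \int[P x]_w (F w * \1_alive w * survival q A N (path_shift t w))%:E.
  rewrite -[X in _ = _ - X]integralZl// -[RHS]integralB//; last exact: integrableZl.
  by apply: eq_integral => w _; rewrite -EFinM -EFinB /defect; congr EFin; ring.
have -> : (fine (\int[P x]_w (F w * survival q A N w)%:E) - expR (- (q * t)) *
    fine (\int[P x]_w (F w * \1_alive w * survival q A N (path_shift t w))%:E))%R =
    fine (\int[P x]_w (F w * defect q w)%:E).
  by rewrite E3; move: f1 f2; case: (\int[P x]_w _) => // a _; case: (\int[P x]_w _).
pose N' := N `|` path_shift t @^-1` N.
have mN' : measurable N'.
  apply: measurableU => //; rewrite -[X in measurable X]setTI.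
  exact: measurable_path_shift.
have N'0 : P x N' = 0.
  apply/negligibleP => //; apply: negligibleU.
    by apply/negligibleP; [exact: mN|exact: N0].
  apply/negligibleP; last exact: (path_shift_null hlevy).
  by rewrite -[X in measurable X]setTI; exact: measurable_path_shift.
pose b := (fun w => F w * defect q w)%R \_ (~` N').
rewrite (_ : \int[P x]_w _ = \int[P x]_w (b w)%:E); last first.
  by apply: (integral_off_null mN' N'0) => w nw; rewrite /b patchE mem_set.
have mb : measurable_fun setT b.
  by apply/(measurable_restrictT _ (measurableC mN')); exact: measurable_funTS.
have qt0 : (0 <= q * t)%R by rewrite mulr_ge0// ltW.
have bM w : (`|b w| <= M * (q * t))%R.
  rewrite /b patchE; case: ifPn => [/set_mem/= nw|_]; last by rewrite normr0 mulr_ge0.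
  have nw1 : ~ N w by move=> ?; apply: nw; left.
  have nw2 : ~ N (path_shift t w) by move=> ?; apply: nw; right.
  have /andP[d0 d1] := defect_itv qp nw1 nw2.
  by rewrite normrM; apply: ler_pM => //; rewrite ger0_norm.
have ib := @integrable_bounded _ _ _ (P x) b _ mb bM.
rewrite -lee_fin -abse_EFin fineK ?(integrable_fin_num measurableT ib)//.
apply: le_trans (le_abse_integral _ measurableT _) _; first exact/measurable_EFinP.
apply: (@le_trans _ _ (\int[P x]_w (M * (q * t))%:E)); last first.
  rewrite integral_cst// -[leRHS]mule1 lee_wpmul2l ?probability_le1// lee_fin.
  exact: mulr_ge0.
apply: ge0_le_integral => //.
- by apply: measurableT_comp => //; exact/measurable_EFinP.
- by move=> w _; rewrite lee_fin.
Qed.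

(** The inequalities 0 <= phi_q <= h_q pass to the limit, so the integrand is dominated by M times h
    at the position at time t, which is integrable. *)
Lemma integrable_killed :
  (P x).-integrable setT (fun w => (F w * \1_alive w * phi P h A (w t))%:E).
Proof.
have ih := integrable_limit_compensated hres h_limit h_continuous q01 t0 x.
have mphi : measurable_fun setT (phi P h A).
  apply: (measurable_fun_cvg (fun n => measurable_scaled_survival (q0 n))) => y _.
  exact: cvg_scaled_survival.
have phi0 y : (0 <= phi P h A y)%R.
  apply: (cvgr_to_ge (@cvg_scaled_survival y)); apply: nearW => n.
  exact: scaled_survival_ge0.
have phih y : (phi P h A y <= h y)%R.
  apply: (ler_cvg_to (@cvg_scaled_survival y) (@h_limit y)); apply: nearW => n.
  exact: scaled_survival_le.
apply: (le_integrable measurableT _ _ (integrableZl measurableT M ih)).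
  apply/measurable_EFinP; apply: measurable_funM => //.
  exact: measurableT_comp mphi (measurable_eval t).
move=> w _; rewrite -EFinM lee_fin normrM normrM (ger0_norm M0).
have h0 y : (0 <= h y)%R by exact: le_trans (phi0 y) (phih y).
by apply: ler_pM => //; rewrite !ger0_norm.
Qed.

Lemma cvg_expect_survival :
  (r (q_ n) 0 * fine (\int[P x]_w (F w * survival (q_ n) A N w)%:E))%R @[n --> \oo] -->
  fine (\int[P x]_w (F w * \1_alive w * phi P h A (w t))%:E).
Proof.
have cJ : fine (\int[P x]_w (F w * \1_alive w * scaled_survival (q_ n) (w t))%:E)
    @[n --> \oo] --> fine (\int[P x]_w (F w * \1_alive w * phi P h A (w t))%:E).
  apply: fine_cvg; rewrite fineK ?(integrable_fin_num measurableT integrable_killed)//.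
  apply: (cvg_expect_dominated hres h_limit h_continuous q01 q_cvg t0 (M := M)
    (Z := (fun w => F w * \1_alive w)%R) (g_ := fun n => scaled_survival (q_ n))) => //.
  - by move=> n; exact: measurable_scaled_survival.
  - by move=> n y; rewrite scaled_survival_ge0//= scaled_survival_le.
  - by move=> y; exact: cvg_scaled_survival.
set I := fun n : nat => (r (q_ n) 0 * fine _)%R; set L := fine _ in cJ *.
set J := fun n : nat => fine _ in cJ.
have cE : (expR (- (q_ n * t)) * J n)%R @[n --> \oo] --> L.
  by rewrite -[L]mul1r; apply: cvgM => //; exact: cvg_exp.
have cr : (M * t * (q_ n * r (q_ n) 0))%R @[n --> \oo] --> (0%R : R).
  have cq : (q_ n * r (q_ n) 0)%R @[n --> \oo] --> (0%R : R).
    by have /cvg_at_rightP := cvg_rate_resolvent0 hres; apply; split.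
  suff : (M * t * (q_ n * r (q_ n) 0))%R @[n --> \oo] --> (M * t * 0)%R by rewrite mulr0.
  by apply: cvgM => //; exact: cvg_cst.
have cd : (I n - expR (- (q_ n * t)) * J n)%R @[n --> \oo] --> (0%R : R).
  apply/norm_cvg0P.
  apply: (@squeeze_cvgr _ _ _ _ (cst 0%R) (fun n => M * t * (q_ n * r (q_ n) 0))%R) => //.
    by apply: nearW => n; rewrite normr_ge0 survival_estimate.
  exact: cvg_cst.
rewrite -[L]add0r; have -> : I = (fun n => (I n - expR (- (q_ n * t)) * J n) +
    expR (- (q_ n * t)) * J n)%R by apply/funext => n; rewrite subrK.
exact: cvgD.
Qed.

End conditioning.

End limit.

End killed_process.

(** The uniform bounds concern rates in ]0, 1]. A sequence tending to 0 is eventually there, so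
    cutting it at 1 does not affect the limit. *)
Lemma cvg_at_right0_small (R : realType) (f : R -> R) (l : R) :
  (forall u : nat -> R, (forall n, 0 < u n <= 1) -> u n @[n --> \oo] --> 0 ->
    f (u n) @[n --> \oo] --> l) ->
  f q @[q --> 0^'+] --> l.
Proof.
move=> fl; apply/cvg_at_rightP => u [u0 u_cvg].
pose v n := Num.min (u n) 1.
have near_v : \forall n \near \oo, v n = u n.
  have /cvgrPdist_lt /(_ _ (@ltr01 R)) := u_cvg; apply: filterS => n.
  by rewrite sub0r normrN gtr0_norm// => un1; apply/min_idPl; exact: ltW.
have v_cvg : v n @[n --> \oo] --> 0.
  by apply: cvg_trans u_cvg; apply: near_eq_cvg; apply: filterS near_v => n ->.
have v01 n : 0 < v n <= 1 by rewrite lt_min u0 ltr01 ge_min lexx orbT.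
apply: cvg_trans (fl v v01 v_cvg); apply: near_eq_cvg.
by apply: filterS near_v => n ->.
Qed.

Local Open Scope complex_scope.

Theorem theorem1p3 (R : realType) (P : R -> probability (cadlag R) R)
  (Psi : R -> R[i]) (r : R -> R -> R) (h : R -> R)
  (d : measure_display) (T : measurableType d) (Q : R -> probability T R)
  (Y : T -> cadlag R) (e : R -> T -> R) (A : set R)
  (hlevy : levy_family P)
  (hPsi : characteristic_exponent P Psi)
  (hrec : recurrent P)
  (hreg : forall x : R, regular_for_itself P x)
  (hA : forall q : R, 0 < q ->
    (\int[lebesgue_measure]_(l in `[0%R, +oo[)
       (complex.Re `|(q%:C + Psi l)^-1|)%:E < +oo)%E)
  (hr_bounded : forall q : R, 0 < q -> exists M : R, forall x : R, `|r q x| <= M)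
  (hr_continuous : forall q : R, 0 < q -> continuous (r q))
  (hr_density : forall q : R, 0 < q -> resolvent_density P q (r q))
  (hh_limit : forall x : R, (r q 0 - r q (- x)) @[q --> 0^'+] --> h x)
  (hh_continuous : continuous h)
  (hclocks : exponential_clocks P Q Y e)
  (hA_bounded : bounded_set A)
  (hA_Fsigma : Fsigma A)
  (hA0 : A 0)
  (t : R) (ht : 0 <= t)
  (F : cadlag R -> R)
  (hF_bounded : exists M : R, forall w : cadlag R, `|F w| <= M)
  (hF_measurable : forall B : set R,
    measurable B -> right_filtration t (F @^-1` B))
  (x : R) (hx : phi P h A x != 0) :
  (elementary_cond_exp (Q x) (F \o Y)
     [set v : T | ((e q v)%:E < hitting_time A (Y v))%E])%:E @[q --> 0^'+] -->
  (\int[P x]_(w in [set w : cadlag R | (t%:E < hitting_time A w)%E])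
     (F w * (phi P h A (w t) / phi P h A x))%:E)%E.
Proof.
have hres := LevyResolvent hlevy hr_bounded hr_continuous hr_density.
have [S [N hv]] : exists S N, @hitting_version R P A S N.
  have [B cB [_ ->]] := Fsigma_nondecreasing hA_Fsigma.
  have BSN := hitting_version_bigcup (fun n => hitting_version_closed hlevy (cB n)).
  by eexists; eexists; exact: BSN.
have [oS mN N0 AS] := hv.
have [M FM] := hF_bounded.
have mF : @measurable_fun _ _ (right_filtered t) R setT F.
  by move=> _ B mB; rewrite setTI; apply: measurable_right_filteredE; exact: hF_measurable.
have mF' := measurable_fun_right_filtered mF.
have seq_limit (u : nat -> R) : (forall n, 0 < u n <= 1) -> u n @[n --> \oo] --> 0 ->
    forall y, compensated r (u n) y @[n --> \oo] --> h y.
  move=> u01 u0 y; have /cvg_at_rightP := hh_limit y; apply; split=> // n.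
  by case/andP : (u01 n).
(* Any sequence of rates would do here: the integrability of the limit is required before the
   sequence tending to 0 is chosen. *)
pose u0 n : R := n.+1%:R^-1.
have u0_01 n : 0 < u0 n <= 1 by rewrite /u0 invr_gt0 ltr0n/= invf_le1 ?ltr0n// ler1n.
have u0_cvg : u0 n @[n --> \oo] --> 0 by exact: cvg_harmonic.
pose killed w := F w * \1_[set w | (t%:E < S w)%E] w * phi P h A (w t).
have ikilled : (P x).-integrable setT (fun w => (killed w)%:E).
  apply: (integrable_killed hres hA_Fsigma hA0 hv (seq_limit _ u0_01 u0_cvg)
    hh_continuous u0_01 u0_cvg hA_bounded x ht mF FM).
(* Outside [N] the hitting time is [S]; the integral being finite, the constant [phi P h A x] can
   leave it. *)
have -> : (\int[P x]_(w in [set w : cadlag R | (t%:E < hitting_time A w)%E])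
     (F w * (phi P h A (w t) / phi P h A x))%:E)%E =
    (fine (\int[P x]_w (killed w)%:E)%E / phi P h A x)%:E.
  rewrite EFinM fineK; last exact: integrable_fin_num ikilled.
  rewrite -integralZr// [LHS]integral_mkcond.
  apply: (integral_off_null mN (N0 x)) => w nw.
  rewrite patchE /killed indicE -EFinM.
  have -> : (w \in [set w : cadlag R | (t%:E < hitting_time A w)%E]) =
      (w \in [set w | (t%:E < S w)%E]).
    by apply/idP/idP => /set_mem/=; rewrite ?AS// => ?; rewrite mem_set//= ?AS.
  by case: ifPn => _; rewrite ?mulr1 ?mulr0 ?mul0r// mulrA.
apply: cvg_EFin; first exact: nearW.
apply: cvg_at_right0_small => u u01 u_cvg.
have up n : 0 < u n by case/andP : (u01 n).
have num := cvg_expect_survival hres hA_Fsigma hA0 hv (seq_limit _ u01 u_cvg)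
  hh_continuous u01 u_cvg hA_bounded (x := x) ht mF FM.
have den : scaled_survival (P := P) (r := r) A N (u n) x @[n --> \oo] --> phi P h A x.
  exact: (cvg_scaled_survival hres hA_Fsigma hA0 hv (seq_limit _ u01 u_cvg) u01 u_cvg hA_bounded).
(* Numerator and denominator are both multiplied by [r (u n) 0], and the denominator is the
   numerator for the constant functional 1. *)
have E n : elementary_cond_exp (Q x) (F \o Y)
     [set v : T | ((e (u n) v)%:E < hitting_time A (Y v))%E] =
    (r (u n) 0 * fine (\int[P x]_w (F w * survival (u n) A N w)%:E)) /
    scaled_survival (P := P) (r := r) A N (u n) x.
  rewrite /elementary_cond_exp /Rintegral /=.
  rewrite (expect_before_clock hclocks hv x (up n) mF' FM).
  rewrite (expect_before_clock hclocks hv x (up n) (Z := cst 1) (M := 1))//; last first.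
    by move=> w; rewrite normr1.
  under [X in _ / fine X]eq_integral do rewrite mul1r.
  by rewrite /scaled_survival invfM mulrACA mulfV ?mul1r// gt_eqF// (resolvent0_gt0 hres).
under eq_cvg do rewrite E.
by apply: cvgM => //; exact: cvgV.
Qed.
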